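(* Let $\Bbbk$ be a field of characteristic $0$, $n$ a positive integer, and let $\cdots\to F_3\to F_2\to F_1\to F_0\to S/\det_n^\perp\to0$ be the minimal graded free resolution of $S/\det_n^\perp$. The degree $4$ component of $F_3$ is isomorphic as a $G_{\det_n}$-representation to $$\big((V_{(2,1,1)}\otimes W_{(4)})\oplus(V_{(4)}\otimes W_{(2,1,1)})\big)\oplus(V_{(3,1)}\otimes W_{(3,1)}),$$ the direct sum of two irreducible $G_{\det_n}$-representations.
   Context: Let $V\cong W\cong\Bbbk^n$, $M_n(\Bbbk)=V\otimes W$ with standard basis $X_{i,j}$, $S=\operatorname{Sym}^*M_n(\Bbbk)=\Bbbk[X_{i,j}]$, and $R=\Bbbk[x_{i,j}]$ the polynomial ring on the dual basis. $S$ acts on $R$ by identifying $X_{i,j}$ with $x_{i,j}^{-1}$: for monomials $g\in S$, $f\in R$, $g\star f=gf$ if this lies in $R$, and $0$ otherwise, extended bilinearly. With $\det_n\in R$ the determinant of the matrix $(x_{i,j})$, the apolar ideal is $\det_n^\perp=\{g\in S:g\star\det_n=0\}$. $G_{\det_n}=(\operatorname{GL}(V)\times\operatorname{GL}(W))/\Bbbk^*\rtimes\mathbb Z/2$, where $\Bbbk^*$ is embedded as pairs $(\alpha I_n,\alpha^{-1}I_n)$; $(A,B)$ acts on $M_n(\Bbbk)$ by $M\mapsto AMB^\top$ and the nontrivial element of $\mathbb Z/2$ by $M\mapsto M^\top$. This group preserves $\det_n$ up to scaling, so it acts on $S$ and on $\det_n^\perp$, and the minimal graded free resolution is naturally a resolution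 of $G_{\det_n}$-representations. The degree $4$ component of $F_3$ is the space of linear second syzygies. A representation of $G_{\det_n}$ is the same as a $\operatorname{GL}(V)\times\operatorname{GL}(W)$-representation $Q$ on which $\Bbbk^*$ acts trivially, together with an involution $\iota:Q\to Q$ (corresponding to the transpose) with $(g_1,g_2)\cdot\iota(q)=\iota((g_2,g_1)\cdot q)$. For a highest weight $\lambda:\lambda_1\ge\cdots\ge\lambda_n$ (trailing zeros are omitted in the notation), $V_\lambda$ (resp. $W_\lambda$) is the irreducible $\operatorname{GL}(V)$- (resp. $\operatorname{GL}(W)$-) representation of highest weight $\lambda$. An irreducible representation of $G_{\det_n}$ has either the form $V_\lambda\otimes W_\lambda$ for a highest weight $\lambda$, or the form $(V_\lambda\otimes W_\eta)\oplus(V_\eta\otimes W_\lambda)$ for a pair of distinct highest weights $\lambda,\eta$ with $\lambda_1+\cdots+\lambda_n=\eta_1+\cdots+\eta_n$.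
   Formalization: V_λ is taken to be 0 if λ has more than n parts, so the first summand is claimed irreducible only for n ≥ 3 and V_(3,1)⊗W_(3,1) only for n ≥ 2 (they vanish otherwise); the involution on V_(3,1)⊗W_(3,1) is specified as minus the swap. *)

(* Defs.v *)
From HB Require Import structures.
From mathcomp Require Import all_boot all_order all_algebra.
From mathcomp Require Import generic_quotient ring_quotient.
From mathcomp Require Export mpoly.

Set Implicit Arguments.
Unset Strict Implicit.
Unset Printing Implicit Defensive.

Import GRing.Theory.

Local Open Scope ring_scope.
Local Open Scope quotient_scope.

(* S = Sym M_n(k) = k[X_ij] and R = k[x_ij] are both polynomial rings in n^2
   variables, the (i, j) variable being number [mxvec_index i j]; they share
   the type [mat_poly k n]. *)
Notation mat_poly k n := {mpoly k[(n * n)%N]}.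

Definition generic_mx (k : fieldType) (n : nat) : 'M[mat_poly k n]_n :=
  \matrix_(i, j) 'X_(mxvec_index i j).

Definition det_poly (k : fieldType) (n : nat) : mat_poly k n :=
  \det (generic_mx k n).

(* The action g * f of S on R: bilinear, with X^a * x^b = x^(b - a) if a <= b
   pointwise and X^a * x^b = 0 otherwise. *)
Definition contract (k : fieldType) (N : nat) (g f : {mpoly k[N]}) :
    {mpoly k[N]} :=
  \sum_(a <- msupp g) \sum_(b <- msupp f | (a <= b)%MM)
    (g@_a * f@_b) *: 'X_[b - a].

Definition det_perp (k : fieldType) (n : nat) (g : mat_poly k n) : bool :=
  contract g (det_poly k n) == 0.

Section Apolar.
Variables (k : fieldType) (N : nat).
Implicit Types f g h : {mpoly k[N]}.

Lemma sum_msupp_widen g (s : seq 'X_{1..N}) (F : 'X_{1..N} -> k) :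
  uniq s -> {subset msupp g <= s} ->
  \sum_(a <- msupp g) g@_a * F a = \sum_(a <- s) g@_a * F a.
Proof.
move=> us sub; rewrite [RHS](bigID (mem (msupp g))) /= [X in _ + X]big1 ?addr0.
  rewrite -[RHS]big_filter; apply: perm_big; apply: uniq_perm.
  - exact: msupp_uniq.
  - exact: filter_uniq.
  by move=> a; rewrite mem_filter andb_idr //; apply: sub.
by move=> a; rewrite -mcoeff_eq0 => /eqP ->; rewrite mul0r.
Qed.

Lemma mcoeff_contract g f m :
  (contract g f)@_m = \sum_(a <- msupp g) g@_a * f@_(a + m).
Proof.
rewrite /contract raddf_sum /=; apply: eq_bigr => a _.
rewrite raddf_sum /=.
have [mf|mf] := boolP ((a + m)%MM \in msupp f).
  rewrite big_mkcond (bigD1_seq (a + m)%MM) ?msupp_uniq //= lem_addr.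
  rewrite mcoeffZ mcoeffX {2}addmC addmK eqxx mulr1 big1 ?addr0 // => b neb.
  case: ifP => // leab; rewrite mcoeffZ mcoeffX.
  case: eqP => [Eb|_]; last by rewrite mulr0.
  by case/eqP: neb; rewrite -Eb addmC submK.
rewrite (eqP (_ : f@_(a + m) == 0)) ?mcoeff_eq0 // mulr0 big_seq_cond big1 //.
move=> b /andP[bf leab]; rewrite mcoeffZ mcoeffX.
case: eqP => [Eb|_]; last by rewrite mulr0.
by move: mf; rewrite -Eb addmC submK // bf.
Qed.

Lemma contractDl g h f : contract (g + h) f = contract g f + contract h f.
Proof.
apply/mpolyP => m; rewrite mcoeffD !mcoeff_contract.
pose s := undup (msupp g ++ msupp h).
have us : uniq s by apply: undup_uniq.
rewrite (@sum_msupp_widen (g + h) s) //; last first.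
  by move=> a /msuppD_le; rewrite mem_undup.
rewrite (@sum_msupp_widen g s) //; last first.
  by move=> a ag; rewrite mem_undup mem_cat ag.
rewrite (@sum_msupp_widen h s) //; last first.
  by move=> a ah; rewrite mem_undup mem_cat ah orbT.
by rewrite -big_split; apply: eq_bigr => a _ /=; rewrite mcoeffD mulrDl.
Qed.

Lemma contract0l f : contract 0 f = 0.
Proof. by rewrite /contract msupp0 big_nil. Qed.

Lemma contractZl c g f : contract (c *: g) f = c *: contract g f.
Proof.
apply/mpolyP => m; rewrite mcoeffZ !mcoeff_contract.
rewrite (@sum_msupp_widen (c *: g) (msupp g)) //; last exact: msuppZ_le.
by rewrite mulr_sumr; apply: eq_bigr => a _; rewrite mcoeffZ mulrA.
Qed.

Lemma mcoeff_contractMX g f m m' :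
  (contract (g * 'X_[m]) f)@_m' = (contract g f)@_(m + m').
Proof.
rewrite !mcoeff_contract (perm_big _ (msuppMX _ _)) big_map /=.
apply: eq_bigr => a _; rewrite mcoeffMX; congr (_ * f@__).
by rewrite [(m + a)%MM]addmC addmA.
Qed.

Lemma contract1l f : contract 1 f = f.
Proof.
apply/mpolyP => m; rewrite mcoeff_contract msupp1 big_seq1.
by rewrite mcoeff1 eqxx mul1r add0m.
Qed.

Lemma contractM0 u g f : contract g f = 0 -> contract (u * g) f = 0.
Proof.
move=> g0; elim/mpolyind: u => [|c m p _ _ IH]; first by rewrite mul0r contract0l.
rewrite mulrDl contractDl IH addr0 -scalerAl contractZl mulrC.
suff -> : contract (g * 'X_[m]) f = 0 by rewrite scaler0.
by apply/mpolyP => m'; rewrite mcoeff_contractMX g0 !mcoeff0.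
Qed.

End Apolar.

Lemma det_poly_neq0 (k : fieldType) n : det_poly k n != 0.
Proof.
pose v : 'I_(n * n) -> k := fun l => mxvec (1%:M : 'M_n) 0 l.
apply/eqP => /(congr1 (meval v)); rewrite meval0 -det_map_mx.
rewrite (_ : map_mx _ _ = 1%:M) ?det1; first by move/eqP; rewrite oner_eq0.
by apply/matrixP => i j; rewrite /generic_mx !mxE /=; rewrite mevalXU /v mxvecE mxE.
Qed.

Lemma det_perp_idealr (k : fieldType) n : idealr_closed (@det_perp k n).
Proof.
split; first by rewrite unfold_in /det_perp contract0l.
  by rewrite unfold_in /det_perp contract1l det_poly_neq0.
move=> a u v; rewrite !unfold_in /det_perp => /eqP u0 /eqP v0.
by rewrite contractDl v0 addr0 contractM0.
Qed.

HB.instance Definition _ (k : fieldType) (n : nat) :=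
  isIdealr.Build (mat_poly k n) (@det_perp k n) (@det_perp_idealr k n).

Definition det_perp_ideal (k : fieldType) (n : nat) : idealr (mat_poly k n) :=
  @det_perp k n.

(* S / det_n^perp *)
Notation apolar_alg k n := {ideal_quot (det_perp_ideal k n)}.
Definition apolar_proj (k : fieldType) (n : nat) (s : mat_poly k n) :
  apolar_alg k n := \pi s.

Definition subst_mx (k : fieldType) (n : nat) (M : 'M[mat_poly k n]_n)
    (s : mat_poly k n) : mat_poly k n :=
  s \mPo [tuple mxvec M 0 l | l < (n * n)%N].

(* As (A, B) sends E_ij to A E_ij B^T = \sum_(a, b) A_ai B_bj E_ab, it
   substitutes A^T X B for the generic matrix X = (X_ij); similarly the
   transposition substitutes X^T. *)
Definition act_S (k : fieldType) (n : nat) (A B : 'M[k]_n) :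
    mat_poly k n -> mat_poly k n :=
  subst_mx ((map_mx (@mpolyC _ k) A)^T *m generic_mx k n *m map_mx (@mpolyC _ k) B).

Definition swap_S (k : fieldType) (n : nat) : mat_poly k n -> mat_poly k n :=
  subst_mx (generic_mx k n)^T.

(* [act] and [iota] define an action of (GL(V) x GL(W)) : Z/2 on T, where
   V = W = k^n; the values of [act] outside invertible matrices are junk. *)
Definition is_swap_action (k : fieldType) (n : nat) (T : Type)
    (act : 'M[k]_n -> 'M[k]_n -> T -> T) (iota : T -> T) : Prop :=
  [/\ forall x, act 1%:M 1%:M x = x,
      forall A A' B B' x,
        A \in unitmx -> A' \in unitmx -> B \in unitmx -> B' \in unitmx ->
        act (A *m A') (B *m B') x = act A B (act A' B' x),
      involutive iota
    & forall A B x, A \in unitmx -> B \in unitmx ->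
        act A B (iota x) = iota (act B A x)].

(* The subgroup k^* of the pairs (c I, c^-1 I) acts trivially, i.e. the action
   factors through G_det. *)
Definition central_trivial (k : fieldType) (n : nat) (T : Type)
    (act : 'M[k]_n -> 'M[k]_n -> T -> T) : Prop :=
  forall (c : k) x, c != 0 -> act c%:M c^-1%:M x = x.

(* F_i is the module of row vectors S^(rank i), the j-th basis vector being
   placed in degree [deg j]; d_(i+1) : F_(i+1) -> F_i is v |-> v *m diff i and
   aug : F_0 -> S / det_n^perp is the augmentation. *)

Definition homogeneous (k : fieldType) (N r : nat) (deg : 'I_r -> nat) (d : nat)
    (v : 'rV[{mpoly k[N]}]_r) : Prop :=
  forall j m, m \in msupp (v 0 j) -> (mdeg m + deg j)%N = d.

Record graded_free_resolution (k : fieldType) (n : nat) := GradedFreeResolution {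
  rank : nat -> nat;
  deg : forall i, 'I_(rank i) -> nat;
  diff : forall i, 'M[mat_poly k n]_(rank i.+1, rank i);
  aug : 'rV[mat_poly k n]_(rank 0) -> apolar_alg k n;
  diff_graded : forall i d (v : 'rV_(rank i.+1)),
    homogeneous (@deg i.+1) d v -> homogeneous (@deg i) d (v *m diff i);
  aug_linear : forall s x y,
    aug (s *: x + y) = apolar_proj s * aug x + aug y;
  aug_graded : forall d v, homogeneous (@deg 0%N) d v ->
    exists2 s : mat_poly k n, s \is d.-homog & aug v = apolar_proj s;
  aug_surj : forall q, exists v, aug v = q;
  exact_aug : forall v : 'rV_(rank 0),
    aug v = 0 <-> exists w, v = w *m diff 0;
  exact_diff : forall i (v : 'rV_(rank i.+1)),
    v *m diff i = 0 <-> exists w, v = w *m diff i.+1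
}.

Arguments deg {k n} F i j : rename.
Arguments diff {k n} F i : rename.
Arguments aug {k n} F v : rename.

(* d(F_(i+1)) is contained in (X_ij) F_i. *)
Definition minimal (k : fieldType) (n : nat) (F : graded_free_resolution k n) :=
  forall i a b, (diff F i a b)@_0%MM = 0.

Record equivariant_structure (k : fieldType) (n : nat)
    (F : graded_free_resolution k n) := EquivariantStructure {
  res_act : forall i, 'M[k]_n -> 'M[k]_n ->
    'rV[mat_poly k n]_(rank F i) -> 'rV[mat_poly k n]_(rank F i);
  res_swap : forall i,
    'rV[mat_poly k n]_(rank F i) -> 'rV[mat_poly k n]_(rank F i);
  res_action : forall i, is_swap_action (@res_act i) (@res_swap i);
  res_central : forall i, central_trivial (@res_act i);
  res_act_semilinear : forall i A B s x y, A \in unitmx -> B \in unitmx ->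
    @res_act i A B (s *: x + y) = act_S A B s *: @res_act i A B x + @res_act i A B y;
  res_swap_semilinear : forall i s x y,
    @res_swap i (s *: x + y) = swap_S s *: @res_swap i x + @res_swap i y;
  res_act_graded : forall i A B d v, A \in unitmx -> B \in unitmx ->
    homogeneous (deg F i) d v -> homogeneous (deg F i) d (@res_act i A B v);
  res_swap_graded : forall i d v,
    homogeneous (deg F i) d v -> homogeneous (deg F i) d (@res_swap i v);
  diff_act : forall i A B v, A \in unitmx -> B \in unitmx ->
    @res_act i A B (v *m diff F i) = @res_act i.+1 A B v *m diff F i;
  diff_swap : forall i v,
    @res_swap i (v *m diff F i) = @res_swap i.+1 v *m diff F i;
  aug_act : forall A B v s, A \in unitmx -> B \in unitmx ->
    aug F v = apolar_proj s -> aug F (@res_act 0%N A B v) = apolar_proj (act_S A B s);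
  aug_swap : forall v s,
    aug F v = apolar_proj s -> aug F (@res_swap 0%N v) = apolar_proj (swap_S s)
}.

Arguments res_act {k n F} E i A B v : rename.
Arguments res_swap {k n F} E i v : rename.

Definition is_subspace (k : fieldType) (U : lmodType k) (P : U -> Prop) : Prop :=
  P 0 /\ forall c x y, P x -> P y -> P (c *: x + y).

(* U is nonzero, and 0 and U are its only subspaces satisfying [stable]. *)
Definition simple_for (k : fieldType) (U : lmodType k)
    (stable : (U -> Prop) -> Prop) : Prop :=
  (exists x : U, x != 0) /\
  forall P, is_subspace P -> stable P ->
    (forall x, P x -> x = 0) \/ (forall x, P x).

(* Rational representations of GL_n(k) on k^N: the entries are of the form
   (polynomial in the entries of A) / (power of \det A). *)
Record gl_rep (k : fieldType) (n : nat) := GLRep {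
  gl_dim : nat;
  gl_mx : 'M[k]_n -> 'M[k]_gl_dim;
  gl_mx1 : gl_mx 1%:M = 1%:M;
  gl_mxM : forall A B, A \in unitmx -> B \in unitmx ->
    gl_mx (A *m B) = gl_mx A *m gl_mx B;
  gl_rational : exists (e : nat) (p : 'M[mat_poly k n]_gl_dim),
    forall A, A \in unitmx -> forall i j,
      \det A ^+ e * gl_mx A i j = (p i j).@[fun l => mxvec A 0 l]
}.

Definition gl_irreducible (k : fieldType) (n : nat) (V : gl_rep k n) : Prop :=
  @simple_for k 'cV[k]_(gl_dim V) (fun P =>
    forall A x, A \in unitmx -> P x -> P (gl_mx V A *m x)).

Definition upper_unitriangular (k : fieldType) (n : nat) (A : 'M[k]_n) : Prop :=
  forall i j : 'I_n, (j <= i)%N -> A i j = (i == j)%:R.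

Definition has_highest_weight (k : fieldType) (n : nat) (lam : seq nat)
    (V : gl_rep k n) : Prop :=
  exists v : 'cV[k]_(gl_dim V),
    [/\ v != 0,
        forall A, upper_unitriangular A -> gl_mx V A *m v = v
      & forall t : 'rV[k]_n, (forall i, t 0 i != 0) ->
          gl_mx V (diag_mx t) *m v = (\prod_i t 0 i ^+ nth 0%N lam i) *: v].

(* V is V_lam, for a partition lam without trailing zeros; V_lam = 0 if lam
   has more than n parts. *)
Definition is_V (k : fieldType) (n : nat) (lam : seq nat) (V : gl_rep k n) : Prop :=
  if (size lam <= n)%N then gl_irreducible V /\ has_highest_weight lam V
  else gl_dim V = 0%N.

Record swap_rep (k : fieldType) (n : nat) := SwapRep {
  swap_space : lmodType k;
  swap_act : 'M[k]_n -> 'M[k]_n -> swap_space -> swap_space;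
  swap_iota : swap_space -> swap_space;
  swap_action : is_swap_action swap_act swap_iota;
  swap_act_linear : forall A B c x y, A \in unitmx -> B \in unitmx ->
    swap_act A B (c *: x + y) = c *: swap_act A B x + swap_act A B y;
  swap_iota_linear : forall c x y,
    swap_iota (c *: x + y) = c *: swap_iota x + swap_iota y
}.

Definition gdet_irreducible (k : fieldType) (n : nat) (Q : swap_rep k n) : Prop :=
  central_trivial (@swap_act _ _ Q) /\
  @simple_for k (swap_space Q) (fun P =>
    (forall A B x, A \in unitmx -> B \in unitmx -> P x -> P (swap_act A B x)) /\
    (forall x, P x -> P (swap_iota x))).

(* V (x) W is realised on the matrices: v (x) w is v w^T, on which (A, B) acts
   by M |-> V(A) M W(B)^T, and w (x) v is its transpose. *)
Section Constructions.
Variables (k : fieldType) (n : nat).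
Implicit Types V W : gl_rep k n.

Definition tensor_act V W (A B : 'M[k]_n) (M : 'M[k]_(gl_dim V, gl_dim W)) :=
  gl_mx V A *m M *m (gl_mx W B)^T.

Lemma tensor_act1 V W (M : 'M[k]_(gl_dim V, gl_dim W)) :
  tensor_act 1%:M 1%:M M = M.
Proof. by rewrite /tensor_act !gl_mx1 trmx1 mul1mx mulmx1. Qed.

Lemma tensor_actM V W A A' B B' (M : 'M[k]_(gl_dim V, gl_dim W)) :
  A \in unitmx -> A' \in unitmx -> B \in unitmx -> B' \in unitmx ->
  tensor_act (A *m A') (B *m B') M = tensor_act A B (tensor_act A' B' M).
Proof. by move=> *; rewrite /tensor_act !gl_mxM // trmx_mul !mulmxA. Qed.

Lemma tensor_act_linear V W A B c (M N : 'M[k]_(gl_dim V, gl_dim W)) :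
  tensor_act A B (c *: M + N) = c *: tensor_act A B M + tensor_act A B N.
Proof. by rewrite /tensor_act mulmxDr mulmxDl -scalemxAr -scalemxAl. Qed.

Lemma tensor_act_tr V W A B (M : 'M[k]_(gl_dim V, gl_dim W)) :
  (tensor_act A B M)^T = tensor_act B A M^T.
Proof. by rewrite /tensor_act !trmx_mul trmxK mulmxA. Qed.

(* (V_lam (x) W_eta) (+) (V_eta (x) W_lam), with the involution exchanging
   v (x) w and w (x) v. *)
Section Pair.
Variables V W : gl_rep k n.
Let U : lmodType k :=
  ('M[k]_(gl_dim V, gl_dim W) * 'M[k]_(gl_dim W, gl_dim V))%type.

Definition pair_act A B (x : U) : U := (tensor_act A B x.1, tensor_act A B x.2).
Definition pair_iota (x : U) : U := (x.2^T, x.1^T).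

Lemma pair_action : is_swap_action pair_act pair_iota.
Proof.
split=> [[x y]|A A' B B' [x y] *|[x y]|A B [x y] *].
- by rewrite /pair_act !tensor_act1.
- by rewrite /pair_act !tensor_actM.
- by rewrite /pair_iota !trmxK.
- by rewrite /pair_act /pair_iota /= !tensor_act_tr.
Qed.

Lemma pair_act_linear A B c (x y : U) : A \in unitmx -> B \in unitmx ->
  pair_act A B (c *: x + y) = c *: pair_act A B x + pair_act A B y.
Proof. by move=> _ _; rewrite /pair_act /= !tensor_act_linear. Qed.

Lemma pair_iota_linear c (x y : U) :
  pair_iota (c *: x + y) = c *: pair_iota x + pair_iota y.
Proof. by rewrite /pair_iota /= !linearP. Qed.

Definition pair_rep : swap_rep k n :=
  SwapRep pair_action pair_act_linear pair_iota_linear.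
End Pair.

(* V_lam (x) W_lam. Its GL(V) x GL(W)-structure extends to G_det in exactly two
   ways, the involution being v (x) w |-> w (x) v up to a sign; these two
   representations are not isomorphic. The minus sign ([odd = true]) is the one
   occurring in the second syzygies: the highest weight vector
   X12^X21 (x) X11^2 + X11^X12 (x) X11 X21 - X11^X21 (x) X11 X12
   of weight ((3,1), (3,1)) is negated by the transposition. *)
Section Square.
Variables (odd : bool) (V : gl_rep k n).
Let U : lmodType k := 'M[k]_(gl_dim V, gl_dim V).

Definition square_act A B (x : U) : U := tensor_act A B x.
Definition square_iota (x : U) : U := (-1) ^+ odd *: x^T.

Lemma square_action : is_swap_action square_act square_iota.
Proof.
split=> [x|A A' B B' x *|x|A B x _ _].
- exact: tensor_act1.
- exact: tensor_actM.
- by rewrite /square_iota linearZ /= trmxK scalerA -expr2 sqrr_sign scale1r.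
- by rewrite /square_act /square_iota tensor_act_tr /tensor_act -scalemxAr -scalemxAl.
Qed.

Lemma square_act_linear A B c (x y : U) : A \in unitmx -> B \in unitmx ->
  square_act A B (c *: x + y) = c *: square_act A B x + square_act A B y.
Proof. by move=> _ _; apply: tensor_act_linear. Qed.

Lemma square_iota_linear c (x y : U) :
  square_iota (c *: x + y) = c *: square_iota x + square_iota y.
Proof. by rewrite /square_iota linearP scalerDr !scalerA mulrC. Qed.

Definition square_rep : swap_rep k n :=
  SwapRep square_action square_act_linear square_iota_linear.
End Square.

Section DirectSum.
Variables P Q : swap_rep k n.
Let U : lmodType k := (swap_space P * swap_space Q)%type.

Definition sum_act A B (x : U) : U := (swap_act A B x.1, swap_act A B x.2).
Definition sum_iota (x : U) : U := (swap_iota x.1, swap_iota x.2).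

Lemma sum_action : is_swap_action sum_act sum_iota.
Proof.
have [P1 PM PK Pi] := swap_action P; have [Q1 QM QK Qi] := swap_action Q.
split=> [[x y]|A A' B B' [x y] *|[x y]|A B [x y] *].
- by rewrite /sum_act /= P1 Q1.
- by rewrite /sum_act /= PM ?QM.
- by rewrite /sum_iota /= PK QK.
- by rewrite /sum_act /sum_iota /= Pi ?Qi.
Qed.

Lemma sum_act_linear A B c (x y : U) : A \in unitmx -> B \in unitmx ->
  sum_act A B (c *: x + y) = c *: sum_act A B x + sum_act A B y.
Proof. by move=> Au Bu; rewrite /sum_act /= !swap_act_linear. Qed.

Lemma sum_iota_linear c (x y : U) :
  sum_iota (c *: x + y) = c *: sum_iota x + sum_iota y.
Proof. by rewrite /sum_iota /= !swap_iota_linear. Qed.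

Definition sum_rep : swap_rep k n :=
  SwapRep sum_action sum_act_linear sum_iota_linear.
End DirectSum.

End Constructions.

(* The degree d component of F_i is isomorphic to Q; phi is the composite of
   an isomorphism with the inclusion of this component in F_i. *)
Definition degree_component_iso (k : fieldType) (n : nat)
    (F : graded_free_resolution k n) (E : equivariant_structure F)
    (i d : nat) (Q : swap_rep k n) : Prop :=
  exists phi : swap_space Q -> 'rV[mat_poly k n]_(rank F i),
    [/\ forall (c : k) x y, phi (c *: x + y) = c%:MP *: phi x + phi y,
        injective phi,
        forall v, homogeneous (deg F i) d v <-> exists x, phi x = v,
        forall A B x, A \in unitmx -> B \in unitmx ->
          phi (swap_act A B x) = res_act E i A B (phi x)
      & forall x, phi (swap_iota x) = res_swap E i (phi x)].

(* Main.v *)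
Require Import Defs.
From mathcomp Require Import all_boot all_order all_algebra all_fingroup.
From mathcomp Require Import generic_quotient ring_quotient.
From mathcomp Require Import ring zify.
From Stdlib Require Import Classical ClassicalEpsilon.

Set Implicit Arguments.
Unset Strict Implicit.
Unset Printing Implicit Defensive.

Import GRing.Theory.
Local Open Scope ring_scope.

(** The proof has three independent ingredients.

    From the resolution to tensors. No nonzero form of degree 0 or 1 is
    apolar to the determinant, so in a minimal resolution F_0 = S and F_i, i
    > 0, is generated in degrees at least i + 1 ([rank0], [deg_ge]). An
    element v of degree 4 of F_3 therefore has constant coordinates; its
    image in F_2 is \sum_x X_x u_x with constant vectors u_x, x running over
    the positions of the matrix; applying the differential to the u_x and
    repeating once more, one arrives at quadrics q_xy in det_n^perp ([syz]).
    From d d = 0 they satisfy q_yx = - q_xy and \sum_y X_y q_xy = 0, and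
    exactness shows that every such family of apolar quadrics comes from
    exactly one v ([syz_inj], [syz_surj]). A quadric is apolar to det_n iff
    its polarized coefficient at (X_ij, X_i'j') does not change when j and
    j' are exchanged ([det_perp_quad_suff], [det_perp_quad_nec]). So the
    degree 4 part of F_3 is the space K ([in_kernel]) of tensors in V^{x4}
    (x) W^{x4} that are alternating in the first two positions, symmetric in
    the last two V-letters and in the last two W-letters separately, and
    satisfy a cyclic relation. Tensors are written as square matrices, with
    rows indexed by words of four V-letters and columns by words of four
    W-letters. Any semilinear automorphism of the resolution acts on these
    tensors by the fourth tensor power of the underlying linear substitution
    ([coef2_syz_f]), because such an automorphism fixes the generator of
    F_0.

    Decomposition of K. Let P_s permute the places of words and let J =
    P_(03) - P_(02). If the rows of t1 lie in V_211 and its columns in W_4,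
    then J t1 is in K; so are the transposes of such matrices, with V and W
    exchanged, and t3 P_(01) - P_(01) t3 for t3 in V_31 (x) W_31. Every
    element of K is uniquely a sum of these three ([kernel_decomposition],
    [assemble_inj]). Indeed, fix four row letters and four column letters:
    an element of K becomes a function X(ab, cd) of two ordered pairs of
    places, odd under the simultaneous reversal of the pairs and with
    vanishing sums over matchings, and such a function has the form f(ab) +
    g(cd) + C(a, d) - C(b, c) with f, g, C explicit linear combinations of
    values of X ([pair_decomposition]). As t3 P_(01) - P_(01) t3 has
    transpose of the same shape for - t3^T, the transposition acts on the
    last summand with a minus sign.

    Irreducibility. V_4, V_31 and V_211 are realised in V^{x4} as the images
    of the symmetrizer and of two idempotents e built from the stabilizer of
    a place in S_4 ([hook_proj]). They satisfy e P_s e = c(s) e with \sum_s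
    c(s) c(s^-1) nonzero. By polarization, the span of the A^{x4}, A
    invertible, contains \sum_s P_s Y P_s^-1 for every Y ([tens_span_sym]);
    compressed by e, and for Y acting on the image of e, this is a nonzero
    multiple of Y. So the linear group spans the whole matrix algebra of the
    image, and, as the symmetrizer and the idempotent of V_211 are
    orthogonal even with a permutation in between, it does so independently
    on V_4 and V_211 ([span_full]). *)

(** * Linear algebra over a field of characteristic zero *)

Lemma natS_neq0 (k : fieldType) (char0 : [pchar k] =i pred0) m : m.+1%:R != 0 :> k.
Proof. by rewrite ((pcharf0P k).1 char0). Qed.

Section Subspace.
Variables (k : fieldType) (U : lmodType k) (P : U -> Prop).
Hypothesis subP : is_subspace P.

Lemma subspaceD x y : P x -> P y -> P (x + y).
Proof. by move=> Px Py; rewrite -[x]scale1r; apply: subP.2. Qed.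

Lemma subspaceZ c x : P x -> P (c *: x).
Proof. by move=> Px; rewrite -[_ *: _]addr0; apply: subP.2 => //; apply: subP.1. Qed.

Lemma subspace_sum (I : finType) (Q : pred I) F :
  (forall i, Q i -> P (F i)) -> P (\sum_(i | Q i) F i).
Proof. by move=> h; apply: big_ind => //; [apply: subP.1 | apply: subspaceD]. Qed.
End Subspace.

(** * The fourth tensor power and place permutations *)

Section TensorPower.
Variables (k : fieldType) (n : nat).

Notation idx := {ffun 'I_4 -> 'I_n}.
Notation N := #|{ffun 'I_4 -> 'I_n}|.
Implicit Types (i j l : idx) (s t : 'S_4).

Lemma big_rank (V : nmodType) (F : 'I_N -> V) :
  \sum_a F a = \sum_(i : idx) F (enum_rank i).
Proof.
by rewrite (reindex (@enum_rank idx)) //=; apply: onW_bij; apply: enum_rank_bij.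
Qed.

Lemma rank_rowP m (M M' : 'M[k]_(N, m)) :
  (forall i b, M (enum_rank i) b = M' (enum_rank i) b) -> M = M'.
Proof. by move=> h; apply/matrixP => a b; rewrite -(enum_valK a) h. Qed.

Lemma rank_mxP (M M' : 'M[k]_N) :
  (forall i j, M (enum_rank i) (enum_rank j) = M' (enum_rank i) (enum_rank j)) ->
  M = M'.
Proof. by move=> h; apply: rank_rowP => i b; rewrite -(enum_valK b). Qed.

(** The matrix of E_0 (x) E_1 (x) E_2 (x) E_3 on the fourth tensor power of k^n,
    whose standard basis is the set of words of four letters. *)
Definition tensor_mx (E : 'I_4 -> 'M[k]_n) : 'M[k]_N :=
  \matrix_(a, b) \prod_p E p ((enum_val a : idx) p) ((enum_val b : idx) p).

Definition tens (A : 'M[k]_n) : 'M[k]_N := tensor_mx (fun=> A).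

Lemma tensor_mxE E i j :
  tensor_mx E (enum_rank i) (enum_rank j) = \prod_p E p (i p) (j p).
Proof. by rewrite mxE !enum_rankK. Qed.

Lemma tensE A i j : tens A (enum_rank i) (enum_rank j) = \prod_p A (i p) (j p).
Proof. exact: tensor_mxE. Qed.

Lemma word_neq i j : i != j -> exists p, i p != j p.
Proof.
move=> ne; apply/existsP; apply: contraR ne; rewrite negb_exists => /forallP h.
by apply/eqP/ffunP => p; apply/eqP; move: (h p); rewrite negbK.
Qed.

Lemma tens_scalar (c : k) : tens c%:M = (c ^+ 4)%:M.
Proof.
apply: rank_mxP => i j; rewrite tensE !mxE (inj_eq enum_rank_inj).
case: eqVneq => [<-|/word_neq[p np]].
  by under eq_bigr do rewrite mxE eqxx; rewrite prodr_const card_ord.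
by rewrite (bigD1 p) //= mxE (negbTE np) mul0r.
Qed.

Lemma tens1 : tens 1%:M = 1%:M.
Proof. by rewrite tens_scalar expr1n. Qed.

Lemma tensM A B : tens (A *m B) = tens A *m tens B.
Proof.
apply: rank_mxP => i j; rewrite tensE mxE big_rank.
under eq_bigr do rewrite mxE.
rewrite bigA_distr_bigA /=; apply: eq_bigr => l _.
by rewrite !tensE -big_split.
Qed.

(** The inverse makes [pmx] below multiplicative for the product of permutations,
    which composes from left to right. *)
Definition pidx s i : idx := [ffun p => i (s^-1%g p)].

Lemma pidxM s t i : pidx (s * t)%g i = pidx t (pidx s i).
Proof. by apply/ffunP => p; rewrite !ffunE invMg permM. Qed.

Lemma pidx1 i : pidx 1%g i = i.
Proof. by apply/ffunP => p; rewrite !ffunE invg1 perm1. Qed.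

Lemma pidxK s : cancel (pidx s) (pidx s^-1%g).
Proof. by move=> i; rewrite -pidxM mulgV pidx1. Qed.

Lemma pidxKV s : cancel (pidx s^-1%g) (pidx s).
Proof. by move=> i; rewrite -pidxM mulVg pidx1. Qed.

Definition pmx s : 'M[k]_N := \matrix_(a, b) (enum_val b == pidx s (enum_val a))%:R.

Lemma pmx_mulE m s (M : 'M[k]_(N, m)) i b :
  (pmx s *m M) (enum_rank i) b = M (enum_rank (pidx s i)) b.
Proof.
rewrite mxE (bigD1 (enum_rank (pidx s i))) //= mxE !enum_rankK eqxx mul1r.
rewrite big1 ?addr0 // => a na; rewrite mxE enum_rankK.
case: eqP => [E|_]; last by rewrite mul0r.
by case/eqP: na; rewrite -E enum_valK.
Qed.

Lemma mul_pmxE m s (M : 'M[k]_(m, N)) b j :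
  (M *m pmx s) b (enum_rank j) = M b (enum_rank (pidx s^-1%g j)).
Proof.
rewrite mxE (bigD1 (enum_rank (pidx s^-1%g j))) //= mxE !enum_rankK pidxKV eqxx mulr1.
rewrite big1 ?addr0 // => a na; rewrite mxE enum_rankK.
case: eqP => [E|_]; last by rewrite mulr0.
by case/eqP: na; rewrite E pidxK enum_valK.
Qed.

Lemma pmx1 : pmx 1%g = 1%:M.
Proof. by apply: rank_rowP => i b; rewrite -[pmx _]mulmx1 pmx_mulE pidx1. Qed.

Lemma pmxM s t : pmx (s * t)%g = pmx s *m pmx t.
Proof.
by apply: rank_rowP => i b; rewrite -[pmx (_ * _)]mulmx1 !pmx_mulE pidxM -[pmx t]mulmx1 pmx_mulE.
Qed.

Lemma pmx_tr s : (pmx s)^T = pmx s^-1%g.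
Proof.
by apply/matrixP => a b; rewrite !mxE; congr (_ *+ nat_of_bool _);
  rewrite -[RHS](inj_eq (can_inj (pidxK s))) pidxKV eq_sym.
Qed.

Lemma pmx_tensor_mx E s :
  pmx s *m tensor_mx E *m pmx s^-1%g = tensor_mx (fun p => E (s p)).
Proof.
apply: rank_mxP => i j; rewrite mul_pmxE pmx_mulE invgK !tensor_mxE.
by rewrite (reindex_inj (@perm_inj _ s)); apply: eq_bigr => p _; rewrite !ffunE permK.
Qed.

Lemma pmx_tens s A : pmx s *m tens A = tens A *m pmx s.
Proof.
have := pmx_tensor_mx (fun=> A) s; rewrite -!/(tens A) => h.
by rewrite -[X in X *m pmx s]h -!mulmxA -pmxM mulVg pmx1 mulmx1.
Qed.

Definition sym_mx (X : 'M[k]_N) : 'M[k]_N := \sum_s pmx s *m X *m pmx s^-1%g.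

(** Expanding each fourth power over maps f from places to factors, the signed
    sum over the sets S containing the image of f vanishes unless f is onto,
    that is a permutation. *)
Lemma polarization E (two_neq0 : 2%:R != 0 :> k) :
  \sum_(S : {set 'I_4}) (-1) ^+ #|~: S| *: tens (\sum_(p in S) E p) =
  sym_mx (tensor_mx E).
Proof.
transitivity (\sum_(s : 'S_4) tensor_mx (fun p => E (s p))); last first.
  by apply: eq_bigr => s _; rewrite pmx_tensor_mx.
apply: rank_mxP => i j; rewrite !summxE.
under eq_bigr do rewrite mxE tensE.
under [RHS]eq_bigr do rewrite tensor_mxE.
have dist (S : {set 'I_4}) : \prod_q (\sum_(p in S) E p) (i q) (j q) =
    \sum_(f : {ffun 'I_4 -> 'I_4} | f \in ffun_on (mem S)) \prod_q E (f q) (i q) (j q).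
  by under eq_bigr do rewrite summxE; rewrite bigA_distr_big.
under eq_bigr do rewrite dist mulr_sumr.
rewrite (exchange_big_dep xpredT) //=.
under eq_bigr => f _ do rewrite -mulr_suml.
rewrite (bigID (fun f : {ffun 'I_4 -> 'I_4} => injectiveb f)) /= [X in _ + X]big1 ?addr0.
  rewrite (reindex (@pval _)) /=; last first.
    pose in_Sn := insubd (1%g : 'S_4).
    by exists in_Sn => /= f Uf; first apply: val_inj; apply: insubdK.
  apply: eq_big => [s|s _]; rewrite ?(valP s) // pvalE.
  rewrite (big_pred1 setT) /=; last first.
    move=> S /=; rewrite -subTset; apply/ffun_onP/subsetP => h x.
      by move=> _; have := h (s^-1%g x); rewrite pvalE permKV.
    by apply: h; rewrite inE.
  by rewrite setCT cards0 mul1r.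
move=> f /injectivePn ninj.
have [p0 pf] : exists p0, p0 \notin codom f.
  apply/existsP; apply/contraT; rewrite negb_exists => /forallP h.
  case: ninj => x [y nxy fxy]; case/eqP: nxy.
  have cf : #|codom f| == #|'I_4|.
    by apply/eqP/eq_card => z; move: (h z); rewrite negbK.
  have inj : {in 'I_4 &, injective f} by apply/image_injP.
  by apply: inj.
set Z := \sum_(_ | _) _; suff -> : Z = 0 by rewrite mul0r.
(* Adding or removing p0 is a sign-reversing involution on the sets S. *)
pose h (S : {set 'I_4}) := if p0 \in S then S :\ p0 else p0 |: S.
have hS S : (p0 \in h S) = (p0 \notin S).
  by rewrite /h; case: ifP => p0S; rewrite !inE eqxx.
have hK : involutive h.
  move=> S; rewrite {1}/h hS /h; case: (boolP (p0 \in S)) => p0S /=.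
    by rewrite setD1K.
  by rewrite setU1K.
have hZ : Z = - Z.
  rewrite {1}/Z (reindex_inj (inv_inj hK)) /= -sumrN; apply: eq_big => [S|S _].
    apply/ffun_onP/ffun_onP => fS x; have npx : f x != p0.
    - by apply: contraNneq pf => <-; apply: codom_f.
    - by have := fS x; rewrite /h; case: ifP => _; rewrite !inE ?npx ?(negbTE npx).
    - by apply: contraNneq pf => <-; apply: codom_f.
    by have := fS x; rewrite /h; case: ifP => _; rewrite !inE ?npx ?(negbTE npx).
  rewrite /h; case: ifPn => p0S.
    by rewrite setCD setUC cardsU1 inE p0S /= exprS mulN1r.
  rewrite -[in RHS](setU1K p0S) setCD [in RHS]setUC cardsU1 !inE eqxx /=.
  by rewrite exprS mulN1r opprK.
apply/eqP; have /eqP := hZ; rewrite -subr_eq0 opprK -mulr2n -mulr_natl.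
by rewrite mulf_eq0 (negbTE two_neq0).
Qed.

End TensorPower.

(** * The span of the fourth tensor powers of invertible matrices *)

Section Span.
Variables (k : fieldType) (n : nat).
Hypothesis char0 : [pchar k] =i pred0.

Notation idx := {ffun 'I_4 -> 'I_n}.
Notation N := #|{ffun 'I_4 -> 'I_n}|.

(** Membership in the linear span of the A^{x4}, A invertible, as the
    intersection of the subspaces that contain them. *)
Definition tens_span (X : 'M[k]_N) := forall P : 'M[k]_N -> Prop,
  is_subspace P -> (forall A, A \in unitmx -> P (tens A)) -> P X.

Lemma tens_span_subspace : is_subspace tens_span.
Proof.
split=> [P [P0 _] _ //|c X Y hX hY P sP hA].
by apply: sP.2; [apply: hX | apply: hY].
Qed.

(** The entries of (A + x)^{x4} are polynomials of degree at most 4 in x, so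
    their fifth finite difference with step h vanishes. *)
Lemma tens_difference (A : 'M[k]_n) (h : k) :
  let B j := tens (A + (j%:R * h)%:M) in
  tens A = 5%:R *: B 1%N + (- 10%:R) *: B 2%N + 10%:R *: B 3%N
           + (- 5%:R) *: B 4%N + B 5%N.
Proof.
have key (x y : 'I_4 -> k) (Q := fun m => \prod_p (x p + m%:R * h * y p)) :
    \prod_p x p = 5%:R * Q 1%N + - 10%:R * Q 2%N + 10%:R * Q 3%N
                   + - 5%:R * Q 4%N + Q 5%N.
  rewrite /Q !big_ord_recl !big_ord0.
  move: (x _) (x _) (x _) (x _) (y _) (y _) (y _) (y _) => x0 x1 x2 x3 y0 y1 y2 y3.
  by ring.
move=> B; apply: rank_mxP => i j; rewrite tensE.
rewrite (key _ (fun p => (i p == j p)%:R)) {key}.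
have E m : \prod_p (A (i p) (j p) + m%:R * h * (i p == j p)%:R) =
   tens (A + (m%:R * h)%:M) (enum_rank i) (enum_rank j).
  by rewrite tensE; apply: eq_bigr => p _; rewrite 2!mxE mulr_natr.
rewrite !E /B; move: (tens _) (tens _) (tens _) (tens _) (tens _).
by move=> T1 T2 T3 T4 T5; rewrite !mxE.
Qed.

(** Each condition excludes the roots of a nonzero polynomial in h, and k is
    infinite. *)
Lemma shift_unit (A : 'M[k]_n) : exists h : k,
  forall j, (0 < j <= 5)%N -> A + (j%:R * h)%:M \in unitmx.
Proof.
pose q j : {poly k} := char_poly (- A) \Po (j.+1%:R *: 'X).
have qE j x : (q j).[x] = \det (A + (j.+1%:R * x)%:M).
  rewrite /q horner_comp hornerZ hornerX /char_poly -[_.[_]]/(horner_eval _ _).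
  rewrite -det_map_mx; congr (\det _); apply/matrixP => a b; rewrite !mxE.
  by rewrite /= /horner_eval hornerD hornerN hornerMn hornerX hornerC opprK addrC.
have q0 j : q j != 0.
  rewrite /q comp_poly2_eq0 ?(monic_neq0 (char_poly_monic _)) //.
  by rewrite size_scale ?(natS_neq0 char0) // size_polyX.
pose r := \prod_(j < 5) q j.
have r0 : r != 0 by apply/prodf_neq0 => j _.
pose s := [seq m%:R : k | m <- iota 0 (size r)].
have us : uniq s.
  rewrite map_inj_in_uniq ?iota_uniq // => a b _ _.
  wlog le : a b / (a <= b)%N.
    by move=> w e; case/orP: (leq_total a b) => /w; [apply | move=> h; apply/esym/h].
  move/eqP; rewrite eq_sym -subr_eq0 -natrB // ((pcharf0P k).1 char0) subn_eq0 => le'.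
  by apply/eqP; rewrite eqn_leq le.
have /allPn[h _ rh] : ~~ all (root r) s.
  apply/negP => all_r; have := max_poly_roots r0 all_r us.
  by rewrite size_map size_iota ltnn.
exists h => -[|j] // lej; rewrite unitmxE unitfE -qE.
move: rh; rewrite /root horner_prod => /prodf_neq0/(_ (Ordinal (lej : (j < 5)%N))).
by apply.
Qed.

Lemma tens_span_tens (A : 'M[k]_n) : tens_span (tens A).
Proof.
move=> P sP hA; have [h hu] := shift_unit A.
by rewrite (tens_difference A h) /=; do ![apply: subspaceD => //]; 
  rewrite ?scalemxAl; try apply: subspaceZ => //; apply: hA; apply: hu.
Qed.

Lemma sym_mx_sum (I : finType) (c : I -> k) X :
  sym_mx (\sum_i c i *: X i) = \sum_i c i *: sym_mx (X i) :> 'M[k]_N.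
Proof.
rewrite /sym_mx; under [RHS]eq_bigr do rewrite scaler_sumr.
rewrite exchange_big /=; apply: eq_bigr => s _.
rewrite mulmx_sumr mulmx_suml; apply: eq_bigr => i _.
by rewrite -scalemxAr -scalemxAl.
Qed.

(** Both sides being linear in X, one may take X = E_0 (x) ... (x) E_3, where
    polarization applies. *)
Lemma tens_span_sym (X : 'M[k]_N) : tens_span (sym_mx X).
Proof.
pose E (x : idx * idx) : 'M[k]_N := tensor_mx (fun p => delta_mx (x.1 p) (x.2 p)).
have -> : X = \sum_x X (enum_rank x.1) (enum_rank x.2) *: E x.
  apply: rank_mxP => i j; rewrite summxE (bigD1 (i, j)) //= big1 ?addr0.
    by rewrite mxE tensor_mxE big1 ?mulr1 // => p _; rewrite mxE !eqxx.
  move=> [a b] /= ne; rewrite mxE tensor_mxE /=.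
  have [p np] : exists p, (i p, j p) != (a p, b p).
    apply/existsP; apply: contraR ne; rewrite negb_exists => /forallP h.
    apply/eqP; congr (_, _); apply/ffunP => p; move: (h p); rewrite negbK => /eqP[];
      by move=> e1 e2; rewrite ?e1 ?e2.
  rewrite (bigD1 p) //= mxE; move: np; rewrite -pair_eqE /pair_eq /= => /negbTE ->.
  by rewrite mul0r mulr0.
have sp := tens_span_subspace.
rewrite sym_mx_sum; apply: (subspace_sum sp) => x _; apply: (subspaceZ sp).
rewrite /E -polarization ?(natS_neq0 char0) //; apply: (subspace_sum sp) => S _.
by apply: (subspaceZ sp); apply: tens_span_tens.
Qed.
End Span.

(** * Direct summands of the fourth tensor power and their irreducibility *)

(** Cancelling the full-rank factors C and D from C D C D = C D leaves D C = 1. *)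
Lemma idempotent_split (k : fieldType) m (e : 'M[k]_m) : e *m e = e ->
  {C : 'M[k]_(m, \rank e) & {D : 'M[k]_(\rank e, m) | D *m C = 1%:M & C *m D = e}}.
Proof.
move=> ee; have := mulmx_base e; have := col_base_full e; have := row_base_free e.
move: (col_base e) (row_base e) => C D freeD fullC CD; exists C, D => //.
apply: (row_full_inj fullC); apply: (row_free_inj freeD); rewrite /= mulmx1.
by rewrite !mulmxA CD -mulmxA CD ee.
Qed.

Section Subrep.
Variables (k : fieldType) (n : nat).

Notation idx := {ffun 'I_4 -> 'I_n}.
Notation N := #|{ffun 'I_4 -> 'I_n}|.

(** A direct summand of the GL_n-module (k^n)^{x4}: [sm_in] includes it and
    [sm_out] projects onto it. *)
Record tens_summand := TensSummand {
  sm_dim : nat;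
  sm_in : 'M[k]_(N, sm_dim);
  sm_out : 'M[k]_(sm_dim, N);
  sm_outK : sm_out *m sm_in = 1%:M;
  sm_tens : forall A,
    sm_in *m sm_out *m tens A = tens A *m (sm_in *m sm_out)
}.

Definition summand_of (e : 'M[k]_N) (ee : e *m e = e)
    (et : forall A, e *m tens A = tens A *m e) : tens_summand.
Proof.
pose s := idempotent_split ee; exists (\rank e) (projT1 s) (s2val (projT2 s)).
  exact: (s2valP (projT2 s)).
by move=> A; rewrite (s2valP' (projT2 s)) et.
Defined.

Definition sm_proj (s : tens_summand) := sm_in s *m sm_out s.

Lemma summand_of_proj e ee et : sm_proj (@summand_of e ee et) = e.
Proof. exact: (s2valP' (projT2 (idempotent_split ee))). Qed.

Section Image.
Variable s : tens_summand.
Notation r := (sm_dim s).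
Notation C := (sm_in s).
Notation D := (sm_out s).
Notation e := (sm_proj s).

Lemma sm_proj_in : e *m C = C.
Proof. by rewrite /sm_proj -mulmxA sm_outK mulmx1. Qed.

Lemma sm_out_proj : D *m e = D.
Proof. by rewrite /sm_proj mulmxA sm_outK mul1mx. Qed.

Lemma sm_proj_tens A : e *m tens A = tens A *m e.
Proof. exact: sm_tens. Qed.

Definition sm_mx (A : 'M[k]_n) : 'M[k]_r := D *m tens A *m C.

Lemma sm_inE A : C *m sm_mx A = tens A *m C.
Proof. by rewrite /sm_mx !mulmxA -/(sm_proj s) sm_proj_tens -mulmxA sm_proj_in. Qed.

Lemma sm_mx1 : sm_mx 1%:M = 1%:M.
Proof. by rewrite /sm_mx tens1 mulmx1 sm_outK. Qed.

Lemma sm_mxM A B : A \in unitmx -> B \in unitmx ->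
  sm_mx (A *m B) = sm_mx A *m sm_mx B.
Proof.
by move=> _ _; rewrite {2}/sm_mx -!mulmxA sm_inE /sm_mx tensM !mulmxA.
Qed.

Lemma sm_mx_rational : exists (d : nat) (p : 'M[mat_poly k n]_r),
  forall A, A \in unitmx -> forall i j,
    \det A ^+ d * sm_mx A i j = (p i j).@[fun l => mxvec A 0 l].
Proof.
pose T : 'M[mat_poly k n]_N :=
  \matrix_(a, b) \prod_p 'X_(mxvec_index ((enum_val a : idx) p) ((enum_val b : idx) p)).
exists 0%N, (map_mx (@mpolyC _ _) D *m T *m map_mx (@mpolyC _ _) C) => A _ i j.
rewrite expr0 mul1r; set v := fun _ => _.
have TA : map_mx (meval v) T = tens A.
  apply/matrixP => a b; rewrite !mxE rmorph_prod; apply: eq_bigr => p _.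
  by rewrite /= mevalXU /v mxvecE.
have cK m m' (M : 'M[k]_(m, m')) : map_mx (meval v) (map_mx (@mpolyC _ _) M) = M.
  by apply/matrixP => a b; rewrite !mxE mevalC.
transitivity (map_mx (meval v) (map_mx (@mpolyC _ _) D *m T *m map_mx (@mpolyC _ _) C) i j).
  by rewrite !map_mxM TA !cK.
by rewrite mxE.
Qed.

Definition sm_rep : gl_rep k n := GLRep sm_mx1 sm_mxM sm_mx_rational.
End Image.

(** The first condition is primitivity in the group algebra of S_4, which acts on
    the tensor power; the number \sum_t c(t) c(t^-1) is the factor by which
    symmetrizing, then compressing, multiplies an operator on the summand, see
    [span_full]. *)
Definition primitive (s : tens_summand) := exists c : 'S_4 -> k,
  (forall t, sm_proj s *m pmx k n t *m sm_proj s = c t *: sm_proj s) /\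
  \sum_t c t * c t^-1%g != 0.

(** Nothing in the group algebra of S_4 carries one summand to the other. *)
Definition disjoint_from (s s' : tens_summand) :=
  forall t, sm_proj s' *m pmx k n t *m sm_proj s = 0.

(** Jacobson density made explicit: X is the symmetrization of Y, extended by
    zero, divided by \sum_t c(t) c(t^-1). Since e P_t e = c(t) e, each term of the
    symmetrization compresses to c(t) c(t^-1) Y, and it compresses to 0 on a
    disjoint summand. *)
Lemma span_full (char0 : [pchar k] =i pred0) s (Y : 'M[k]_(sm_dim s)) :
  primitive s -> exists X, [/\ tens_span X, sm_out s *m X *m sm_in s = Y
    & forall s', disjoint_from s s' -> sm_out s' *m X *m sm_in s' = 0].
Proof.
move=> [c [ec c0]]; set g := \sum_t _ in c0.
pose Y' := sm_in s *m Y *m sm_out s.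
have Ye : sm_proj s *m Y' *m sm_proj s = Y'.
  by rewrite /Y' !mulmxA sm_proj_in -!mulmxA sm_out_proj.
exists (g^-1 *: sym_mx Y'); split.
- by apply: (subspaceZ (@tens_span_subspace _ _)); apply: tens_span_sym.
- rewrite -scalemxAr -scalemxAl; suff -> : sm_out s *m sym_mx Y' *m sm_in s = g *: Y.
    by rewrite scalerA mulVf // scale1r.
  rewrite -sm_out_proj -[in LHS]sm_proj_in /sym_mx mulmx_sumr mulmx_suml /g scaler_suml.
  apply: eq_bigr => t _.
  transitivity (sm_out s *m (sm_proj s *m pmx k n t *m sm_proj s) *m Y' *m
     (sm_proj s *m pmx k n t^-1 *m sm_proj s) *m sm_in s).
    by rewrite -[in LHS]Ye !mulmxA.
  rewrite !ec -!(scalemxAl, scalemxAr) !scalerA mulrC; congr (_ *: _).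
  by rewrite sm_out_proj -mulmxA sm_proj_in /Y' !mulmxA sm_outK mul1mx -mulmxA sm_outK mulmx1.
move=> s' dis; rewrite -scalemxAr -scalemxAl.
suff -> : sm_out s' *m sym_mx Y' *m sm_in s' = 0 by rewrite scaler0.
rewrite -sm_out_proj /sym_mx mulmx_sumr mulmx_suml big1 // => t _.
transitivity (sm_out s' *m (sm_proj s' *m pmx k n t *m sm_proj s) *m Y' *m sm_proj s *m
     pmx k n t^-1 *m sm_in s').
  by rewrite -[in LHS]Ye !mulmxA.
by rewrite dis mulmx0 !mul0mx.
Qed.

Lemma sm_mx_scalar s (c : k) : sm_mx s c%:M = (c ^+ 4)%:M.
Proof.
by rewrite /sm_mx tens_scalar mul_mx_scalar; rewrite -(scalemxAl (c ^+ 4) (sm_out s)) sm_outK scalemx1.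
Qed.

(** c acts on a fourth tensor power by c^4 and its inverse by c^-4, so the central
    torus of the determinant group acts trivially. *)
Lemma tensor_act_scalar s s' (c : k) (x : 'M[k]_(sm_dim s, sm_dim s')) : c != 0 ->
  @tensor_act k n (sm_rep s) (sm_rep s') c%:M c^-1%:M x = x.
Proof.
move=> c0; rewrite /tensor_act /= !sm_mx_scalar tr_scalar_mx.
by rewrite mul_scalar_mx mul_mx_scalar scalerA exprVn mulVf ?scale1r // expf_neq0.
Qed.

(** Multiplying by matrix units moves a nonzero entry of x to any place and
    clears the others. *)
Lemma matrix_bimodule_simple (m m' : nat) (x : 'M[k]_(m, m')) (P : 'M[k]_(m, m') -> Prop) :
  is_subspace P -> x != 0 -> (forall Y Y', P (Y *m x *m Y'^T)) -> forall z, P z.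
Proof.
move=> sP x0 h z.
have [i [j xij]] : exists i j, x i j != 0.
  have [/existsP[i /existsP[j]]|] := boolP [exists i, [exists j, x i j != 0]].
    by exists i, j.
  rewrite negb_exists => /forallP h0; case/eqP: x0; apply/matrixP => i j.
  by move: (h0 i); rewrite negb_exists => /forallP/(_ j); rewrite negbK mxE => /eqP.
rewrite [z]matrix_sum_delta; apply: (subspace_sum sP) => a _.
apply: (subspace_sum sP) => b _; apply: (subspaceZ sP).
have := subspaceZ sP (x i j)^-1 (h (delta_mx a i) (delta_mx b j)).
suff -> : delta_mx a i *m x *m (delta_mx b j)^T = x i j *: delta_mx a b.
  by rewrite scalerA mulVf // scale1r.
rewrite trmx_delta; apply/matrixP => a' b'; rewrite !mxE (bigD1 j) //= big1 ?addr0.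
  rewrite !mxE (bigD1 i) //= big1 ?addr0; last first.
    by move=> l nl; rewrite mxE (negbTE nl) andbF mul0r.
  rewrite !mxE !eqxx /= andbT.
  by case: (a' == a); case: (b' == b); rewrite /= ?(mulr1, mul1r, mulr0, mul0r).
by move=> l nl; rewrite [X in _ * X]mxE (negbTE nl) mulr0.
Qed.

Section Irreducible.
Hypothesis char0 : [pchar k] =i pred0.

Lemma sm_rep_irreducible s : primitive s -> (0 < sm_dim s)%N -> gl_irreducible (sm_rep s).
Proof.
move=> prim s0; split.
  exists (const_mx 1); apply/eqP => /matrixP/(_ (Ordinal s0) 0).
  by rewrite !mxE => /eqP; rewrite oner_eq0.
move=> P sP stP.
have [[x [Px x0]]|none] := classic (exists x, P x /\ x <> 0); last first.
  by left=> x Px; apply: NNPP => nx; apply: none; exists x.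
right; apply: (matrix_bimodule_simple sP (x := x)); first exact/eqP.
move=> Y Y'; have [X [Xs XY _]] := span_full char0 Y prim.
rewrite [Y'^T]mx11_scalar mul_mx_scalar; apply: (subspaceZ sP); rewrite -XY.
apply: (Xs (fun Z => P (sm_out s *m Z *m sm_in s *m x))) => [|A Au]; last exact: stP.
split; first by rewrite mulmx0 !mul0mx; apply: sP.1.
move=> c X1 X2 h1 h2; rewrite mulmxDr !mulmxDl -scalemxAr -!scalemxAl.
exact: sP.2.
Qed.

Lemma square_irreducible odd s : primitive s -> (0 < sm_dim s)%N ->
  gdet_irreducible (square_rep odd (sm_rep s)).
Proof.
move=> prim s0; split; first by move=> c x c0; apply: tensor_act_scalar.
split.
  exists (const_mx 1 : 'M[k]_(sm_dim s)).
  apply/eqP => /matrixP/(_ (Ordinal s0) (Ordinal s0)).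
  by rewrite !mxE => /eqP; rewrite oner_eq0.
move=> P sP [stP _].
have [[x [Px x0]]|none] := classic (exists x, P x /\ x <> 0); last first.
  by left=> x Px; apply: NNPP => nx; apply: none; exists x.
right; apply: (matrix_bimodule_simple sP (x := x)); first exact/eqP.
move=> Y Y'; have [X [Xs XY _]] := span_full char0 Y prim.
have [X' [Xs' XY' _]] := span_full char0 Y' prim.
rewrite -XY; apply: (Xs (fun Z => P (sm_out s *m Z *m sm_in s *m x *m Y'^T))) => [|A Au].
  split; first by rewrite mulmx0 !mul0mx; apply: sP.1.
  move=> c X1 X2 h1 h2; rewrite mulmxDr !mulmxDl -scalemxAr -!scalemxAl.
  exact: sP.2.
rewrite -XY'.
apply: (Xs' (fun Z => P (sm_out s *m tens A *m sm_in s *m x *m (sm_out s *m Z *m sm_in s)^T))) => [|B Bu];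
  last exact: (stP A B).
split; first by rewrite mulmx0 !mul0mx linear0 mulmx0; apply: sP.1.
move=> c X1 X2 h1 h2; rewrite mulmxDr !mulmxDl -scalemxAr -!scalemxAl linearP /=.
by rewrite mulmxDr -scalemxAr; apply: sP.2.
Qed.

(** By [span_full] the first factor GL(V) acts on the two components through
    independent full matrix algebras, which separates the components; the swap
    then carries one to the other. *)
Lemma pair_irreducible s s' : primitive s -> primitive s' ->
  disjoint_from s s' -> disjoint_from s' s ->
  (0 < sm_dim s)%N -> (0 < sm_dim s')%N ->
  gdet_irreducible (pair_rep (sm_rep s) (sm_rep s')).
Proof.
move=> prim prim' dis dis' s0 s0'; split.
  by move=> c [x y] c0; rewrite /= /pair_act !tensor_act_scalar.
split.
  exists ((const_mx 1, 0) : 'M[k]_(sm_dim s, sm_dim s') * 'M[k]_(sm_dim s', sm_dim s)).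
  apply/eqP => -[] /matrixP/(_ (Ordinal s0) (Ordinal s0')).
  by rewrite !mxE => /eqP; rewrite oner_eq0.
move=> P sP [stP swP].
have [[x0 [Px0 nx0]]|none] := classic (exists x, P x /\ x <> 0); last first.
  by left=> x Px; apply: NNPP => nx; apply: none; exists x.
right.
(* After a swap, the first component may be assumed nonzero. *)
have {x0 Px0 nx0} [x1 [x2 [Px x0]]] : exists (x1 : 'M[k]_(sm_dim s, sm_dim s'))
    (x2 : 'M[k]_(sm_dim s', sm_dim s)), P (x1, x2) /\ x1 != 0.
  case: x0 Px0 nx0 => x1 x2 Px nx.
  case: (eqVneq x1 0) => [z1|]; last by exists x1, x2.
  exists x2^T, x1^T; split; first exact: (swP (x1, x2)).
  by rewrite trmx_eq0; apply/eqP => z2; apply: nx; rewrite z1 z2.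
have comb c (y1 z1 : 'M[k]_(sm_dim s, sm_dim s')) (y2 z2 : 'M[k]_(sm_dim s', sm_dim s)) :
    P (y1, y2) -> P (z1, z2) -> P (c *: y1 + z1, c *: y2 + z2).
  exact: (sP.2 c (y1, y2) (z1, z2)).
have stab A B (y1 : 'M[k]_(sm_dim s, sm_dim s')) (y2 : 'M[k]_(sm_dim s', sm_dim s)) :
    A \in unitmx -> B \in unitmx -> P (y1, y2) ->
    P (sm_mx s A *m y1 *m (sm_mx s' B)^T, sm_mx s' A *m y2 *m (sm_mx s B)^T).
  by move=> Au Bu; apply: (stP A B (y1, y2)).
(* GL(V) acts on the first component alone through X, which annihilates the second. *)
have left (z : 'M[k]_(sm_dim s, sm_dim s')) : P (z, 0).
  move: z; apply: (matrix_bimodule_simple (x := x1)) => //.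
    split; first exact: sP.1.
    by move=> c y z Py Pz; have := comb c _ _ _ _ Py Pz; rewrite scaler0 addr0.
  move=> Y Y'; have [X [Xs XY X0]] := span_full char0 Y prim.
  have [X' [Xs' XY' _]] := span_full char0 Y' prim'.
  have Px' : P (Y *m x1, 0).
    rewrite -XY -(mul0mx _ x2) -(X0 _ dis).
    apply: (Xs (fun Z => P (sm_out s *m Z *m sm_in s *m x1,
                            sm_out s' *m Z *m sm_in s' *m x2))) => [|A Au].
      split; first by rewrite !mulmx0 !mul0mx; apply: sP.1.
      move=> c X1 X2 h1 h2; rewrite !mulmxDr !mulmxDl -!scalemxAr -!scalemxAl.
      exact: comb.
    by have := stab A 1%:M _ _ Au (unitmx1 _ _) Px; rewrite !sm_mx1 !trmx1 !mulmx1.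
  rewrite -XY'; apply: (Xs' (fun Z =>
    P (Y *m x1 *m (sm_out s' *m Z *m sm_in s')^T, 0))) => [|B Bu].
    split; first by rewrite mulmx0 !mul0mx linear0 mulmx0; apply: sP.1.
    move=> c X1 X2 h1 h2; rewrite mulmxDr !mulmxDl -scalemxAr -!scalemxAl linearP /=.
    by rewrite mulmxDr -scalemxAr; have := comb c _ _ _ _ h1 h2; rewrite scaler0 addr0.
  by have := stab 1%:M B _ _ (unitmx1 _ _) Bu Px'; rewrite !sm_mx1 !mul1mx mul0mx.
move=> [z z']; have := comb 1 _ _ _ _ (left z) (swP _ (left z'^T)).
by rewrite /= trmx0 trmxK scaler0 scale1r addr0 add0r.
Qed.
End Irreducible.

End Subrep.

(** * The idempotents attached to a character of the symmetric group *)

Section Projectors.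
Variables (k : fieldType) (n : nat).
Hypothesis char0 : [pchar k] =i pred0.

Notation idx := {ffun 'I_4 -> 'I_n}.
Notation N := #|{ffun 'I_4 -> 'I_n}|.
Notation pmx := (pmx k n).
Implicit Types (eps : bool) (s t : 'S_4) (G H : {group 'S_4}) (i j b : idx).

Definition chi eps s : k := (-1) ^+ (eps && odd_perm s).

Lemma chiM eps s t : chi eps (s * t)%g = chi eps s * chi eps t.
Proof. by case: eps; rewrite /chi /= ?odd_permM ?signr_addb ?mulr1. Qed.

Lemma chiK eps s : chi eps s * chi eps s = 1.
Proof. by rewrite -expr2 sqrr_sign. Qed.

Lemma chi1 eps : chi eps 1%g = 1.
Proof. by rewrite /chi odd_perm1 andbF. Qed.

Lemma chiV eps s : chi eps s^-1%g = chi eps s.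
Proof. by rewrite /chi odd_permV. Qed.

Lemma chi_tperm eps (p q : 'I_4) : p != q -> chi eps (tperm p q) = (-1) ^+ eps.
Proof. by move=> pq; rewrite /chi odd_tperm pq andbT. Qed.

(** The projector onto the tensors on which G acts through [chi]. *)
Definition avg eps G : 'M[k]_N :=
  locked (#|G|%:R^-1 *: \sum_(s in G) chi eps s *: pmx s).

Lemma avgE eps G : avg eps G = #|G|%:R^-1 *: \sum_(s in G) chi eps s *: pmx s.
Proof. by rewrite /avg -lock. Qed.

Lemma card_group_neq0 G : #|G|%:R != 0 :> k.
Proof. by rewrite ((pcharf0P k).1 char0) -lt0n cardG_gt0. Qed.

Lemma pmx_avg eps G t : t \in G -> pmx t *m avg eps G = chi eps t *: avg eps G.
Proof.
move=> tG; rewrite avgE -scalemxAr scalerA mulrC -scalerA; congr (_ *: _).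
rewrite mulmx_sumr scaler_sumr [RHS](reindex_inj (mulgI t)) /=.
apply: eq_big => [s|s _]; first by rewrite groupMl.
by rewrite -scalemxAr -pmxM scalerA chiM mulrA chiK mul1r.
Qed.

Lemma avg_pmx eps G t : t \in G -> avg eps G *m pmx t = chi eps t *: avg eps G.
Proof.
move=> tG; rewrite avgE -scalemxAl scalerA mulrC -scalerA; congr (_ *: _).
rewrite mulmx_suml scaler_sumr [RHS](reindex_inj (mulIg t)) /=.
apply: eq_big => [s|s _]; first by rewrite groupMr.
by rewrite -scalemxAl -pmxM scalerA chiM mulrCA chiK mulr1.
Qed.

Lemma avg_mul_fixed m eps G (M : 'M[k]_(N, m)) :
  (forall s, s \in G -> pmx s *m M = chi eps s *: M) -> avg eps G *m M = M.
Proof.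
move=> h; rewrite avgE -scalemxAl mulmx_suml.
rewrite (eq_bigr (fun=> M)) => [|s sG]; last first.
  by rewrite -scalemxAl h // scalerA chiK scale1r.
by rewrite sumr_const -scaler_nat scalerA mulVf ?scale1r // card_group_neq0.
Qed.

Lemma avg_sub eps H G : H \subset G -> avg eps H *m avg eps G = avg eps G.
Proof. by move=> /subsetP sHG; apply: avg_mul_fixed => s /sHG; apply: pmx_avg. Qed.

Lemma avg_tr eps G : (avg eps G)^T = avg eps G.
Proof.
rewrite avgE linearZ /= linear_sum /=; congr (_ *: _).
rewrite (reindex_inj invg_inj) /=; apply: eq_big => [s|s _]; first by rewrite groupV.
by rewrite linearZ /= pmx_tr invgK chiV.
Qed.

Lemma avg_sub_r eps H G : H \subset G -> avg eps G *m avg eps H = avg eps G.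
Proof. by move=> sHG; apply: trmx_inj; rewrite trmx_mul !avg_tr avg_sub. Qed.

Lemma avg_tens eps G A : avg eps G *m tens A = tens A *m avg eps G.
Proof.
rewrite avgE -scalemxAl -scalemxAr mulmx_suml mulmx_sumr; congr (_ *: _).
by apply: eq_bigr => s _; rewrite -scalemxAl -scalemxAr pmx_tens.
Qed.

Definition st0_set := [set s : 'S_4 | s ord0 == ord0].
Lemma st0_group_set : group_set st0_set.
Proof.
apply/group_setP; split=> [|s t]; first by rewrite inE perm1.
by rewrite !inE permM => /eqP -> /eqP ->.
Qed.
Canonical st0 := group st0_group_set.

Notation full := [set: 'S_4]%G.
Notation av eps := (avg eps full).
Notation E eps := (avg eps st0).

(** The [chi]-semi-invariants of the stabilizer of a place form the character
    induced from that stabilizer, which is the sum of [chi] and of the standard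
    character twisted by [chi]; the difference isolates the latter. Its image in
    the tensor power is V_31 for the trivial character and V_211 for the sign. *)
Definition hook_proj eps : 'M[k]_N := E eps - av eps.

Lemma st0_sub : st0 \subset full. Proof. exact: subsetT. Qed.

Lemma pmx_av eps t : pmx t *m av eps = chi eps t *: av eps.
Proof. by apply: pmx_avg; rewrite inE. Qed.
Lemma av_pmx eps t : av eps *m pmx t = chi eps t *: av eps.
Proof. by apply: avg_pmx; rewrite inE. Qed.

Lemma hook_idem eps : hook_proj eps *m hook_proj eps = hook_proj eps.
Proof.
rewrite /hook_proj mulmxBl !mulmxBr (avg_sub_r eps st0_sub) !avg_sub ?st0_sub //.
by rewrite subrr subr0.
Qed.

Lemma hook_tens eps A : hook_proj eps *m tens A = tens A *m hook_proj eps.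
Proof. by rewrite /hook_proj mulmxBl mulmxBr !avg_tens. Qed.

Lemma hook_tr eps : (hook_proj eps)^T = hook_proj eps.
Proof. by rewrite /hook_proj linearB /= !avg_tr. Qed.

(** S_4 acts doubly transitively on the four places. *)
Lemma st0_double_coset s t : s \notin st0 -> t \notin st0 ->
  exists u v, [/\ u \in st0, v \in st0 & t = (u * s * v)%g].
Proof.
rewrite !inE => s0 t0; pose v := tperm (s ord0) (t ord0).
exists (t * (s * v)^-1)%g, v; split; last by rewrite -mulgA mulgKV.
  rewrite inE permM; apply/eqP; apply: (canLR (permK _)).
  by rewrite permM tpermL.
by rewrite inE tpermD.
Qed.

(** As [st0] has only one nontrivial double coset, E P_s E is the same, up to
    [chi], for all s outside [st0]; summing E P_s E over S_4 gives the whole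
    average. *)
Lemma avg_st0_conj eps s : s \notin st0 ->
  #|~: st0|%:R *: (chi eps s *: (E eps *m pmx s *m E eps)) =
  #|full|%:R *: av eps - #|st0|%:R *: E eps.
Proof.
move=> s0; have avE : #|full|%:R *: av eps = \sum_s chi eps s *: pmx s.
  rewrite avgE scalerA mulfV ?card_group_neq0 // scale1r.
  by apply: eq_bigl => t; rewrite inE.
apply/eqP; rewrite eq_sym subr_eq addrC; apply/eqP.
have <- : E eps *m av eps *m E eps = av eps.
  by rewrite avg_sub ?st0_sub // avg_sub_r ?st0_sub.
rewrite scalemxAl scalemxAr avE.
rewrite mulmx_sumr mulmx_suml (bigID (mem st0)) /=; congr (_ + _).
  rewrite (eq_bigr (fun=> E eps)) => [|t tH]; last first.
    by rewrite -scalemxAr -scalemxAl avg_pmx // -scalemxAl avg_sub // scalerA chiK scale1r.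
  by rewrite sumr_const scaler_nat.
rewrite (eq_bigl (mem (~: st0))) => [|t]; last by rewrite !inE.
rewrite scaler_nat -sumr_const; apply: eq_bigr => t t1.
have t0 : t \notin st0 by move: t1; rewrite !inE.
have [u [v [uH vH ->]]] := st0_double_coset s0 t0.
rewrite !pmxM -scalemxAr -scalemxAl !mulmxA (avg_pmx eps uH) -!mulmxA (pmx_avg eps vH).
rewrite -!scalemxAl -!scalemxAr !scalerA !mulmxA; congr (_ *: _).
transitivity ((chi eps u * chi eps u) * (chi eps v * chi eps v) * chi eps s).
  by rewrite !chiM; ring.
by rewrite !chiK !mul1r.
Qed.

Lemma st0_cardC : (0 < #|~: st0|)%N.
Proof.
apply/card_gt0P; exists (tperm ord0 (lift ord0 ord0)).
by rewrite !inE tpermL.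
Qed.

(** The spherical function of the hook representation with respect to [st0],
    twisted by [chi]. *)
Definition hook_coef eps s : k :=
  if s \in st0 then chi eps s else - (chi eps s * #|st0|%:R / #|~: st0|%:R).

Lemma cardC_neq0 : #|~: st0|%:R != 0 :> k.
Proof. by rewrite ((pcharf0P k).1 char0) -lt0n st0_cardC. Qed.

Lemma hook_pmx_hook eps s : hook_proj eps *m pmx s *m hook_proj eps = hook_coef eps s *: hook_proj eps.
Proof.
have -> : hook_proj eps *m pmx s *m hook_proj eps = E eps *m pmx s *m E eps - chi eps s *: av eps.
  have h : E eps *m pmx s *m av eps = chi eps s *: av eps.
    by rewrite -mulmxA pmx_av -scalemxAr avg_sub ?st0_sub.
  rewrite /hook_proj mulmxBl av_pmx mulmxBl !mulmxBr h -!scalemxAl.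
  by rewrite (avg_sub_r eps st0_sub) avg_sub // subrr subr0.
rewrite /hook_coef; case: ifPn => sH.
  by rewrite avg_pmx // -scalemxAl avg_sub // /hook_proj scalerBr.
have := avg_st0_conj eps sH; rewrite scalerA => h.
have -> : E eps *m pmx s *m E eps = (chi eps s / #|~: st0|%:R) *:
    (#|full|%:R *: av eps - #|st0|%:R *: E eps).
  by rewrite -h scalerA -mulrA (mulrA _^-1) mulVf ?cardC_neq0 // mul1r chiK scale1r.
have -> : #|full|%:R = #|st0|%:R + #|~: st0|%:R :> k.
  by rewrite -natrD; congr _%:R; rewrite cardsC -cardsT; apply: eq_card => x; rewrite !inE.
have := cardC_neq0; set a : k := #|~: st0|%:R; set c : k := #|st0|%:R => a0.
apply/matrixP => x y; rewrite /hook_proj !mxE; set p := avg _ _ _ _; set q := avg _ _ _ _.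
set w := chi _ _; by field.
Qed.

(** The sum is |H| + |H'| (|H| / |H'|)^2 = |H| (|H| + |H'|) / |H'|, where H is
    the stabilizer and H' its complement. *)
Lemma hook_primitive_sum eps : \sum_s hook_coef eps s * hook_coef eps s^-1%g != 0.
Proof.
have c0 := cardC_neq0; have h0 := card_group_neq0 [group of st0].
rewrite (bigID (mem st0)) /= (eq_bigr (fun=> 1)) => [|s sH]; last first.
  by rewrite /hook_coef groupV sH chiV chiK.
rewrite [X in _ + X](eq_bigr (fun=> (#|st0|%:R / #|~: st0|%:R) ^+ 2)) => [|s sH]; last first.
  rewrite /hook_coef groupV (negbTE sH) chiV mulrNN expr2.
  transitivity ((chi eps s * chi eps s) * (#|st0|%:R / #|~: st0|%:R * (#|st0|%:R / #|~: st0|%:R))).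
    by ring.
  by rewrite chiK mul1r.
rewrite sumr_const (eq_bigl (mem (~: st0))) => [|s]; last by rewrite !inE.
rewrite sumr_const -mulr_natr -[X in _ + X]mulr_natr.
set a : k := #|mem (~: _)|%:R.
rewrite (_ : _ + _ = #|st0|%:R * (#|~: st0|%:R + #|st0|%:R) / #|~: st0|%:R).
  rewrite mulf_neq0 ?invr_eq0 // mulf_neq0 // -natrD.
  by rewrite ((pcharf0P k).1 char0) addn_eq0 negb_and -lt0n st0_cardC.
rewrite -/a in c0 *; by field.
Qed.
End Projectors.

(** * Highest weights *)

Section Weights.
Variables (k : fieldType) (n : nat).
Hypothesis char0 : [pchar k] =i pred0.

Notation idx := {ffun 'I_4 -> 'I_n}.
Notation N := #|{ffun 'I_4 -> 'I_n}|.
Notation pmx := (pmx k n).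
Notation av eps := (avg k n eps [set: 'S_4]%G).
Notation E eps := (avg k n eps st0).
Notation hook := (hook_proj k n).
Implicit Types (eps : bool) (s t : 'S_4) (G H : {group 'S_4}) (i j b : idx).

Lemma av_idem eps : av eps *m av eps = av eps.
Proof. by rewrite avg_sub. Qed.

Definition summand4 := summand_of (av_idem false) (@avg_tens k n false _).
Definition summand31 := summand_of (hook_idem n char0 false) (@hook_tens k n false).
Definition summand211 := summand_of (hook_idem n char0 true) (@hook_tens k n true).

Lemma primitive4 : primitive summand4.
Proof.
exists (fun=> 1); split=> [t|].
  by rewrite summand_of_proj av_pmx -scalemxAl av_idem /chi /= expr0.
rewrite (eq_bigr (fun=> 1)) => [|t _]; last by rewrite mulr1.
by rewrite sumr_const ((pcharf0P k).1 char0) card_Sn.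
Qed.

Lemma primitive31 : primitive summand31.
Proof.
exists (hook_coef k false); split; last exact: hook_primitive_sum.
by move=> t; rewrite summand_of_proj hook_pmx_hook.
Qed.

Lemma primitive211 : primitive summand211.
Proof.
exists (hook_coef k true); split; last exact: hook_primitive_sum.
by move=> t; rewrite summand_of_proj hook_pmx_hook.
Qed.

Lemma anti_eq0 m m' (M : 'M[k]_(m, m')) : M = - M -> M = 0.
Proof.
move=> /eqP; rewrite -subr_eq0 opprK -mulr2n -scaler_nat scaler_eq0.
by rewrite ((pcharf0P k).1 char0) => /eqP.
Qed.

(** A transposition in G acts by -1 on one side and by 1 on the other. *)
Lemma sign_avg_av G (p q : 'I_4) : p != q -> tperm p q \in G ->
  avg k n true G *m av false = 0.
Proof.
move=> pq tG; apply: anti_eq0; rewrite -[in LHS](scale1r (av false)).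
have <- : chi k false (tperm p q) = 1 by rewrite chi_tperm.
rewrite -pmx_av mulmxA avg_pmx // chi_tperm // expr1 scaleN1r mulNmx.
by [].
Qed.

Lemma tperm_st0 (p q : 'I_4) : p != ord0 -> q != ord0 -> tperm p q \in st0.
Proof. by move=> p0 q0; rewrite inE tpermD. Qed.

Lemma hook_sign_av : hook true *m av false = 0.
Proof.
have p12 : lift ord0 ord0 != lift ord0 (lift ord0 ord0) :> 'I_4 by [].
rewrite /hook_proj mulmxBl (sign_avg_av p12) ?tperm_st0 //.
by rewrite (sign_avg_av p12) ?inE // subrr.
Qed.

Lemma disjoint_4_211 : disjoint_from summand4 summand211.
Proof.
move=> t; rewrite !summand_of_proj -mulmxA pmx_av -scalemxAr hook_sign_av.
by rewrite scaler0.
Qed.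

Lemma disjoint_211_4 : disjoint_from summand211 summand4.
Proof.
move=> t; rewrite !summand_of_proj av_pmx -scalemxAl.
apply/eqP; rewrite scaler_eq0 -trmx_eq0 trmx_mul hook_tr avg_tr hook_sign_av.
by rewrite eqxx orbT.
Qed.

Definition basis_vec i : 'cV[k]_N := delta_mx (enum_rank i) 0.

Lemma basis_vecE i j : basis_vec i (enum_rank j) 0 = (j == i)%:R.
Proof. by rewrite mxE (inj_eq enum_rank_inj) andbT. Qed.

Lemma pmx_basis s i : pmx s *m basis_vec i = basis_vec (pidx s^-1%g i).
Proof.
apply: rank_rowP => j z; rewrite ord1 pmx_mulE !basis_vecE.
by rewrite -[in RHS](inj_eq (can_inj (pidxK s))) pidxKV.
Qed.

Lemma mx_basis_eq0 m (M : 'M[k]_(m, N)) : (forall i, M *m basis_vec i = 0) -> M = 0.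
Proof.
move=> h; apply/matrixP => a b; have /matrixP/(_ a 0) := h (enum_val b).
by rewrite /basis_vec enum_valK -colE !mxE.
Qed.

Lemma sum_basis (v : 'cV[k]_N) : v = \sum_i v (enum_rank i) 0 *: basis_vec i.
Proof.
apply: rank_rowP => j z; rewrite ord1 summxE (bigD1 j) //= big1 ?addr0.
  by rewrite mxE basis_vecE eqxx mulr1.
by move=> i ne; rewrite mxE basis_vecE eq_sym (negbTE ne) mulr0.
Qed.

Lemma tens_basis A b i :
  (tens A *m basis_vec b) (enum_rank i) 0 = \prod_p A (i p) (b p).
Proof. by rewrite /basis_vec -colE mxE tensE. Qed.

(** A unitriangular matrix sends the word b to b plus a combination of words i
    that are letterwise at most b. If the idempotent kills all of these, the
    projection of b is a highest weight vector, and its weight is the content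
    of b. *)
Lemma highest_weight (s : tens_summand k n) lam b :
  sm_proj s *m basis_vec b != 0 ->
  (forall i, i != b -> (forall p, (i p <= b p)%N) -> sm_proj s *m basis_vec i = 0) ->
  (forall t : 'rV[k]_n, \prod_p t 0 (b p) = \prod_i t 0 i ^+ nth 0%N lam i) ->
  has_highest_weight lam (sm_rep s).
Proof.
move=> nz low wt; exists (sm_out s *m basis_vec b).
have out0 (v : 'cV_N) : sm_proj s *m v = 0 -> sm_out s *m v = 0.
  by move=> h; rewrite -sm_out_proj -mulmxA h mulmx0.
have act A : sm_mx s A *m (sm_out s *m basis_vec b) =
    sm_out s *m (tens A *m basis_vec b).
  by rewrite /sm_mx !mulmxA -(mulmxA _ _ (sm_out s)) -(mulmxA (sm_out s))
     -sm_proj_tens mulmxA sm_out_proj.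
split=> [|A uA|t _].
- by apply: contraNneq nz => h; rewrite /sm_proj -mulmxA h mulmx0.
- rewrite /= act [tens A *m _]sum_basis (bigD1 b) //= mulmxDr.
  rewrite tens_basis big1 ?scale1r => [|p _]; last by rewrite uA // eqxx.
  rewrite mulmx_sumr big1 ?addr0 // => i ib; rewrite -scalemxAr tens_basis.
  case: (boolP [forall p, (i p <= b p)%N]) => [/forallP le|].
    by rewrite (out0 _ (low _ ib le)) scaler0.
  rewrite negb_forall => /existsP[p]; rewrite -ltnNge => lt.
  rewrite (bigD1 p) //= uA ?(ltnW lt) // (_ : (_ == _) = false) ?mul0r ?scale0r //.
  by apply/eqP => e; rewrite e ltnn in lt.
rewrite /= act [tens _ *m _]sum_basis (bigD1 b) //= big1 ?addr0; last first.
  move=> i ib; rewrite tens_basis.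
  have [p np] := word_neq ib.
  by rewrite (bigD1 p) //= mxE (negbTE np) mulr0n mul0r scale0r.
rewrite -scalemxAr tens_basis -wt; congr (_ *: _).
by apply: eq_bigr => p _; rewrite mxE eqxx mulr1n.
Qed.

Definition quad (a b c d : 'I_n) : idx := [ffun p : 'I_4 => nth a [:: a; b; c; d] p].

(** The transposition of two places with equal letters fixes the word but acts
    by -1 on the average. *)
Lemma avg_sign_repeat G i (p q : 'I_4) : p != q -> tperm p q \in G -> i p = i q ->
  avg k n true G *m basis_vec i = 0.
Proof.
move=> pq tG ipq; apply: anti_eq0.
have e : pmx (tperm p q) *m basis_vec i = basis_vec i.
  rewrite pmx_basis; congr basis_vec; apply/ffunP => x; rewrite ffunE invgK.
  by case: tpermP => // ->.
rewrite -[in LHS]e mulmxA avg_pmx // chi_tperm // expr1 scaleN1r mulNmx.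
by [].
Qed.

Lemma avg_fixed G i : (forall s, s \in G -> pidx s i = i) ->
  avg k n false G *m basis_vec i = basis_vec i.
Proof.
move=> h; apply: avg_mul_fixed => // s sG.
by rewrite pmx_basis h ?groupV // /chi /= expr0 scale1r.
Qed.

(** A constant word is invariant under all permutations, so both averages fix it. *)
Lemma hook_const i a : (forall p, i p = a) -> hook false *m basis_vec i = 0.
Proof.
move=> ia; rewrite /hook_proj mulmxBl !avg_fixed ?subrr // => s _;
  by apply/ffunP => p; rewrite ffunE !ia.
Qed.

Lemma hook_sign_repeat i (p q : 'I_4) : p != q -> p != ord0 -> q != ord0 ->
  i p = i q -> hook true *m basis_vec i = 0.
Proof.
move=> pq p0 q0 ipq; rewrite /hook_proj mulmxBl.
by rewrite (avg_sign_repeat pq (tperm_st0 p0 q0) ipq) (avg_sign_repeat pq _ ipq) ?inE // subrr.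
Qed.

Lemma av_basis_neq0 (a : 'I_n) : av false *m basis_vec [ffun=> a] != 0.
Proof.
rewrite avg_fixed => [|s _]; last by apply/ffunP => p; rewrite !ffunE.
apply/eqP => /matrixP/(_ (enum_rank [ffun=> a]) 0).
by rewrite basis_vecE eqxx mxE => /eqP; rewrite oner_eq0.
Qed.

(** The word is fixed by the stabilizer of place 0. Were its projection zero, it
    would equal its average over S_4 and be symmetric. *)
Lemma hook_basis_neq0 (a a' : 'I_n) : a != a' ->
  hook false *m basis_vec (quad a a' a' a') != 0.
Proof.
move=> ne; set b := quad _ _ _ _.
have b0 (p : 'I_4) : p != ord0 -> b p = a'.
  by rewrite ffunE; case: p => -[|[|[|[|//]]]].
rewrite /hook_proj mulmxBl subr_eq0 avg_fixed; last first.
  move=> s; rewrite inE => /eqP s0; apply/ffunP => p; rewrite ffunE.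
  have sV0 : s^-1%g ord0 = ord0 by rewrite -[in LHS]s0 permK.
  case: (eqVneq p ord0) => [->|np]; first by rewrite sV0.
  rewrite !b0 //; apply: contraNneq np => e.
  by rewrite -[p](permKV s) e s0.
apply/eqP => e; pose t : 'S_4 := tperm ord0 (lift ord0 ord0).
have : pmx t *m basis_vec b = basis_vec b.
  by rewrite e mulmxA pmx_av /chi /= expr0 scale1r.
rewrite pmx_basis => /matrixP/(_ (enum_rank b) 0); rewrite !basis_vecE eqxx.
case: eqP => [/ffunP/(_ ord0)|_ /eqP]; last by rewrite eq_sym oner_eq0.
by rewrite !ffunE invgK tpermL /= => h; rewrite h eqxx in ne.
Qed.

(** The average over S_4 vanishes because of the repeated letter, and in the
    average over [st0] the word itself occurs only for the identity, its last
    three letters being distinct. *)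
Lemma hook_sign_basis_neq0 (a a' a'' : 'I_n) : a != a' -> a != a'' -> a' != a'' ->
  hook true *m basis_vec (quad a a a' a'') != 0.
Proof.
move=> n1 n2 n3; set b := quad _ _ _ _.
have p01 : ord0 != lift ord0 ord0 :> 'I_4 by [].
rewrite /hook_proj mulmxBl (avg_sign_repeat (G := [set: 'S_4]%G) p01) ?inE ?ffunE // subr0.
apply/eqP => /matrixP/(_ (enum_rank b) 0); rewrite avgE -scalemxAl mulmx_suml 2!mxE.
rewrite summxE (bigD1 1%g) //= big1 ?addr0; last first.
  move=> s /andP[]; rewrite inE => /eqP s0 s1; rewrite -scalemxAl mxE pmx_basis basis_vecE.
  case: eqP => [e|_]; last by rewrite mulr0.
  case/eqP: s1; apply/permP => p; rewrite perm1.
  case: (eqVneq p ord0) => [->//|np].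
  have nsp : s p != ord0 by apply: contraNneq np => h; rewrite -s0 in h; rewrite (perm_inj h).
  have := congr1 (fun f : idx => f p) e; rewrite !ffunE invgK.
  move: (s p) nsp => q nq; case: p np {s0 e} => -[|[|[|[|//]]]] // ? _;
  case: q nq => -[|[|[|[|//]]]] // ? _ /= h; try (by apply: val_inj);
  by move: n1 n2 n3; rewrite ?h ?eqxx // -?h ?eqxx.
rewrite -(scalemxAl (chi k true 1)) pmx1 mul1mx mxE basis_vecE eqxx mulr1 chi1 mulr1 => /eqP.
by rewrite invr_eq0 (negbTE (card_group_neq0 char0 _)).
Qed.

End Weights.

Section IsV.
Variables (k : fieldType) (n : nat).
Hypothesis char0 : [pchar k] =i pred0.

Lemma sm_dim_gt0 (s : tens_summand k n) m (v : 'M_(_, m)) : sm_proj s *m v != 0 -> (0 < sm_dim s)%N.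
Proof.
apply: contraNT; rewrite -leqNgt leqn0 => /eqP d0; rewrite /sm_proj.
have -> : sm_in s = 0 by apply/matrixP => a b; have: (b < 0)%N by rewrite -d0.
by rewrite !mul0mx.
Qed.

Lemma prod4 (F : 'I_4 -> k) :
  \prod_p F p = F (inord 0) * F (inord 1) * F (inord 2) * F (inord 3).
Proof.
rewrite !big_ord_recl big_ord0 mulr1 !mulrA; congr (F _ * F _ * F _ * F _);
  by apply: val_inj; rewrite /= inordK.
Qed.

Lemma quad0 (a b c d : 'I_n) : quad a b c d (inord 0) = a.
Proof. by rewrite ffunE inordK. Qed.
Lemma quad1 (a b c d : 'I_n) : quad a b c d (inord 1) = b.
Proof. by rewrite ffunE inordK. Qed.
Lemma quad2 (a b c d : 'I_n) : quad a b c d (inord 2) = c.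
Proof. by rewrite ffunE inordK. Qed.
Lemma quad3 (a b c d : 'I_n) : quad a b c d (inord 3) = d.
Proof. by rewrite ffunE inordK. Qed.
Definition quadE := (quad0, quad1, quad2, quad3).

Lemma quadP (i : {ffun 'I_4 -> 'I_n}) :
  i = quad (i (inord 0)) (i (inord 1)) (i (inord 2)) (i (inord 3)).
Proof.
apply/ffunP => p; rewrite ffunE.
by case: p => -[|[|[|[|//]]]] lt /=; congr (i _); apply: val_inj; rewrite /= inordK.
Qed.

(** The highest weight vector is the word 0000, the lowest word of all. *)
Lemma is_V4 : (0 < n)%N -> is_V [:: 4%N] (sm_rep (summand4 n char0)).
Proof.
move=> n0; rewrite /is_V /= n0; pose o : 'I_n := Ordinal n0.
have nz := av_basis_neq0 char0 o.
have nz' : sm_proj (summand4 n char0) *m basis_vec k [ffun=> o] != 0.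
  by rewrite summand_of_proj.
split; first by apply: sm_rep_irreducible (sm_dim_gt0 nz') => //; apply: primitive4.
apply: (highest_weight nz') => [i ne le|t].
  case/eqP: ne; apply/ffunP => p; apply: val_inj => /=.
  by have := le p; rewrite !ffunE /= leqn0 => /eqP.
rewrite prod4 !ffunE (bigD1 o) //= big1 ?mulr1 => [|i]; first by rewrite !exprS expr0 mulr1 !mulrA.
by case: i => -[|[|i]] lt //=; rewrite ?expr0 // => /eqP[]; apply: val_inj.
Qed.

(** The highest weight vector is the projection of the word 1000; the only
    lower word, 0000, is constant and projects to zero. *)
Lemma is_V31 : is_V [:: 3%N; 1%N] (sm_rep (summand31 n char0)).
Proof.
rewrite /is_V /=; case: ltnP => n1; last first.
  suff h0 : hook_proj k n false = 0 by change (\rank (hook_proj k n false) = 0%N); rewrite h0 mxrank0.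
  apply: mx_basis_eq0 => i.
  apply: (hook_const char0 (a := i ord0)) => p; apply: val_inj => /=.
  by case: (i p) (i ord0) => [[|a] la] [[|b] lb] //=; move: (leq_trans la n1) (leq_trans lb n1).
pose o0 : 'I_n := Ordinal (ltnW n1); pose o1 : 'I_n := Ordinal n1.
have nz := hook_basis_neq0 char0 (isT : o1 != o0).
have nz' : sm_proj (summand31 n char0) *m basis_vec k (quad o1 o0 o0 o0) != 0.
  by rewrite summand_of_proj.
split; first by apply: sm_rep_irreducible (sm_dim_gt0 nz') => //; apply: primitive31.
apply: (highest_weight nz') => [i ne le|t].
  rewrite summand_of_proj; apply: (hook_const char0 (a := o0)).
  have := le (inord 0); have := le (inord 1); have := le (inord 2); have := le (inord 3).
  move: ne; rewrite (quadP i) !quadE.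
  move: (i (inord 0)) (i (inord 1)) (i (inord 2)) (i (inord 3)) => [x lx] [y ly] [z lz] [w lw].
  rewrite /= !leqn0 => ne /eqP ew /eqP ez /eqP ey le0; subst.
  have ex : x = 0%N.
    case: x lx le0 ne => [|[|//]] // lx _ /eqP[]; congr quad; exact: val_inj.
  by subst; move=> p; rewrite ffunE; case: p => -[|[|[|[|//]]]] lp /=; apply: val_inj.
rewrite prod4 !quadE (bigD1 o0) //= (bigD1 o1) //= big1 ?mulr1 => [|i].
  by ring.
case: i => -[|[|i]] lt /andP[/eqP h1 /eqP h2].
- by case: h1; apply: val_inj.
- by case: h2; apply: val_inj.
by rewrite /= nth_nil expr0.
Qed.

(** The highest weight vector is the projection of the word 0012. A lower word
    has a repeated letter among its last three and projects to zero. With fewer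
    than three letters every word has such a repetition. *)
Lemma is_V211 : is_V [:: 2%N; 1%N; 1%N] (sm_rep (summand211 n char0)).
Proof.
pose q1 : 'I_4 := inord 1; pose q2 : 'I_4 := inord 2; pose q3 : 'I_4 := inord 3.
have nq1 : q1 != ord0 by rewrite -val_eqE /= inordK.
have nq2 : q2 != ord0 by rewrite -val_eqE /= inordK.
have nq3 : q3 != ord0 by rewrite -val_eqE /= inordK.
have q12 : q1 != q2 by rewrite -val_eqE /= !inordK.
have q13 : q1 != q3 by rewrite -val_eqE /= !inordK.
have q23 : q2 != q3 by rewrite -val_eqE /= !inordK.
rewrite /is_V /=; case: ltnP => n1; last first.
  suff h0 : hook_proj k n true = 0 by change (\rank (hook_proj k n true) = 0%N); rewrite h0 mxrank0.
  apply: mx_basis_eq0 => i.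
  have [e|n12] := eqVneq (i q1) (i q2); first exact: (hook_sign_repeat char0 q12).
  have [e|n13] := eqVneq (i q1) (i q3); first exact: (hook_sign_repeat char0 q13).
  apply: (hook_sign_repeat char0 q23) => //; apply: val_inj => /=.
  move: n12 n13; rewrite -!val_eqE /=.
  have := leq_trans (ltn_ord (i q1)) n1; have := leq_trans (ltn_ord (i q2)) n1.
  have := leq_trans (ltn_ord (i q3)) n1.
  by move: (nat_of_ord (i q1)) (nat_of_ord (i q2)) (nat_of_ord (i q3)) => [|[|//]] [|[|//]] [|[|//]].
pose o0 : 'I_n := Ordinal (ltnW (ltnW n1)); pose o1 : 'I_n := Ordinal (ltnW n1).
pose o2 : 'I_n := Ordinal n1.
have nz := hook_sign_basis_neq0 char0 (isT : o0 != o1) (isT : o0 != o2) (isT : o1 != o2).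
have nz' : sm_proj (summand211 n char0) *m basis_vec k (quad o0 o0 o1 o2) != 0.
  by rewrite summand_of_proj.
split; first by apply: sm_rep_irreducible (sm_dim_gt0 nz') => //; apply: primitive211.
apply: (highest_weight nz') => [i ne le|t].
  rewrite summand_of_proj.
  have [e|n12] := eqVneq (i q1) (i q2); first exact: (hook_sign_repeat char0 q12).
  have [e|n13] := eqVneq (i q1) (i q3); first exact: (hook_sign_repeat char0 q13).
  have [e|n23] := eqVneq (i q2) (i q3); first exact: (hook_sign_repeat char0 q23).
  case/eqP: ne; rewrite [i]quadP -/q1 -/q2 -/q3.
  have := le (inord 0); have := le q1; have := le q2; have := le q3.
  rewrite !quadE; move: n12 n13 n23; rewrite -!val_eqE /=.
  move: (i q1) (i q2) (i q3) (i (inord 0)) => [a la] [b lb] [c lc] [d ld] /=.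
  move=> n12 n13 n23 h3 h2 h1 h0.
  have ea : a = 0%N by case: (a) h1.
  have eb : b = 1%N by move: h2 n12; rewrite ea; case: (b) => [|[|]].
  have ec : c = 2%N by move: h3 n13 n23; rewrite ea eb; case: (c) => [|[|[|]]].
  have ed : d = 0%N by case: (d) h0.
  by subst; congr quad; apply: val_inj.
rewrite prod4 !quadE (bigD1 o0) //= (bigD1 o1) //= (bigD1 o2) //= big1 ?mulr1 => [|i].
  by ring.
case: i => -[|[|[|i]]] lt /andP[/andP[/eqP h1 /eqP h2] /eqP h3].
- by case: h1; apply: val_inj.
- by case: h2; apply: val_inj.
- by case: h3; apply: val_inj.
by rewrite /= nth_nil expr0.
Qed.
End IsV.

(** * Functions on ordered pairs of places and symmetry criteria *)

Section Pairs.
Variables (k : fieldType) (X : nat -> nat -> nat -> nat -> k).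

(** Places are natural numbers below 4. *)
Definition distinct4 (s : seq nat) := all (fun p => (p < 4)%N) s && uniq s.

Hypothesis anti : forall a b c d, distinct4 [:: a; b] -> distinct4 [:: c; d] ->
  X b a d c = - X a b c d.
Hypothesis matching : forall a b b' b'' c d d' d'',
  distinct4 [:: a; b; b'; b''] -> distinct4 [:: c; d; d'; d''] ->
  X a b c d + X a b' c d' + X a b'' c d'' = 0.

(** All identities of this section are linear consequences of the relations
    W = 0; each proof exhibits the coefficients. *)
Let W a b b' b'' c d d' d'' := X a b c d + X a b' c d' + X a b'' c d''.

Let W0 a b b' b'' c d d' d'' : distinct4 [:: a; b; b'; b''] ->
  distinct4 [:: c; d; d'; d''] -> W a b b' b'' c d d' d'' = 0.
Proof. exact: matching. Qed.

Let antiE := (fun c d => @anti 0 1 c d isT, fun c d => @anti 0 2 c d isT,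
  fun c d => @anti 0 3 c d isT, fun c d => @anti 1 2 c d isT,
  fun c d => @anti 1 3 c d isT, fun c d => @anti 2 3 c d isT).

(** Four times the value f(01) of the decomposition below. *)
Definition left_part := X 0 1 0 1 + X 0 1 1 0 + X 0 1 2 3 + X 0 1 3 2.
Definition right_part := X 0 1 0 1 + X 1 0 0 1 + X 2 3 0 1 + X 3 2 0 1.

(** Eight times the value C(a, d) of the decomposition below. *)
Definition hook_part a d : k :=
  \sum_(b <- [seq x <- iota 0 4 | x != a]) \sum_(c <- [seq x <- iota 0 4 | x != d]) X a b c d.

(** The average of X(01, cd) over the four ordered pairs cd that make up a
    matching of the places does not depend on the matching. This is what makes
    the left part symmetric in the column places. *)
Lemma pairing_indep :
  left_part = X 0 1 0 2 + X 0 1 2 0 + X 0 1 1 3 + X 0 1 3 1.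
Proof.
apply: subr0_eq; transitivity (W 0 1 2 3 3 2 0 1 - W 0 1 2 3 3 1 0 2
  - W 1 0 2 3 0 1 3 2 + W 2 0 1 3 2 0 3 1 + W 3 0 1 2 1 3 0 2
  + W 1 0 2 3 3 1 2 0 - W 0 1 2 3 0 2 1 3 - W 3 0 1 2 2 3 0 1
  - W 2 0 1 3 1 0 3 2 + W 0 1 2 3 0 1 2 3 - W 1 0 2 3 3 2 1 0
  + W 1 0 2 3 0 2 3 1); last by rewrite !W0 // !subr0 !addr0.
by rewrite /left_part /W !antiE //; ring.
Qed.

(** The cyclic relation that separates V_211 from V_31 among the tensors
    alternating in two places and symmetric in the others. *)
Lemma left_part_sum :
  \sum_(b <- [:: 1; 2; 3]%N) (X 0 b 0 1 + X 0 b 1 0 + X 0 b 2 3 + X 0 b 3 2) = 0.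
Proof.
transitivity (- W 1 0 2 3 2 3 1 0 - W 2 0 1 3 1 0 2 3 - W 1 0 2 3 3 2 0 1
  - W 3 0 1 2 0 1 2 3 - W 2 0 1 3 3 2 1 0 - W 1 0 2 3 1 0 3 2
  - W 3 0 1 2 2 3 1 0 - W 2 0 1 3 0 1 3 2 - W 3 0 1 2 1 0 3 2
  - W 2 0 1 3 2 3 0 1 - W 1 0 2 3 0 1 2 3 - W 3 0 1 2 3 2 0 1); last first.
  by rewrite !W0 // !subr0 oppr0.
by rewrite !big_cons big_nil /W !antiE //; ring.
Qed.

(** The relation that places the hook part in V_31. *)
Lemma hook_part_sum : \sum_(a <- iota 0 4) hook_part a 0 = 0.
Proof.
transitivity (- W 1 0 2 3 0 1 2 3 - W 1 0 2 3 0 2 3 1 - W 1 0 2 3 0 3 1 2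
  - W 2 0 1 3 0 1 3 2 - W 3 0 1 2 0 1 3 2 - W 0 1 2 3 0 3 2 1
  - W 2 0 1 3 0 2 1 3 - W 3 0 1 2 0 3 2 1 - W 0 1 2 3 0 2 1 3
  - W 2 0 1 3 0 3 2 1 - W 0 1 2 3 0 1 3 2 - W 3 0 1 2 0 2 1 3); last first.
  by rewrite !W0 // !subr0 oppr0.
by rewrite /hook_part /= !big_cons !big_nil /W !antiE //; ring.
Qed.

(** X(ab, cd) = f(ab) + g(cd) + C(a, d) - C(b, c), at ab = cd = 01; the general
    case follows by relabelling the letters. *)
Lemma pair_decomposition :
  8%:R * X 0 1 0 1 =
  2%:R * left_part + 2%:R * right_part + (hook_part 0 1 - hook_part 1 0).
Proof.
apply: subr0_eq; transitivity (- W 0 1 2 3 2 3 1 0 - W 1 0 2 3 1 0 3 2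
  + W 1 0 2 3 2 3 1 0 - W 3 0 1 2 0 2 3 1 - W 2 0 1 3 0 3 2 1
  + W 1 0 2 3 1 2 3 0 - W 0 1 2 3 3 2 0 1 - W 2 0 1 3 0 2 3 1
  + W 1 0 2 3 1 3 0 2 - W 0 1 2 3 2 3 0 1 + W 0 1 2 3 0 1 3 2
  - W 0 1 2 3 0 2 3 1 + W 2 0 1 3 1 3 2 0 - W 0 1 2 3 0 3 1 2); last first.
  by rewrite !W0 // !subr0 !addr0 oppr0.
by rewrite /left_part /right_part /hook_part /= !big_cons !big_nil /W !antiE //; ring.
Qed.
End Pairs.

Section Semiinvariant.
Variables (k : fieldType) (n : nat).
Hypothesis char0 : [pchar k] =i pred0.

Notation idx := {ffun 'I_4 -> 'I_n}.
Notation N := #|{ffun 'I_4 -> 'I_n}|.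
Notation av eps := (avg k n eps [set: 'S_4]%G).
Notation hook := (hook_proj k n).
Notation tp a b := (tperm (inord a : 'I_4) (inord b)).

Ltac swap_quad := rewrite pmx_mulE;
  match goal with |- _ (enum_rank ?x) _ = _ (enum_rank ?y) _ => suff -> : x = y by [] end;
  apply/ffunP => -[[|[|[|[|//]]]] lt];
  by rewrite !ffunE tpermV permE /= -!val_eqE /= !inordK //= ?inordK.

Section Rows.
Variables (m : nat) (t : 'M[k]_(N, m)).

Lemma swap01 a b c d z :
  (pmx k n (tp 0 1) *m t) (enum_rank (quad a b c d)) z = t (enum_rank (quad b a c d)) z.
Proof. swap_quad. Qed.
Lemma swap02 a b c d z :
  (pmx k n (tp 0 2) *m t) (enum_rank (quad a b c d)) z = t (enum_rank (quad c b a d)) z.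
Proof. swap_quad. Qed.
Lemma swap03 a b c d z :
  (pmx k n (tp 0 3) *m t) (enum_rank (quad a b c d)) z = t (enum_rank (quad d b c a)) z.
Proof. swap_quad. Qed.
Lemma swap12 a b c d z :
  (pmx k n (tp 1 2) *m t) (enum_rank (quad a b c d)) z = t (enum_rank (quad a c b d)) z.
Proof. swap_quad. Qed.
Lemma swap23 a b c d z :
  (pmx k n (tp 2 3) *m t) (enum_rank (quad a b c d)) z = t (enum_rank (quad a b d c)) z.
Proof. swap_quad. Qed.

Lemma quad_rowP (t' : 'M[k]_(N, m)) :
  (forall a b c d z, t (enum_rank (quad a b c d)) z = t' (enum_rank (quad a b c d)) z) ->
  t = t'.
Proof. by move=> h; apply: rank_rowP => i z; rewrite (quadP i) h. Qed.

Definition semi_set eps := [set s | pmx k n s *m t == chi k eps s *: t].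

Lemma semi_group_set eps : group_set (semi_set eps).
Proof.
apply/group_setP; split=> [|s u]; first by rewrite inE pmx1 mul1mx chi1 scale1r.
rewrite !inE => /eqP hs /eqP hu; rewrite pmxM -mulmxA hu -scalemxAr hs scalerA.
by rewrite chiM mulrC.
Qed.
Canonical semi_group eps := group (semi_group_set eps).

(** A permutation that fixes place 0 is brought to the identity by sending the
    places 1 and 2 home with transpositions. *)
Lemma st0_gen (G : {group 'S_4}) : (forall p q, p != ord0 -> q != ord0 -> tperm p q \in G) ->
  st0 \subset G.
Proof.
move=> h; apply/subsetP => s; rewrite inE => /eqP s0.
have mv (u : 'S_4) (p : 'I_4) : u ord0 = ord0 -> p != ord0 ->
    (u * tperm (u p) p \in G)%g -> (u \in G)%g.
  move=> u0 p0; rewrite groupMr //; apply: h => //.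
  by apply: contraNneq p0 => e; apply/eqP/(@perm_inj _ u); rewrite e.
pose p1 : 'I_4 := inord 1; pose p2 : 'I_4 := inord 2; pose p3 : 'I_4 := inord 3.
have n1 : p1 != ord0 by rewrite -val_eqE /= inordK.
have n2 : p2 != ord0 by rewrite -val_eqE /= inordK.
have n12 : p1 != p2 by rewrite -val_eqE /= !inordK.
apply: (mv s p1) => //; set u := (_ * _)%g.
have u0 : u ord0 = ord0.
  rewrite permM s0 tpermD // eq_sym //; apply: contraNneq n1 => e.
  by apply/eqP/(@perm_inj _ s); rewrite s0.
have u1 : u p1 = p1 by rewrite permM tpermL.
apply: (mv u p2) => //; set v := (_ * _)%g.
have v0 : v ord0 = ord0.
  rewrite permM u0 tpermD // eq_sym //; apply: contraNneq n2 => e.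
  by apply/eqP/(@perm_inj _ u); rewrite u0.
have v1 : v p1 = p1.
  rewrite permM u1 tpermD //; last by rewrite eq_sym.
  by apply: contraNneq n12 => e; apply/eqP/(@perm_inj _ u); rewrite u1.
have v2 : v p2 = p2 by rewrite permM tpermL.
suff -> : v = 1%g by apply: group1.
apply/permP => p; rewrite perm1.
have inj x : v p = v x -> p = x by apply: perm_inj.
have e1 : p1 = Ordinal (isT : (1 < 4)%N) by apply: val_inj; rewrite /= inordK.
have e2 : p2 = Ordinal (isT : (2 < 4)%N) by apply: val_inj; rewrite /= inordK.
move: (inj ord0) (inj p1) (inj p2); rewrite v0 v1 v2.
case: p {inj} => -[|[|[|[|//]]]] lt.
- by move=> *; rewrite (_ : Ordinal lt = ord0) ?v0 //; apply: val_inj.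
- by move=> *; rewrite (_ : Ordinal lt = p1) ?v1 //; rewrite e1; apply: val_inj.
- by move=> *; rewrite (_ : Ordinal lt = p2) ?v2 //; rewrite e2; apply: val_inj.
move: (v _) => -[[|[|[|[|//]]]] lv] h0 h1 h2; try by apply: val_inj.
- by have /h0/(congr1 val) : Ordinal lv = ord0 by apply: val_inj.
- have : Ordinal lv = p1 by rewrite e1; apply: val_inj.
  by move/h1; rewrite e1 => /(congr1 val).
have : Ordinal lv = p2 by rewrite e2; apply: val_inj.
by move/h2; rewrite e2 => /(congr1 val).
Qed.

Lemma semi_tp eps (a b : nat) : (a < b < 4)%N ->
  (tp a b \in semi_set eps) = (pmx k n (tp a b) *m t == (-1) ^+ eps *: t).
Proof.
move=> /andP[ab b4]; rewrite inE chi_tperm // -val_eqE /= !inordK ?(ltn_trans ab) //.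
by rewrite neq_ltn ab.
Qed.

Lemma tpC a b : tp a b = tp b a. Proof. exact: tpermC. Qed.

Lemma tp_conj (G : {group 'S_4}) (p q r : 'I_4) : tperm p q \in G -> tperm q r \in G ->
  p != q -> q != r -> p != r -> tperm p r \in G.
Proof.
move=> pq qr npq nqr npr; suff -> : tperm p r = (tperm p q ^ tperm q r)%g.
  by rewrite groupJ.
by rewrite tpermJ tpermL tpermD // eq_sym.
Qed.

End Rows.

Section Criteria.
Variables (m : nat) (eps : bool) (t : 'M[k]_(N, m)).
Notation sgn := ((-1) ^+ eps : k).
Notation T a b c d z := (t (enum_rank (quad a b c d)) z).

Lemma st0_semi : (forall a b c d z, T a c b d z = sgn * T a b c d z) ->
  (forall a b c d z, T a b d c z = sgn * T a b c d z) ->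
  st0 \subset semi_set t eps.
Proof.
move=> h12 h23; have i12 : tp 1 2 \in semi_set t eps.
  rewrite semi_tp //; apply/eqP; apply: quad_rowP => a b c d z.
  by rewrite swap12 mxE h12.
have i23 : tp 2 3 \in semi_set t eps.
  rewrite semi_tp //; apply/eqP; apply: quad_rowP => a b c d z.
  by rewrite swap23 mxE h23.
have i13 : tp 1 3 \in semi_set t eps.
  by apply: (tp_conj i12 i23); rewrite -val_eqE /= !inordK.
apply: st0_gen => p q; rewrite -!val_eqE /=.
have dec (x : 'I_4) : (x != 0 :> nat)%N -> [\/ x = inord 1, x = inord 2 | x = inord 3].
  by case: x => -[|[|[|[|//]]]] lt //= _; [apply: Or31 | apply: Or32 | apply: Or33];
     apply: val_inj; rewrite /= inordK.
move=> /dec[] -> /dec[] ->; rewrite ?tperm1 ?group1 //; rewrite tpC //.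
Qed.

(** The adjacent transpositions generate S_4. *)
Lemma av_criterion : (forall a b c d z, T b a c d z = sgn * T a b c d z) ->
  (forall a b c d z, T a c b d z = sgn * T a b c d z) ->
  (forall a b c d z, T a b d c z = sgn * T a b c d z) -> av eps *m t = t.
Proof.
move=> h01 h12 h23; have i0 := subsetP (st0_semi h12 h23).
have i01 : tp 0 1 \in semi_set t eps.
  rewrite semi_tp //; apply/eqP; apply: quad_rowP => a b c d z.
  by rewrite swap01 mxE h01.
have in0 (q : 'I_4) : q != ord0 -> tperm ord0 q \in semi_set t eps.
  have e0 : inord 0 = ord0 :> 'I_4 by apply: val_inj; rewrite /= inordK.
  rewrite e0 in i01; move=> q0; have [->//|nq] := eqVneq q (inord 1).
  apply: (@tp_conj _ ord0 (inord 1) q) => //.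
  - by apply: i0; rewrite inE tpermD // -val_eqE /= inordK.
  - by rewrite -val_eqE /= inordK.
  - by rewrite eq_sym.
  by rewrite eq_sym.
apply: avg_mul_fixed => // s _; apply/eqP.
suff : s \in semi_set t eps by rewrite inE.
have [ts -> _] := prod_tpermP s; apply: group_prod => -[p q] _ /=.
have [->|np] := eqVneq p ord0.
  by have [->|nq] := eqVneq q ord0; [rewrite tperm1 group1 | apply: in0].
have [->|nq] := eqVneq q ord0; first by rewrite tpermC; apply: in0.
by apply: i0; rewrite inE tpermD.
Qed.

Lemma semi_entries (p q : nat) : (p < q < 4)%N -> tp p q \in semi_set t eps ->
  pmx k n (tp p q) *m t = sgn *: t.
Proof. by move=> pq; rewrite semi_tp // => /eqP. Qed.

Lemma avP : av eps *m t = t -> [/\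
  forall a b c d z, T b a c d z = sgn * T a b c d z,
  forall a b c d z, T a c b d z = sgn * T a b c d z &
  forall a b c d z, T a b d c z = sgn * T a b c d z].
Proof.
move=> ht; have h s : s \in semi_set t eps.
  by rewrite inE -[in X in X == _]ht mulmxA pmx_av -scalemxAl ht.
split=> a b c d z.
- by rewrite -(swap01 t) (semi_entries _ (h _)) // mxE.
- by rewrite -(swap12 t) (semi_entries _ (h _)) // mxE.
by rewrite -(swap23 t) (semi_entries _ (h _)) // mxE.
Qed.

End Criteria.

Section HookCriterion.
Variables (m : nat) (eps : bool) (t : 'M[k]_(N, m)).
Notation sgn := ((-1) ^+ eps : k).
Notation T a b c d z := (t (enum_rank (quad a b c d)) z).

(** The first two conditions are semi-invariance under [st0]. The cosets of
    [st0] are represented by the identity and the transpositions (0 p), so the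
    third says that the average over S_4 vanishes. *)
Lemma hook_criterion : (forall a b c d z, T a c b d z = sgn * T a b c d z) ->
  (forall a b c d z, T a b d c z = sgn * T a b c d z) ->
  (forall a b c d z,
     T a b c d z + sgn * (T b a c d z + T c b a d z + T d b c a z) = 0) ->
  hook eps *m t = t.
Proof.
move=> h12 h23 h0.
have Et : avg k n eps st0 *m t = t.
  apply: avg_mul_fixed => // s /(subsetP (st0_semi h12 h23)).
  by rewrite inE => /eqP.
suff avt : av eps *m t = 0 by rewrite /hook_proj mulmxBl Et avt subr0.
pose u := t + sgn *: (pmx k n (tp 0 1) *m t + pmx k n (tp 0 2) *m t + pmx k n (tp 0 3) *m t).
have u0 : u = 0.
  by apply: quad_rowP => a b c d z; rewrite /u 4!mxE swap01 swap02 swap03 h0 mxE.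
have : av eps *m u = 4%:R *: (av eps *m t).
  rewrite /u mulmxDr -scalemxAr !mulmxDr !mulmxA !av_pmx !chi_tperm;
    try by rewrite -val_eqE /= !inordK.
  rewrite -!scalemxAl -!scalerDl scalerA -[X in X + _]scale1r -scalerDl.
  congr (_ *: _); rewrite !mulrDr -expr2 sqrr_sign; ring.
rewrite u0 mulmx0 => /esym/eqP; rewrite scaler_eq0 ((pcharf0P k).1 char0) /=.
by move/eqP.
Qed.

Lemma hookP : hook eps *m t = t -> [/\
  forall a b c d z, T a c b d z = sgn * T a b c d z,
  forall a b c d z, T a b d c z = sgn * T a b c d z &
  forall a b c d z, T a b c d z + sgn * (T b a c d z + T c b a d z + T d b c a z) = 0].
Proof.
move=> ht; have Et : avg k n eps st0 *m t = t.
  by rewrite -ht mulmxA /hook_proj mulmxBr avg_sub // avg_sub // st0_sub.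
have avt : av eps *m t = 0.
  rewrite -ht mulmxA /hook_proj mulmxBr (avg_sub_r n char0 eps st0_sub) avg_sub //.
  by rewrite subrr mul0mx.
have h s : s \in st0 -> s \in semi_set t eps.
  by move=> s0; rewrite inE -[in X in X == _]Et mulmxA pmx_avg // -scalemxAl Et.
have i12 : tp 1 2 \in semi_set t eps.
  by apply: h; rewrite inE tpermD // -val_eqE /= inordK.
have i23 : tp 2 3 \in semi_set t eps.
  by apply: h; rewrite inE tpermD // -val_eqE /= inordK.
have h12 a b c d z : T a c b d z = sgn * T a b c d z.
  by rewrite -(swap12 t) (semi_entries _ i12) // mxE.
have h23 a b c d z : T a b d c z = sgn * T a b c d z.
  by rewrite -(swap23 t) (semi_entries _ i23) // mxE.
have h13 a b c d z : T a d c b z = sgn * T a b c d z.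
  by rewrite h12 h23 h12; case: (eps); rewrite ?expr0 ?expr1; ring.
split=> //.
pose u := t + sgn *: (pmx k n (tp 0 1) *m t + pmx k n (tp 0 2) *m t + pmx k n (tp 0 3) *m t).
have uE a b c d z : u (enum_rank (quad a b c d)) z =
    T a b c d z + sgn * (T b a c d z + T c b a d z + T d b c a z).
  by rewrite /u 4!mxE swap01 swap02 swap03.
have sgn2 : sgn * sgn = 1 by rewrite -expr2 sqrr_sign.
suff u0 : u = 0 by move=> a b c d z; rewrite -uE u0 mxE.
have <- : av eps *m u = u.
  apply: av_criterion => a b c d z; rewrite !uE.
  - rewrite (h12 c b a d) (h13 d b c a).
    by case: (eps); rewrite ?expr0 ?expr1; ring.
  - rewrite (h12 a b c d) (h12 c b a d) (h12 b a c d) (h12 d b c a).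
    by case: (eps); rewrite ?expr0 ?expr1; ring.
  rewrite (h23 a b c d) (h23 b a c d) (h23 d b c a) (h23 c b a d).
  by case: (eps); rewrite ?expr0 ?expr1; ring.
rewrite /u mulmxDr -scalemxAr !mulmxDr !mulmxA !av_pmx -!scalemxAl avt.
by rewrite !scaler0 !addr0 scaler0 addr0.
Qed.
End HookCriterion.
End Semiinvariant.

(** * The space of linear second syzygies as tensors *)

Section Kernel.
Variables (k : fieldType) (n : nat).
Hypothesis char0 : [pchar k] =i pred0.

Notation idx := {ffun 'I_4 -> 'I_n}.
Notation N := #|{ffun 'I_4 -> 'I_n}|.
Notation av eps := (avg k n eps [set: 'S_4]%G).
Notation hook := (hook_proj k n).
Notation tp a b := (tperm (inord a : 'I_4) (inord b)).
Notation ent M a b c d e f g h := (M (enum_rank (quad a b c d)) (enum_rank (quad e f g h))).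

Lemma ent_eqP (M M' : 'M[k]_N) :
  (forall a b c d e f g h, ent M a b c d e f g h = ent M' a b c d e f g h) -> M = M'.
Proof. by move=> E; apply: rank_mxP => i j; rewrite (quadP i) (quadP j) E. Qed.

(** The entry of M at the row word abcd and the column word efgh is the
    coefficient at the four positions x = ae, y = bf, z = cg, w = dh of the
    matrix of variables. In these terms the conditions read: the quadrics q_xy
    alternate; the polarized coefficient of q_xy at z, w is symmetric in the
    rows and in the columns of z and w separately, which is apolarity; and
    \sum_y X_y q_xy = 0. *)
Record in_kernel (M : 'M[k]_N) : Prop := InKernel {
  ker_anti : forall a b c d e f g h, ent M b a c d f e g h = - ent M a b c d e f g h;
  ker_syml : forall a b c d e f g h, ent M a b d c e f g h = ent M a b c d e f g h;
  ker_symr : forall a b c d e f g h, ent M a b c d e f h g = ent M a b c d e f g h;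
  ker_cycle : forall a b c d e f g h, ent M a b c d e f g h + ent M a c b d e g f h
    + ent M a d c b e h g f = 0
}.

Lemma ker_tr M : in_kernel M -> in_kernel M^T.
Proof.
by case=> K1 K2 K3 K4; split=> *; rewrite !mxE.
Qed.

Lemma kerD M M' : in_kernel M -> in_kernel M' -> in_kernel (M + M').
Proof.
move=> [K1 K2 K3 K4] [L1 L2 L3 L4]; split=> a b c d e f g h; rewrite !mxE.
- by rewrite K1 L1 opprD.
- by rewrite K2 L2.
- by rewrite K3 L3.
rewrite -[RHS](addr0 0) -[X in _ = X + _](K4 a b c d e f g h)
  -[X in _ = _ + X](L4 a b c d e f g h); ring.
Qed.

(** An equivariant map from V_211 to the tensors alternating in the first two
    places and symmetric in the last two. *)
Definition Jmx : 'M[k]_N := locked (pmx k n (tp 0 3) - pmx k n (tp 0 2)).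
Lemma JmxE : Jmx = pmx k n (tp 0 3) - pmx k n (tp 0 2).
Proof. by rewrite /Jmx -lock. Qed.
Notation s01 := (pmx k n (tp 0 1)).

Lemma Jmx_tens A : Jmx *m tens A = tens A *m Jmx.
Proof. by rewrite JmxE mulmxBl mulmxBr !pmx_tens. Qed.

Lemma entJ (M : 'M[k]_N) a b c d e f g h : ent (Jmx *m M) a b c d e f g h =
  ent M d b c a e f g h - ent M c b a d e f g h.
Proof. by rewrite JmxE mulmxBl mxE [X in _ + X]mxE swap03 swap02. Qed.

Lemma ents_l (M : 'M[k]_N) a b c d e f g h : ent (s01 *m M) a b c d e f g h = ent M b a c d e f g h.
Proof. exact: swap01. Qed.

Lemma ents_r (M : 'M[k]_N) a b c d e f g h : ent (M *m s01) a b c d e f g h = ent M a b c d f e g h.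
Proof.
have -> : M *m s01 = (s01 *m M^T)^T by rewrite trmx_mul trmxK pmx_tr tpermV.
by rewrite mxE swap01 mxE.
Qed.

Definition commut (t : 'M[k]_N) : 'M[k]_N := locked (t *m s01 - s01 *m t).
Lemma commutE t : commut t = t *m s01 - s01 *m t.
Proof. by rewrite /commut -lock. Qed.

Lemma ent_commut (t : 'M[k]_N) a b c d e f g h : ent (commut t) a b c d e f g h =
  ent t a b c d f e g h - ent t b a c d e f g h.
Proof. by rewrite commutE mxE [X in _ + X]mxE ents_r ents_l. Qed.

Lemma ker_J (t : 'M[k]_N) : hook true *m t = t -> av false *m t^T = t^T -> in_kernel (Jmx *m t).
Proof.
move=> ht at_; have [h12 h23 h0] := hookP char0 ht.
have [a01 a12 a23] := avP at_.
have r01 a b c d e f g h : ent t a b c d f e g h = ent t a b c d e f g h.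
  by have := a01 e f g h (enum_rank (quad a b c d)); rewrite !mxE expr0 mul1r.
have r12 a b c d e f g h : ent t a b c d e g f h = ent t a b c d e f g h.
  by have := a12 e f g h (enum_rank (quad a b c d)); rewrite !mxE expr0 mul1r.
have r23 a b c d e f g h : ent t a b c d e f h g = ent t a b c d e f g h.
  by have := a23 e f g h (enum_rank (quad a b c d)); rewrite !mxE expr0 mul1r.
have l12 a b c d z : t (enum_rank (quad a c b d)) z = - t (enum_rank (quad a b c d)) z.
  by rewrite h12 expr1 mulN1r.
have l23 a b c d z : t (enum_rank (quad a b d c)) z = - t (enum_rank (quad a b c d)) z.
  by rewrite h23 expr1 mulN1r.
have l13 a b c d z : t (enum_rank (quad a d c b)) z = - t (enum_rank (quad a b c d)) z.
  by rewrite l12 l23 l12 !opprK.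
split=> a b c d e f g h; rewrite !entJ.
- by rewrite !(r01 _ _ _ _ e f g h) (l13 d b c a) (l12 c b a d); ring.
- by rewrite (l23 c b a d) (l23 d b c a); ring.
- by rewrite !(r23 _ _ _ _ e f g h).
have r13 x1 x2 x3 x4 : ent t x1 x2 x3 x4 e h g f = ent t x1 x2 x3 x4 e f g h.
  by rewrite (r12 _ _ _ _ e g h f) (r23 _ _ _ _ e g f h) (r12 _ _ _ _ e f g h).
rewrite !(r12 _ _ _ _ e f g h) !r13 (l12 d b c a) (l12 b c d a) (l23 b c a d).
rewrite (l13 c b a d); ring.
Qed.

(** The cyclic relation follows from the sum relations of V_31 on the rows and
    on the columns, whose contributions cancel. *)
Lemma ker_commut (t : 'M[k]_N) : hook false *m t = t -> hook false *m t^T = t^T -> in_kernel (commut t).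
Proof.
move=> ht htT; have [h12 h23 h0] := hookP char0 ht.
have [g12 g23 g0] := hookP char0 htT.
have l12 a b c d z : t (enum_rank (quad a c b d)) z = t (enum_rank (quad a b c d)) z.
  by rewrite h12 expr0 mul1r.
have l23 a b c d z : t (enum_rank (quad a b d c)) z = t (enum_rank (quad a b c d)) z.
  by rewrite h23 expr0 mul1r.
have l13 a b c d z : t (enum_rank (quad a d c b)) z = t (enum_rank (quad a b c d)) z.
  by rewrite l12 l23 l12.
have r12 a b c d z : t z (enum_rank (quad a c b d)) = t z (enum_rank (quad a b c d)).
  by have := g12 a b c d z; rewrite !mxE expr0 mul1r.
have r23 a b c d z : t z (enum_rank (quad a b d c)) = t z (enum_rank (quad a b c d)).
  by have := g23 a b c d z; rewrite !mxE expr0 mul1r.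
have r13 a b c d z : t z (enum_rank (quad a d c b)) = t z (enum_rank (quad a b c d)).
  by rewrite r12 r23 r12.
split=> a b c d e f g h; rewrite !ent_commut.
- by ring.
- by rewrite (l23 a b c d) (l23 b a c d).
- by rewrite (r23 f e g h) (r23 e f g h).
have L := h0 a b c d (enum_rank (quad e f g h)).
have R := g0 e f g h (enum_rank (quad a b c d)).
rewrite !mxE expr0 mul1r in L R.
rewrite (l12 a b c d) (l13 a b c d) (r12 e f g h) (r13 e f g h).
rewrite (r12 g f e h) (r13 h f g e) (l12 c b a d) (l13 d b c a).
rewrite -[RHS](subrr 0) -[X in _ = X - _]R -[X in _ = _ - X]L; ring.
Qed.

Definition assemble (t1 t2 t3 : 'M[k]_N) := Jmx *m t1 + t2 *m Jmx^T + commut t3.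

Lemma assemble_kernel t1 t2 t3 :
  hook true *m t1 = t1 -> av false *m t1^T = t1^T ->
  hook true *m t2^T = t2^T -> av false *m t2 = t2 ->
  hook false *m t3 = t3 -> hook false *m t3^T = t3^T ->
  in_kernel (assemble t1 t2 t3).
Proof.
move=> h1 a1 h2 a2 h3 h3'; apply: kerD; last exact: ker_commut.
apply: kerD; first exact: ker_J.
by rewrite -[t2]trmxK -trmx_mul; apply/ker_tr/ker_J; rewrite ?trmxK.
Qed.

End Kernel.

(** * Decomposition of the space of tensors *)

Section Decompose.
Variables (k : fieldType) (n : nat).
Hypothesis char0 : [pchar k] =i pred0.

Notation idx := {ffun 'I_4 -> 'I_n}.
Notation N := #|{ffun 'I_4 -> 'I_n}|.
Notation av eps := (avg k n eps [set: 'S_4]%G).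
Notation hook := (hook_proj k n).
Notation tp a b := (tperm (inord a : 'I_4) (inord b)).
Notation ent M a b c d e f g h := (M (enum_rank (quad a b c d)) (enum_rank (quad e f g h))).
Notation s01 := (pmx k n (tp 0 1)).

(** The word starting with the letters at places p and q, followed by the two
    others; their order does not matter for elements of the space below. *)
Definition pick4 (v : nat -> 'I_n) p q : idx :=
  let r := [seq x <- iota 0 4 | (x != p) && (x != q)] in
  quad (v p) (v q) (v (nth 0 r 0)%N) (v (nth 0 r 1)%N).

(** The function on pairs of places attached to M once four row letters and
    four column letters are fixed. *)
Definition pairfun (M : 'M[k]_N) v w p q r s : k :=
  M (enum_rank (pick4 v p q)) (enum_rank (pick4 w r s)).

Lemma pick4_rest v a b b' b'' : distinct4 [:: a; b; b'; b''] ->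
  pick4 v a b = quad (v a) (v b) (v b') (v b'') \/
  pick4 v a b = quad (v a) (v b) (v b'') (v b').
Proof.
case: a => [|[|[|[|//]]]]; case: b => [|[|[|[|//]]]] //;
  case: b' => [|[|[|[|//]]]] //; case: b'' => [|[|[|[|//]]]] // _; by [left | right].
Qed.

Lemma pick4_swap v a b : distinct4 [:: a; b] -> exists c d,
  pick4 v a b = quad (v a) (v b) (v c) (v d) /\
  pick4 v b a = quad (v b) (v a) (v c) (v d).
Proof.
case: a => [|[|[|[|//]]]]; case: b => [|[|[|[|//]]]] // _; do 2!eexists; split; reflexivity.
Qed.

Section OfKernel.
Variable M : 'M[k]_N.
Hypothesis KM : in_kernel M.

Lemma pairfun_anti v w a b c d : distinct4 [:: a; b] -> distinct4 [:: c; d] ->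
  pairfun M v w b a d c = - pairfun M v w a b c d.
Proof.
move=> /(pick4_swap v)[x [y [e1 e2]]] /(pick4_swap w)[x' [y' [e3 e4]]].
by rewrite /pairfun e1 e2 e3 e4 (ker_anti KM).
Qed.

Lemma pairfunE v w a b b' b'' c d d' d'' : distinct4 [:: a; b; b'; b''] ->
  distinct4 [:: c; d; d'; d''] ->
  pairfun M v w a b c d = ent M (v a) (v b) (v b') (v b'') (w c) (w d) (w d') (w d'').
Proof.
move=> /(pick4_rest v) h1 /(pick4_rest w) h2; rewrite /pairfun.
by case: h1 h2 => -> [] ->; rewrite ?(ker_syml KM (v a) (v b) (v b') (v b''))
  ?(ker_symr KM _ _ _ _ (w c) (w d) (w d') (w d'')).
Qed.

Lemma pairfun_matching v w a b b' b'' c d d' d'' :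
  distinct4 [:: a; b; b'; b''] -> distinct4 [:: c; d; d'; d''] ->
  pairfun M v w a b c d + pairfun M v w a b' c d' + pairfun M v w a b'' c d'' = 0.
Proof.
move=> h1 h2.
have p1 x y z u : distinct4 [:: x; y; z; u] -> distinct4 [:: x; z; y; u].
  by case: x => [|[|[|[|//]]]]; case: y => [|[|[|[|//]]]] //;
  case: z => [|[|[|[|//]]]] //; case: u => [|[|[|[|//]]]].
have p2 x y z u : distinct4 [:: x; y; z; u] -> distinct4 [:: x; u; z; y].
  by case: x => [|[|[|[|//]]]]; case: y => [|[|[|[|//]]]] //;
  case: z => [|[|[|[|//]]]] //; case: u => [|[|[|[|//]]]].
rewrite (pairfunE _ _ h1 h2) (pairfunE _ _ (p1 _ _ _ _ h1) (p1 _ _ _ _ h2)).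
by rewrite (pairfunE _ _ (p2 _ _ _ _ h1) (p2 _ _ _ _ h2)) (ker_cycle KM).
Qed.
End OfKernel.

Definition letter (a b c d : 'I_n) p := nth a [:: a; b; c; d] p.
Definition word_pairs M a b c d e f g h := pairfun M (letter a b c d) (letter e f g h).

Definition mx8 (F : 'I_n -> 'I_n -> 'I_n -> 'I_n -> 'I_n -> 'I_n -> 'I_n -> 'I_n -> k) : 'M[k]_N :=
  \matrix_(x, y) let i : idx := enum_val x in let j : idx := enum_val y in
    F (i (inord 0)) (i (inord 1)) (i (inord 2)) (i (inord 3))
      (j (inord 0)) (j (inord 1)) (j (inord 2)) (j (inord 3)).

Lemma mx8E F a b c d e f g h : ent (mx8 F) a b c d e f g h = F a b c d e f g h.
Proof. by rewrite mxE !enum_rankK /= !quadE. Qed.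

(** The function f(ab), averaged over cd = 01, 10, 23, 32. *)
Definition lpart (M : 'M[k]_N) := mx8 (fun a b c d e f g h =>
  4%:R^-1 * (ent M a b c d e f g h + ent M a b c d f e g h
    + ent M a b c d g h e f + ent M a b c d h g e f)).

(** The inverse of J on V_211. *)
Definition unJ (u : 'M[k]_N) : 'M[k]_N := \matrix_(x, y) let i : idx := enum_val x in
  let T (a b c d : nat) := u (enum_rank (quad (i (inord a)) (i (inord b)) (i (inord c)) (i (inord d)))) y in
  4%:R^-1 * (T 1%N 2%N 0%N 3%N + T 2%N 3%N 0%N 1%N + T 3%N 1%N 0%N 2%N).

Lemma unJE u a b c d z : unJ u (enum_rank (quad a b c d)) z =
  4%:R^-1 * (u (enum_rank (quad b c a d)) z + u (enum_rank (quad c d a b)) z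
             + u (enum_rank (quad d b a c)) z).
Proof. by rewrite mxE enum_rankK /= !quadE. Qed.

Section UnJ.
Variable u : 'M[k]_N.
Notation U a b c d z := (u (enum_rank (quad a b c d)) z).
Hypothesis u01 : forall a b c d z, U b a c d z = - U a b c d z.
Hypothesis u23 : forall a b c d z, U a b d c z = U a b c d z.
Hypothesis ucyc : forall a b c d z, U a b c d z + U a c b d z + U a d b c z = 0.

Lemma unJ_hook : hook true *m unJ u = unJ u.
Proof.
apply: hook_criterion => // a b c d z; rewrite !unJE expr1 ?mulN1r.
- by rewrite (u01 b c) (u01 d b) (u01 c d); ring.
- by rewrite (u01 d b) (u01 c d) (u01 b c); ring.
rewrite (u23 c d a b) (u23 d b a c) (u23 b c a d) (u01 a c d b) (u23 a c b d).
rewrite (u01 a d b c) (u23 a d b c) (u01 a b c d) (u23 a b c d); ring.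
Qed.

Lemma unJK : Jmx k n *m unJ u = u.
Proof.
apply: ent_eqP => a b c d e f g h; rewrite entJ !unJE.
set z := enum_rank (quad e f g h).
rewrite (u23 b c a d) (u01 a c d b) (u23 a c b d) (u23 a b c d) (u01 a b c d).
rewrite (u23 a d b c) (u23 d b a c) (u01 b d a c).
have h1 : U a c b d z = - U a b c d z - U a d b c z.
  by rewrite -[LHS]addr0 -[X in _ + X](subrr 0) -[X in _ + (_ - X)](ucyc a b c d z); ring.
have h2 : U b d a c z = U a b c d z - U b c a d z.
  by rewrite -[LHS]addr0 -[X in _ + X](subrr 0) -[X in _ + (_ - X)](ucyc b a c d z) (u01 a b c d); ring.
rewrite h1 h2; field; exact: (natS_neq0 char0 3).
Qed.

Lemma unJ_av : av false *m u^T = u^T -> av false *m (unJ u)^T = (unJ u)^T.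
Proof.
move=> ut; have [v01 v12 v23] := avP ut.
have c01 a b c d w : u w (enum_rank (quad b a c d)) = u w (enum_rank (quad a b c d)).
  by have := v01 a b c d w; rewrite !mxE expr0 mul1r.
have c12 a b c d w : u w (enum_rank (quad a c b d)) = u w (enum_rank (quad a b c d)).
  by have := v12 a b c d w; rewrite !mxE expr0 mul1r.
have c23 a b c d w : u w (enum_rank (quad a b d c)) = u w (enum_rank (quad a b c d)).
  by have := v23 a b c d w; rewrite !mxE expr0 mul1r.
apply: av_criterion => // a b c d z; rewrite [LHS]mxE [X in _ * X]mxE expr0 mul1r;
  rewrite -(enum_valK z) (quadP (enum_val z)) !unJE.
- by rewrite !(c01 a b c d).
- by rewrite !(c12 a b c d).
by rewrite !(c23 a b c d).
Qed.
End UnJ.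

(** The function C(a, d) at a = d = 0. *)
Definition hpart (M : 'M[k]_N) := mx8 (fun a b c d e f g h =>
  8%:R^-1 * hook_part (word_pairs M a b c d e f g h) 0 0).

Section Parts.
Variable M : 'M[k]_N.
Hypothesis KM : in_kernel M.
Let c4 : 4%:R != 0 :> k. Proof. exact: (natS_neq0 char0 3). Qed.
Let c8 : 8%:R != 0 :> k. Proof. exact: (natS_neq0 char0 7). Qed.

Lemma lpart_r01 a b c d e f g h : ent (lpart M) a b c d f e g h = ent (lpart M) a b c d e f g h.
Proof.
rewrite !mx8E (ker_symr KM _ _ _ _ g h e f) (ker_symr KM _ _ _ _ h g e f).
by congr (_ * _); rewrite [X in X + _ + _]addrC.
Qed.

Lemma lpart_r23 a b c d e f g h : ent (lpart M) a b c d e f h g = ent (lpart M) a b c d e f g h.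
Proof.
rewrite !mx8E (ker_symr KM _ _ _ _ e f g h) (ker_symr KM _ _ _ _ f e g h).
by congr (_ * _); rewrite -addrA [X in _ + X]addrC addrA.
Qed.

(** Exchanging the middle column places turns the matching 01|23 into 02|13, on
    which the average is the same. *)
Lemma lpart_r12 a b c d e f g h : ent (lpart M) a b c d e g f h = ent (lpart M) a b c d e f g h.
Proof.
rewrite !mx8E; congr (_ * _).
have := @pairing_indep _ (word_pairs M a b c d e f g h) (pairfun_anti KM _ _) (pairfun_matching KM _ _).
rewrite /left_part /word_pairs /pairfun /pick4 /letter /= => ->.
by [].
Qed.

Lemma lpart_l01 a b c d e f g h : ent (lpart M) b a c d e f g h = - ent (lpart M) a b c d e f g h.
Proof.
rewrite !mx8E (ker_anti KM a b c d f e g h) (ker_anti KM a b c d e f g h).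
rewrite (ker_anti KM a b c d h g e f) (ker_anti KM a b c d g h e f); ring.
Qed.

Lemma lpart_l23 a b c d e f g h : ent (lpart M) a b d c e f g h = ent (lpart M) a b c d e f g h.
Proof. by rewrite !mx8E !(ker_syml KM a b c d). Qed.

Lemma lpart_cycle a b c d e f g h : ent (lpart M) a b c d e f g h
  + ent (lpart M) a c b d e f g h + ent (lpart M) a d b c e f g h = 0.
Proof.
rewrite !mx8E -!mulrDr.
have := @left_part_sum _ (word_pairs M a b c d e f g h) (pairfun_anti KM _ _) (pairfun_matching KM _ _).
rewrite /word_pairs /pairfun /pick4 /letter /= !big_cons big_nil addr0 => h0.
by apply/eqP; rewrite mulf_eq0; apply/orP; right; apply/eqP; rewrite -[RHS]h0 !addrA.
Qed.

Lemma lpart_right : av false *m (lpart M)^T = (lpart M)^T.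
Proof.
apply: av_criterion => // a b c d z; rewrite [LHS]mxE [X in _ * X]mxE expr0 mul1r;
  rewrite -(enum_valK z) (quadP (enum_val z)).
- exact: lpart_r01.
- exact: lpart_r12.
exact: lpart_r23.
Qed.

Lemma lpart_factor : exists t, [/\ hook true *m t = t, av false *m t^T = t^T &
  Jmx k n *m t = lpart M].
Proof.
have z_quad (P : 'I_N -> Prop) : (forall a b c d, P (enum_rank (quad a b c d))) -> forall z, P z.
  by move=> h z; rewrite -(enum_valK z) (quadP (enum_val z)); apply: h.
have l01 a b c d z : lpart M (enum_rank (quad b a c d)) z = - lpart M (enum_rank (quad a b c d)) z.
  by move: z; apply: z_quad => e f g h; apply: lpart_l01.
have l23 a b c d z : lpart M (enum_rank (quad a b d c)) z = lpart M (enum_rank (quad a b c d)) z.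
  by move: z; apply: z_quad => e f g h; apply: lpart_l23.
have lc a b c d z : lpart M (enum_rank (quad a b c d)) z + lpart M (enum_rank (quad a c b d)) z
    + lpart M (enum_rank (quad a d b c)) z = 0.
  by move: z; apply: z_quad => e f g h; apply: lpart_cycle.
exists (unJ (lpart M)); split; [exact: unJ_hook | exact/unJ_av/lpart_right | exact: unJK].
Qed.

Lemma hpartE a b c d e f g h : ent (hpart M) a b c d e f g h = 8%:R^-1 *
  (ent M a b c d f e g h + ent M a b c d g e f h + ent M a b c d h e f g +
  (ent M a c b d f e g h + ent M a c b d g e f h + ent M a c b d h e f g) +
  (ent M a d b c f e g h + ent M a d b c g e f h + ent M a d b c h e f g)).
Proof.
rewrite mx8E /hook_part /word_pairs /pairfun /pick4 /letter /= !big_cons !big_nil.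
by congr (_ * _); rewrite !addr0 !addrA.
Qed.

Lemma hpart_hook : hook false *m hpart M = hpart M.
Proof.
apply: hook_criterion => // a b c d z; rewrite -(enum_valK z) (quadP (enum_val z));
  move: (enum_val z : idx) => j;
  move: (j (inord 0)) (j (inord 1)) (j (inord 2)) (j (inord 3)) => e f g h;
  rewrite !hpartE expr0 ?mul1r.
- by rewrite !(ker_syml KM a d b c); congr (_ * _); ring.
- by rewrite !(ker_syml KM a b c d); congr (_ * _); ring.
have := @hook_part_sum _ (word_pairs M a b c d e f g h) (pairfun_anti KM _ _) (pairfun_matching KM _ _).
rewrite /hook_part /word_pairs /pairfun /pick4 /letter /= !big_cons !big_nil !addr0.
rewrite !(ker_syml KM c d b a) !(ker_syml KM d b c a) !(ker_syml KM d c b a).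
rewrite -!mulrDr => E; rewrite -[RHS](mulr0 8%:R^-1) -E; congr (_ * _); ring.
Qed.
End Parts.

(** The three summands are the parts f, g and C of [pair_decomposition]: f and g
    are pulled back along J, and C(a, d) - C(b, c) is the commutator of the hook
    part with the transposition (01). *)
Lemma kernel_decomposition M : in_kernel M -> exists t1 t2 t3,
  [/\ hook true *m t1 = t1 /\ av false *m t1^T = t1^T,
      hook true *m t2^T = t2^T /\ av false *m t2 = t2,
      hook false *m t3 = t3 /\ hook false *m t3^T = t3^T &
      M = assemble t1 t2 t3].
Proof.
move=> KM; have KT := ker_tr KM.
have [t1 [h1 a1 e1]] := lpart_factor KM; have [t2 [h2 a2 e2]] := lpart_factor KT.
have hT : hook false *m (hpart M)^T = (hpart M)^T.
  have E : (hpart M)^T = - hpart M^T.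
    apply: ent_eqP => a b c d e f g h; rewrite mxE [RHS]mxE hpartE hpartE -mulrN.
    congr (_ * _); rewrite !mxE.
    rewrite (ker_anti KM e f g h b a c d) (ker_anti KM e g f h b a c d).
    rewrite (ker_anti KM e h f g b a c d) (ker_anti KM e f g h c a b d).
    rewrite (ker_anti KM e g f h c a b d) (ker_anti KM e h f g c a b d).
    rewrite (ker_anti KM e f g h d a b c) (ker_anti KM e g f h d a b c).
    by rewrite (ker_anti KM e h f g d a b c); ring.
  by rewrite E mulmxN hpart_hook.
exists t1, t2^T, (hpart M); split; rewrite ?trmxK //; first by split=> //; apply: hpart_hook.
apply: ent_eqP => a b c d e f g h.
rewrite /assemble e1 -trmx_mul e2 mxE [X in X + _]mxE ent_commut.
rewrite [((lpart M^T)^T) _ _]mxE !hpartE /lpart 2!mx8E !mxE.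
have := @pair_decomposition _ (word_pairs M a b c d e f g h) (pairfun_anti KM _ _) (pairfun_matching KM _ _).
rewrite /left_part /right_part /hook_part /word_pairs /pairfun /pick4 /letter /= !big_cons !big_nil !addr0.
move=> E; apply: (mulfI (natS_neq0 char0 7)); rewrite E.
have c4 := natS_neq0 char0 3; have c8 := natS_neq0 char0 7.
by field; rewrite c4 c8.
Qed.
End Decompose.

(** * The representation and its isomorphism with the space of tensors *)

Section Model.
Variables (k : fieldType) (n : nat).
Hypothesis char0 : [pchar k] =i pred0.

Notation idx := {ffun 'I_4 -> 'I_n}.
Notation N := #|{ffun 'I_4 -> 'I_n}|.
Notation av eps := (avg k n eps [set: 'S_4]%G).
Notation hook := (hook_proj k n).
Notation tp a b := (tperm (inord a : 'I_4) (inord b)).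
Notation ent M a b c d e f g h := (M (enum_rank (quad a b c d)) (enum_rank (quad e f g h))).
Notation s01 := (pmx k n (tp 0 1)).
Notation J := (Jmx k n).

Lemma unJ_J t : hook true *m t = t -> unJ (J *m t) = t.
Proof.
move=> ht; have [h12 h23 h0] := hookP char0 ht.
have l12 a b c d z : t (enum_rank (quad a c b d)) z = - t (enum_rank (quad a b c d)) z.
  by rewrite h12 expr1 mulN1r.
have l23 a b c d z : t (enum_rank (quad a b d c)) z = - t (enum_rank (quad a b c d)) z.
  by rewrite h23 expr1 mulN1r.
apply: ent_eqP => a b c d e f g h; rewrite unJE !entJ.
have := h0 a b c d (enum_rank (quad e f g h)); rewrite expr1 mulN1r.
set z := enum_rank (quad e f g h) => h0'.
have c4 := natS_neq0 char0 3.
rewrite (l23 d c b a) (l12 d b c a) (l12 b a d c) (l23 b a c d).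
rewrite (l12 a c d b) (l23 a c b d) (l12 a b c d) (l23 a b c d).
have -> : t (enum_rank (quad c b a d)) z = t (enum_rank (quad a b c d)) z
    - t (enum_rank (quad b a c d)) z - t (enum_rank (quad d b c a)) z.
  by apply: subr0_eq; rewrite -[RHS]oppr0 -h0'; ring.
by field.
Qed.

(** If t commutes with (01), the sum relation gives 3 t (01) = - t, whence
    9 t = t. *)
Lemma commut_inj t : hook false *m t = t -> hook false *m t^T = t^T ->
  commut t = 0 -> t = 0.
Proof.
move=> ht htT c0; have [h12 h23 h0] := hookP char0 ht.
have l12 a b c d z : t (enum_rank (quad a c b d)) z = t (enum_rank (quad a b c d)) z.
  by rewrite h12 expr0 mul1r.
have l23 a b c d z : t (enum_rank (quad a b d c)) z = t (enum_rank (quad a b c d)) z.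
  by rewrite h23 expr0 mul1r.
have l13 a b c d z : t (enum_rank (quad a d c b)) z = t (enum_rank (quad a b c d)) z.
  by rewrite l12 l23 l12.
have cm a b c d e f g h : ent t a b c d f e g h = ent t b a c d e f g h.
  by apply: subr0_eq; rewrite -ent_commut c0 mxE.
have t3 a b c d e f g h : 3%:R * ent t a b c d f e g h = - ent t a b c d e f g h.
  have L := h0 a b c d (enum_rank (quad e f g h)); rewrite expr0 mul1r in L.
  have e2 : ent t a b c d f e g h = ent t c b a d e f g h.
    by rewrite -(l12 a b c d) cm -(l12 c a b d).
  have e3 : ent t a b c d f e g h = ent t d b c a e f g h.
    by rewrite -(l13 a b c d) cm (l13 d b c a).
  transitivity (ent t b a c d e f g h + ent t c b a d e f g h + ent t d b c a e f g h).
    by rewrite -e2 -e3 -cm; ring.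
  by apply: subr0_eq; rewrite opprK addrC addrA -L !addrA.
apply: ent_eqP => a b c d e f g h; rewrite mxE.
have E : 8%:R * ent t a b c d e f g h = 0.
  have := t3 a b c d f e g h; have := t3 a b c d e f g h.
  move: (ent t a b c d f e g h) (ent t a b c d e f g h) => x y e1 e2.
  transitivity (3%:R * (3%:R * y) - y); first by ring.
  by rewrite e2 mulrN e1 opprK subrr.
by apply: (mulfI (natS_neq0 char0 7)); rewrite E mulr0.
Qed.

Lemma av_hook eps : av eps *m hook eps = 0.
Proof. by rewrite /hook_proj mulmxBr (avg_sub_r n char0 eps st0_sub) avg_sub // subrr. Qed.

Lemma av_J : av false *m J = 0.
Proof.
by rewrite JmxE mulmxBr !av_pmx !chi_tperm ?expr0 ?subrr // -val_eqE /= !inordK.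
Qed.

Lemma av_commut (t : 'M[k]_N) : hook false *m t = t -> av false *m t = 0.
Proof. by move=> <-; rewrite mulmxA av_hook mul0mx. Qed.

Lemma assemble_tr (t1 t2 t3 : 'M[k]_N) : (assemble t1 t2 t3)^T = assemble t2^T t1^T (- t3^T).
Proof.
have trD (A B : 'M[k]_N) : (A + B)^T = A^T + B^T by rewrite linearD.
have trB (A B : 'M[k]_N) : (A - B)^T = A^T - B^T by rewrite linearB.
rewrite /assemble (trD (_ + _) (commut t3)) (trD (J *m t1)) (trmx_mul J) (trmx_mul t2) trmxK [X in X + _]addrC; congr (_ + _).
rewrite !commutE trB (trmx_mul t3) (trmx_mul _ t3) pmx_tr tpermV mulNmx mulmxN opprK.
by rewrite addrC.
Qed.

(** Multiplying on the right by the symmetrizer kills the second and third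
    summands and fixes J t1. *)
Lemma assemble_inj1 (t1 t2 t3 : 'M[k]_N) :
  hook true *m t1 = t1 -> av false *m t1^T = t1^T ->
  hook false *m t3^T = t3^T -> assemble t1 t2 t3 = 0 -> t1 = 0.
Proof.
move=> h1 a1 h3 z0; suff J0 : J *m t1 = 0.
  rewrite -(unJ_J h1) J0; apply: ent_eqP => a b c d e f g h.
  by rewrite unJE !mxE !addr0 mulr0.
have t1a : t1 *m av false = t1 by apply: trmx_inj; rewrite trmx_mul avg_tr a1.
have t3a : t3 *m av false = 0.
  by apply: trmx_inj; rewrite trmx_mul avg_tr av_commut // trmx0.
have Ja : J^T *m av false = 0 by apply: trmx_inj; rewrite trmx_mul avg_tr trmxK av_J trmx0.
have := congr1 (fun Z => Z *m av false) z0; rewrite mul0mx /assemble !mulmxDl.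
rewrite -!mulmxA t1a Ja mulmx0 addr0 commutE mulmxBl -!mulmxA t3a mulmx0 subr0.
by rewrite pmx_av -scalemxAr t3a scaler0 addr0.
Qed.

Lemma assemble_inj (t1 t2 t3 : 'M[k]_N) :
  hook true *m t1 = t1 -> av false *m t1^T = t1^T ->
  hook true *m t2^T = t2^T -> av false *m t2 = t2 ->
  hook false *m t3 = t3 -> hook false *m t3^T = t3^T ->
  assemble t1 t2 t3 = 0 -> [/\ t1 = 0, t2 = 0 & t3 = 0].
Proof.
move=> h1 a1 h2 a2 h3 h3' z0.
have z1 : t1 = 0 by apply: (assemble_inj1 h1 a1 h3' z0).
have z2 : t2 = 0.
  apply: trmx_inj; rewrite trmx0; apply: (@assemble_inj1 _ t1^T (- t3^T)) => //.
  - by rewrite trmxK.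
  - by rewrite linearN /= trmxK mulmxN h3.
  by rewrite -assemble_tr z0 trmx0.
split=> //; apply: commut_inj => //.
by move: z0; rewrite z1 z2 /assemble mulmx0 mul0mx !add0r.
Qed.

Lemma assemble_tens A B (t1 t2 t3 : 'M[k]_N) :
  assemble (tens A *m t1 *m (tens B)^T) (tens A *m t2 *m (tens B)^T)
    (tens A *m t3 *m (tens B)^T) = tens A *m assemble t1 t2 t3 *m (tens B)^T.
Proof.
have sB : (tens B)^T *m s01 = s01 *m (tens B)^T.
  by apply: trmx_inj; rewrite !trmx_mul trmxK pmx_tr pmx_tens.
have JB : (tens B)^T *m J^T = J^T *m (tens B)^T.
  by rewrite -!trmx_mul Jmx_tens.
rewrite /assemble !commutE !mulmxDr !mulmxDl mulmxN mulNmx; congr (_ + _ + (_ - _)).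
- by rewrite !mulmxA Jmx_tens.
- by rewrite -!mulmxA JB.
- by rewrite -!mulmxA sB.
by rewrite !mulmxA pmx_tens.
Qed.

Notation s4 := (summand4 n char0).
Notation s31 := (summand31 n char0).
Notation s211 := (summand211 n char0).
Notation V4 := (sm_rep s4).
Notation V31 := (sm_rep s31).
Notation V211 := (sm_rep s211).

Definition model : swap_rep k n := sum_rep (pair_rep V211 V4) (square_rep true V31).

(** The inclusion of a product of two summands in V^{x4} (x) W^{x4}. *)
Definition embed (s s' : tens_summand k n) (x : 'M[k]_(sm_dim s, sm_dim s')) : 'M[k]_N :=
  sm_in s *m x *m (sm_in s')^T.

Definition model_tensor (x : swap_space model) : 'M[k]_N :=
  assemble (@embed s211 s4 x.1.1) (@embed s4 s211 x.1.2) (@embed s31 s31 x.2).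

Lemma embed_l s s' x : sm_proj s *m @embed s s' x = embed x.
Proof. by rewrite /embed !mulmxA sm_proj_in. Qed.

Lemma embed_tr s s' x : (@embed s s' x)^T = embed x^T.
Proof. by rewrite /embed !trmx_mul trmxK mulmxA. Qed.

Lemma embedP s s' (M : 'M[k]_N) : sm_proj s *m M = M -> sm_proj s' *m M^T = M^T ->
  exists x, @embed s s' x = M.
Proof.
move=> hs hs'; exists (sm_out s *m M *m (sm_out s')^T).
rewrite /embed !mulmxA -/(sm_proj s) hs -mulmxA -trmx_mul -/(sm_proj s').
by apply: trmx_inj; rewrite trmx_mul trmxK hs'.
Qed.

Lemma embed_eq0 s s' x : @embed s s' x = 0 -> x = 0.
Proof.
move=> h; rewrite -[x]mul1mx -[X in X *m _](sm_outK s) -[_ *m x]mulmx1.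
rewrite -[X in _ *m X]trmx1 -(sm_outK s') trmx_mul mulmxA -(mulmxA (sm_out s)).
by rewrite -(mulmxA (sm_out s)) -/(embed x) h mulmx0 mul0mx.
Qed.

Lemma embed_act s s' A B (x : 'M[k]_(sm_dim s, sm_dim s')) :
  embed (sm_mx s A *m x *m (sm_mx s' B)^T) = tens A *m embed x *m (tens B)^T.
Proof.
transitivity ((sm_in s *m sm_mx s A) *m x *m (sm_in s' *m sm_mx s' B)^T).
  by move: (sm_mx s A) (sm_mx s' B) => P Q; rewrite /embed trmx_mul !mulmxA.
by rewrite !sm_inE trmx_mul /embed !mulmxA.
Qed.

Lemma embed_linear s s' c (x y : 'M[k]_(sm_dim s, sm_dim s')) :
  embed (c *: x + y) = c *: embed x + embed y.
Proof. by rewrite /embed mulmxDr mulmxDl -scalemxAr -scalemxAl. Qed.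

Lemma assemble_linear c (t1 t2 t3 u1 u2 u3 : 'M[k]_N) :
  assemble (c *: t1 + u1) (c *: t2 + u2) (c *: t3 + u3) =
  c *: assemble t1 t2 t3 + assemble u1 u2 u3.
Proof.
have commut_lin : commut (c *: t3 + u3) = c *: commut t3 + commut u3.
  rewrite !commutE mulmxDl mulmxDr -scalemxAr -scalemxAl scalerBr opprD.
  by rewrite addrACA.
rewrite /assemble commut_lin mulmxDr mulmxDl -scalemxAr -scalemxAl !scalerDr.
by rewrite [in RHS]addrACA; congr (_ + _); rewrite [in RHS]addrACA.
Qed.

Lemma model_tensor_linear c (x y : swap_space model) :
  model_tensor (c *: x + y) = c *: model_tensor x + model_tensor y.
Proof.
case: x y => [[x1 x2] x3] [[y1 y2] y3]; rewrite /model_tensor -assemble_linear.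
by rewrite -!embed_linear.
Qed.

Lemma embed_conditions s s' x :
  sm_proj s *m @embed s s' x = embed x /\ sm_proj s' *m (@embed s s' x)^T = (embed x)^T.
Proof. by split; rewrite ?embed_tr embed_l. Qed.

Lemma model_tensor_kernel x : in_kernel (model_tensor x).
Proof.
case: x => [[x1 x2] x3].
have [a1 b1] := @embed_conditions s211 s4 x1.
have [a2 b2] := @embed_conditions s4 s211 x2.
have [a3 b3] := @embed_conditions s31 s31 x3.
rewrite !summand_of_proj in a1 b1 a2 b2 a3 b3.
exact: assemble_kernel.
Qed.

Lemma model_tensor_inj x y : model_tensor x = model_tensor y -> x = y.
Proof.
move=> e; apply/eqP; rewrite -subr_eq0; apply/eqP.
have {e} : model_tensor (x - y) = 0.
  by rewrite addrC -scaleN1r model_tensor_linear e scaleN1r addNr.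
case: (x - y) => [[x1 x2] x3].
have [a1 b1] := @embed_conditions s211 s4 x1.
have [a2 b2] := @embed_conditions s4 s211 x2.
have [a3 b3] := @embed_conditions s31 s31 x3.
rewrite !summand_of_proj in a1 b1 a2 b2 a3 b3.
move=> z0; have [] := assemble_inj a1 b1 b2 a2 a3 b3 z0.
by move=> /embed_eq0 -> /embed_eq0 -> /embed_eq0 ->.
Qed.

Lemma model_tensor_surj M : in_kernel M -> exists x, model_tensor x = M.
Proof.
move=> /(kernel_decomposition char0)[t1 [t2 [t3 [[h1 a1] [h2 a2] [h3 h3'] ->]]]].
have [x1 e1] : exists x, @embed s211 s4 x = t1 by apply: embedP; rewrite summand_of_proj.
have [x2 e2] : exists x, @embed s4 s211 x = t2 by apply: embedP; rewrite summand_of_proj.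
have [x3 e3] : exists x, @embed s31 s31 x = t3 by apply: embedP; rewrite summand_of_proj.
by exists ((x1, x2), x3); rewrite /model_tensor /= e1 e2 e3.
Qed.

Lemma model_tensor_act A B x :
  model_tensor (swap_act A B x) = tens A *m model_tensor x *m (tens B)^T.
Proof.
case: x => [[x1 x2] x3]; rewrite /model_tensor -assemble_tens.
by rewrite -!embed_act.
Qed.

Lemma model_tensor_iota x : model_tensor (swap_iota x) = (model_tensor x)^T.
Proof.
case: x => [[x1 x2] x3]; rewrite /model_tensor assemble_tr !embed_tr; congr assemble.
rewrite /= /square_iota expr1 scaleN1r.
by rewrite /embed mulmxN mulNmx.
Qed.

End Model.

(** * Second derivatives at the origin *)

Section Calculus.
Variables (k : fieldType) (L : nat).
Hypothesis char0 : [pchar k] =i pred0.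
Notation poly := {mpoly k[L]}.
Implicit Types (p q : poly) (a b c x y z : 'I_L).

(** An entry of the Hessian at 0; on quadrics, twice the polarized coefficient. *)
Definition coef2 a b q : k := (mderiv b (mderiv a q))@_0%MM.

Lemma coef2C a b q : coef2 a b q = coef2 b a q.
Proof. by rewrite /coef2 mderiv_comm. Qed.

Lemma coef2D a b q q' : coef2 a b (q + q') = coef2 a b q + coef2 a b q'.
Proof. by rewrite /coef2 !mderivD mcoeffD. Qed.

Lemma coef2Z a b (c : k) q : coef2 a b (c *: q) = c * coef2 a b q.
Proof. by rewrite /coef2 !mderivZ mcoeffZ. Qed.

Lemma coef2_sum a b (I : finType) (F : I -> poly) :
  coef2 a b (\sum_i F i) = \sum_i coef2 a b (F i).
Proof. by rewrite (big_morph _ (coef2D a b) (_ : _ 0 = 0)) // /coef2 !mderiv0 mcoeff0. Qed.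

Lemma mdeg_split m d : mdeg m = d.+1 -> exists a m', m = (U_(a) + m')%MM /\ mdeg m' = d.
Proof.
move=> md; have /existsP[a ma] : [exists a, m a != 0%N].
  apply: contra_eqT md; rewrite negb_exists => /forallP h.
  rewrite mdegE big1 // => i _; have := h i; rewrite negbK => /eqP //.
exists a, (m - U_(a))%MM; have e : m = (U_(a) + (m - U_(a)))%MM.
  by rewrite addmC submK // lep1mP.
by split=> //; apply/eqP; rewrite -eqSS -md {2}e mdegD mdeg1.
Qed.

Lemma mderiv_homog d a p : p \is d.+1.-homog -> mderiv a p \is d.-homog.
Proof.
move=> /dhomogP hp; apply/dhomogP => m; rewrite mcoeff_msupp mcoeff_mderiv => nz.
have : (m + U_(a))%MM \in msupp p.
  by rewrite mcoeff_msupp; apply: contraNneq nz => ->; rewrite mul0rn.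
by move=> /hp /=; rewrite mdegD mdeg1 addn1 => -[].
Qed.

Lemma homog0_const p : p \is 0.-homog -> p = (p@_0%MM)%:MP.
Proof.
move=> hp; apply/mpolyP => m; rewrite mcoeffC.
case: eqVneq => [->|nz]; first by rewrite mulr1.
by rewrite mulr0 (dhomog_nemf_coeff hp) //= mdeg_eq0.
Qed.

Lemma mderiv_eq0 d p : p \is d.+1.-homog -> (forall a, mderiv a p = 0) -> p = 0.
Proof.
move=> hp h; apply/mpolyP => m; rewrite mcoeff0.
have [md|md] := eqVneq (mdeg m) d.+1; last by rewrite (dhomog_nemf_coeff hp).
have [a [m' [-> _]]] := mdeg_split md.
have /(congr1 (mcoeff m')) := h a; rewrite mcoeff_mderiv mcoeff0 addmC.
by move/eqP; rewrite -mulr_natr mulf_eq0 (negbTE (natS_neq0 char0 _)) orbF => /eqP.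
Qed.

Lemma quadratic_eq0 p : p \is 2.-homog -> (forall a b, coef2 a b p = 0) -> p = 0.
Proof.
move=> hp h; apply: (mderiv_eq0 hp) => a.
have ha := mderiv_homog a hp; apply: (mderiv_eq0 ha) => b.
by rewrite (homog0_const (mderiv_homog b ha)) [_@__]h mpolyC0.
Qed.

Lemma cubic_eq0 p : p \is 3.-homog -> (forall a b c, coef2 b c (mderiv a p) = 0) -> p = 0.
Proof.
move=> hp h; apply: (mderiv_eq0 hp) => a.
by apply: quadratic_eq0 (mderiv_homog a hp) _ => b c; apply: h.
Qed.

Lemma linear_expand p : p \is 1.-homog -> p = \sum_a p@_U_(a)%MM *: 'X_a.
Proof.
move=> hp; apply/mpolyP => m; rewrite raddf_sum /=.
have [md|md] := eqVneq (mdeg m) 1%N.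
  have /mdeg1P[a /eqP ->] : mdeg m == 1%N by apply/eqP.
  rewrite (bigD1 a) //= big1 => [|b ne]; rewrite mcoeffZ mcoeffXU ?eqxx ?mulr1 ?addr0 //.
  by rewrite (negbTE ne) mulr0.
rewrite (dhomog_nemf_coeff hp) // big1 // => a _; rewrite mcoeffZ mcoeffX.
by case: eqP => [e|_]; rewrite ?mulr0 //; rewrite -e mdeg1 in md.
Qed.

Lemma mderivX1 a b : mderiv a 'X_b = (b == a)%:R%:MP :> poly.
Proof.
apply/mpolyP => m; rewrite mcoeff_mderiv mcoeffX mcoeffC addmC.
have [->|nz] := eqVneq m 0%MM.
  by rewrite addm0 eq_mnm1 mnm0E mulr1n mulr1.
rewrite mulr0 (_ : (_ == _) = false) ?mul0rn //.
apply/eqP => /(congr1 mdeg); rewrite mdegD !mdeg1 => /eqP.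
by rewrite -[X in X == _]addn0 eqn_add2l eq_sym mdeg_eq0 (negbTE nz).
Qed.

Lemma mderiv_sumX a (F : 'I_L -> poly) :
  mderiv a (\sum_b 'X_b * F b) = F a + \sum_b 'X_b * mderiv a (F b).
Proof.
rewrite raddf_sum /=; under eq_bigr do rewrite mderivM mderivX1.
rewrite big_split /= (bigD1 a) //= big1 ?addr0 => [|b ne].
  by rewrite eqxx mul1r.
by rewrite (negbTE ne) mul0r.
Qed.

Lemma mcoeff0_sumX (F : 'I_L -> poly) : (\sum_b 'X_b * F b)@_0%MM = 0.
Proof.
rewrite raddf_sum big1 // => b _ /=.
by rewrite rmorphM /= mcoeffX mnm1_eq0 mul0r.
Qed.

Lemma coef2_sumX a b (F : 'I_L -> poly) :
  coef2 a b (\sum_c 'X_c * F c) = (mderiv b (F a))@_0%MM + (mderiv a (F b))@_0%MM.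
Proof.
by rewrite /coef2 mderiv_sumX mderivD mderiv_sumX !mcoeffD mcoeff0_sumX addr0.
Qed.

(** The third derivatives of \sum_d X_d F_d at 0: by the Leibniz rule one of the
    three derivations must hit the variable. *)
Lemma coef3_sumX a b c (F : 'I_L -> poly) :
  coef2 b c (mderiv a (\sum_d 'X_d * F d)) =
  coef2 b c (F a) + coef2 a c (F b) + coef2 a b (F c).
Proof.
rewrite mderiv_sumX coef2D coef2_sumX -addrA; congr (_ + (_ + _)).
Qed.

Lemma coef1E a p : (mderiv a p)@_0%MM = p@_U_(a)%MM.
Proof. by rewrite mcoeff_mderiv add0m mnm0E mulr1n. Qed.

Definition quad_poly (S : 'I_L -> 'I_L -> k) : poly := \sum_x \sum_y S x y *: ('X_x * 'X_y).

Lemma quad_polyE S : quad_poly S = \sum_x 'X_x * (\sum_y S x y *: 'X_y).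
Proof.
apply: eq_bigr => x _; rewrite mulr_sumr; apply: eq_bigr => y _.
by rewrite -scalerAr.
Qed.

Lemma coef2_quad S a b : coef2 a b (quad_poly S) = S a b + S b a.
Proof.
rewrite quad_polyE coef2_sumX !coef1E !raddf_sum /=.
have e x y : \sum_i (S x i *: 'X_i : poly)@_U_(y) = S x y.
  rewrite (bigD1 y) //= big1 => [|z ne]; rewrite mcoeffZ mcoeffXU.
    by rewrite eqxx mulr1 addr0.
  by rewrite (negbTE ne) mulr0.
by rewrite !e.
Qed.

Lemma X_homog a : ('X_a : poly) \is 1.-homog.
Proof. by rewrite dhomogX /= mdeg1. Qed.

Lemma quad_homog S : quad_poly S \is 2.-homog.
Proof.
apply: rpred_sum => x _; apply: rpred_sum => y _; apply: rpredZ.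
exact: (dhomogM (X_homog x) (X_homog y)).
Qed.

Lemma quad_expand q : q \is 2.-homog -> q = quad_poly (fun a b => 2%:R^-1 * coef2 a b q).
Proof.
move=> hq; apply: subr0_eq; apply: quadratic_eq0 => [|a b].
  by rewrite rpredB // quad_homog.
rewrite -scaleN1r coef2D coef2Z coef2_quad (coef2C b a).
have := natS_neq0 char0 1; move: (coef2 a b q) => w two; field.
by [].
Qed.

Section Subst.
Variable G : 'I_L -> 'I_L -> k.
Definition subst_lin (s : poly) : poly :=
  s \mPo [tuple \sum_m G l m *: 'X_m | l < L].

Lemma subst_linX a : subst_lin 'X_a = \sum_m G a m *: 'X_m.
Proof. by rewrite /subst_lin comp_mpolyXU -tnth_nth tnth_mktuple. Qed.

Lemma subst_linC (c : k) : subst_lin c%:MP = c%:MP.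
Proof. exact: comp_mpolyC. Qed.

Lemma subst_lin_quad S : subst_lin (quad_poly S) =
  quad_poly (fun a b => \sum_x \sum_y S x y * (G x a * G y b)).
Proof.
rewrite /quad_poly /subst_lin raddf_sum /=.
under eq_bigr => x _ do rewrite raddf_sum /=.
under eq_bigr => x _ do under eq_bigr => y _ do
  rewrite comp_mpolyZ rmorphM /= -!/(subst_lin _) !subst_linX.
transitivity (\sum_x \sum_y \sum_a \sum_b (S x y * (G x a * G y b)) *: ('X_a * 'X_b : poly)).
  apply: eq_bigr => x _; apply: eq_bigr => y _.
  rewrite big_distrl scaler_sumr; apply: eq_bigr => a _ /=.
  rewrite big_distrr scaler_sumr; apply: eq_bigr => b _ /=.
  by rewrite -scalerAl -scalerAr !scalerA mulrA.
rewrite (eq_bigr (fun x => \sum_a \sum_y \sum_b (S x y * (G x a * G y b)) *: ('X_a * 'X_b : poly))); last first.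
  by move=> x _; rewrite exchange_big.
rewrite exchange_big; apply: eq_bigr => a _ /=.
rewrite (eq_bigr (fun x => \sum_b \sum_y (S x y * (G x a * G y b)) *: ('X_a * 'X_b : poly))); last first.
  by move=> x _; rewrite exchange_big.
rewrite exchange_big; apply: eq_bigr => b _ /=.
by rewrite scaler_suml; apply: eq_bigr => x _; rewrite scaler_suml.
Qed.

Lemma coef2_subst q a b : q \is 2.-homog ->
  coef2 a b (subst_lin q) = \sum_x \sum_y (G x a * G y b) * coef2 x y q.
Proof.
move=> /quad_expand {1}->; rewrite subst_lin_quad coef2_quad.
rewrite [X in _ + X]exchange_big -big_split /=; apply: eq_bigr => x _.
rewrite -big_split /=; apply: eq_bigr => y _; rewrite (coef2C y x).
have two := natS_neq0 char0 1; field; by [].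
Qed.
End Subst.
End Calculus.

(** * Forms of low degree apolar to the determinant *)

Section Det.
Variables (k : fieldType) (n : nat).
Hypothesis char0 : [pchar k] =i pred0.
Notation L := (n * n)%N.
Notation mv := (@mxvec_index n n).
Implicit Types (s t : 'S_n) (i j : 'I_n) (m : 'X_{1..(n * n)}).

Definition prow (l : 'I_(n * n)) : 'I_n := (enum_val (cast_ord (esym (mxvec_cast n n)) l)).1.
Definition pcol (l : 'I_(n * n)) : 'I_n := (enum_val (cast_ord (esym (mxvec_cast n n)) l)).2.

Lemma mv_rowcol l : mv (prow l) (pcol l) = l.
Proof.
by rewrite /mxvec_index -surjective_pairing enum_valK cast_ordKV.
Qed.

Lemma prow_mv i j : prow (mv i j) = i.
Proof. by rewrite /prow /mxvec_index cast_ordK enum_rankK. Qed.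

Lemma pcol_mv i j : pcol (mv i j) = j.
Proof. by rewrite /pcol /mxvec_index cast_ordK enum_rankK. Qed.

Lemma mv_eq i j i' j' : (mv i j == mv i' j') = (i == i') && (j == j').
Proof.
apply/eqP/andP => [e|[/eqP -> /eqP ->]//].
by have := congr1 prow e; have := congr1 pcol e; rewrite !prow_mv !pcol_mv => -> ->; rewrite !eqxx.
Qed.

Lemma sum_mv (V : nmodType) (H : 'I_(n * n) -> V) :
  \sum_l H l = \sum_i \sum_j H (mv i j).
Proof.
rewrite pair_bigA /= (reindex (fun p : 'I_n * 'I_n => mv p.1 p.2)) //=.
exists (fun x => (prow x, pcol x)) => [[i j] _|x _] /=.
  by rewrite prow_mv pcol_mv.
by rewrite mv_rowcol.
Qed.

Definition perm_mnm s : 'X_{1..(n * n)} := (\sum_i U_(mv i (s i)))%MM.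

Lemma perm_mnmE s i j : perm_mnm s (mv i j) = (s i == j).
Proof.
rewrite /perm_mnm mnm_sumE (bigD1 i) //= big1 => [|r ne].
  by rewrite mnm1E mv_eq eqxx addn0.
by rewrite mnm1E mv_eq (negbTE ne).
Qed.

Lemma perm_mnm_inj : injective perm_mnm.
Proof.
move=> s t e; apply/permP => i; apply/eqP.
by rewrite eq_sym; have := perm_mnmE s i (s i); rewrite eqxx e perm_mnmE; case: eqP.
Qed.

Lemma det_polyE : det_poly k n = \sum_(s : 'S_n) (-1) ^+ s *: 'X_[perm_mnm s].
Proof.
rewrite /det_poly /determinant; apply: eq_bigr => s _.
rewrite -[RHS]mul_mpolyC rmorphXn rmorphN1; congr (_ * _).
rewrite /perm_mnm (big_morph (fun m => 'X_[m] : mat_poly k n) (@mpolyXD _ _) (mpolyX0 _ _)).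
by apply: eq_bigr => i _; rewrite mxE.
Qed.

Lemma det_coef m : (det_poly k n)@_m = \sum_(s : 'S_n) (-1) ^+ s * (perm_mnm s == m)%:R.
Proof.
by rewrite det_polyE raddf_sum; apply: eq_bigr => s _; rewrite /= mcoeffZ mcoeffX.
Qed.

Lemma perm_mnm_swap i j i' j' s m : i != i' ->
  perm_mnm s = (U_(mv i j) + U_(mv i' j') + m)%MM ->
  perm_mnm (tperm i i' * s)%g = (U_(mv i j') + U_(mv i' j) + m)%MM.
Proof.
move=> ne e.
have si : s i = j.
  apply/eqP; have := perm_mnmE s i j; rewrite e !mnmDE !mnm1E eqxx.
  by case: (s i == j).
have si' : s i' = j'.
  apply/eqP; have := perm_mnmE s i' j'; rewrite e !mnmDE !mnm1E eqxx /= addn1.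
  by case: (s i' == j').
apply/mnmP => l; rewrite -(mv_rowcol l); move: (prow l) (pcol l) => a b.
have := perm_mnmE s a b; rewrite e !mnmDE !mnm1E perm_mnmE permM !mv_eq.
case: tpermP => [->|->|/eqP na /eqP na'].
- by rewrite !(eq_sym i' i) !(negbTE ne) eqxx si si' /= addn0 ; case: (j == b) (j' == b) => -[] /=; case: (m _) => // -[].
- by rewrite (negbTE ne) eqxx si si' /= add0n; case: (j == b) (j' == b) => -[] /=; case: (m _) => // -[].
by rewrite !(eq_sym _ a) (negbTE na) (negbTE na') /= => ->.
Qed.

(** Exchanging two columns changes the sign of the determinant. *)
Lemma det_coef_swap i j i' j' m :
  (det_poly k n)@_(U_(mv i j) + U_(mv i' j') + m) =
  - (det_poly k n)@_(U_(mv i j') + U_(mv i' j) + m).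
Proof.
rewrite !det_coef; have [<-|ne] := eqVneq i i'.
  have z c c' : \sum_(s : 'S_n) (-1) ^+ s * (perm_mnm s == (U_(mv i c) + U_(mv i c') + m)%MM)%:R = 0 :> k.
    rewrite big1 // => s _; case: eqP => [e|_]; last by rewrite mulr0.
    have h1 := perm_mnmE s i c; have h2 := perm_mnmE s i c'; move: h1 h2.
    rewrite e !mnmDE !mnm1E !mv_eq !eqxx /=.
    have [<-|nc] := eqVneq c c'; first by case: (s i == c).
    move=> h1 h2; have sc : s i = c by apply/eqP; move: h1; case: (s i == c).
    by move/eqP: h2; rewrite sc (negbTE nc) !addn_eq0 /= ?andbF.
  by rewrite !z oppr0.
rewrite (reindex_inj (mulgI (tperm i i'))) /= -sumrN; apply: eq_bigr => s _.
rewrite odd_permM odd_tperm ne /= signrN mulNr; congr (- (_ * _%:R)).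
congr nat_of_bool; apply/eqP/eqP => e; last exact: perm_mnm_swap.
have := perm_mnm_swap ne e; rewrite mulgA tperm2 mul1g => ->.
by [].
Qed.

Lemma contract_sum (I : finType) (F : I -> mat_poly k n) f :
  contract (\sum_i F i) f = \sum_i contract (F i) f.
Proof. exact: (big_morph _ (fun g h => contractDl g h _) (contract0l _)). Qed.

Lemma mcoeff_contract_quad S m : (contract (quad_poly S) (det_poly k n))@_m =
  \sum_x \sum_y S x y * (det_poly k n)@_(U_(x) + U_(y) + m).
Proof.
rewrite contract_sum raddf_sum; apply: eq_bigr => x _ /=.
rewrite contract_sum raddf_sum; apply: eq_bigr => y _ /=.
rewrite contractZl mcoeffZ; congr (_ * _).
rewrite -mpolyXD -[X in contract X _]mul1r mcoeff_contractMX contract1l.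
by [].
Qed.

(** Exchanging the columns j and j' leaves S unchanged and changes the sign of
    the coefficient of the determinant, so each contracted coefficient equals
    its opposite. *)
Lemma det_perp_quad_suff (S : 'I_(n * n) -> 'I_(n * n) -> k) :
  (forall i j i' j', S (mv i j) (mv i' j') = S (mv i j') (mv i' j)) ->
  det_perp (quad_poly S).
Proof.
move=> sS; apply/eqP/mpolyP => m; rewrite mcoeff0 mcoeff_contract_quad.
pose f i j i' j' := S (mv i j) (mv i' j') * (det_poly k n)@_(U_(mv i j) + U_(mv i' j') + m).
rewrite sum_mv (eq_bigr (fun i => \sum_j \sum_i' \sum_j' f i j i' j')); last first.
  by move=> i _; apply: eq_bigr => j _; rewrite sum_mv.
set T := \sum_i _; suff TN : T = - T.
  apply/eqP; have /eqP := TN; rewrite -subr_eq0 opprK -mulr2n -mulr_natl mulf_eq0.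
  by rewrite (negbTE (natS_neq0 char0 1)).
rewrite {1}/T -sumrN; apply: eq_bigr => i _.
rewrite [LHS](eq_bigr (fun j => \sum_i' \sum_j' - f i j' i' j)); last first.
  move=> j _; apply: eq_bigr => i' _; apply: eq_bigr => j' _.
  by rewrite /f sS det_coef_swap mulrN.
transitivity (\sum_i' \sum_j \sum_j' - f i j i' j').
  by rewrite exchange_big; apply: eq_bigr => i' _; apply: exchange_big.
rewrite exchange_big -[RHS]sumrN; apply: eq_bigr => j _.
by rewrite -[RHS]sumrN; apply: eq_bigr => i' _; rewrite -sumrN.
Qed.

Lemma perm_agree1 s t i : (forall r, r != i -> t r = s r) -> t = s.
Proof.
move=> h; apply/permP => r; have [->|/h//] := eqVneq r i.
have [e|ne] := eqVneq (s^-1%g (t i)) i; first by rewrite -[in RHS]e permKV.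
by have := h _ ne; rewrite permKV => /perm_inj e; rewrite e eqxx in ne.
Qed.

Lemma perm_agree2 s t i i' : (forall r, r != i -> r != i' -> t r = s r) ->
  t = s \/ t = (tperm i i' * s)%g.
Proof.
move=> h; have [e|ne] := eqVneq (t i) (s i).
  left; apply: (@perm_agree1 _ _ i') => r nr.
  by have [->|nr'] := eqVneq r i => //; apply: h.
right; apply: (@perm_agree1 _ _ i') => r nr; rewrite permM.
have [->|nr'] := eqVneq r i; last by rewrite tpermD 1?eq_sym //; apply: h.
rewrite tpermL; have [e|ne'] := eqVneq (s^-1%g (t i)) i'; first by rewrite -e permKV.
have nei : s^-1%g (t i) != i by apply: contraNneq ne => e; rewrite -[in X in _ == X]e permKV.
by have := h _ nei ne'; rewrite permKV => /perm_inj e; rewrite e eqxx in nei.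
Qed.

(** If m divides the monomial of t and m retains the factor of the monomial of s
    in row r, then t and s agree in row r. *)
Lemma perm_mnm_ge s (B : pred 'I_n) m m' t :
  perm_mnm s = (m' + m)%MM -> (forall r, ~~ B r -> m' (mv r (s r)) = 0%N) ->
  (exists m'', perm_mnm t = (m'' + m)%MM) -> forall r, ~~ B r -> t r = s r.
Proof.
move=> e h [m'' e'] r Br; apply/eqP.
have := perm_mnmE s r (s r); rewrite e mnmDE (h r Br) eqxx add0n => mr.
by have := perm_mnmE t r (s r); rewrite e' mnmDE mr /= addn1; case: (t r == s r).
Qed.

(** Choose a permutation s through the position of l0. Contracting with X_l0
    leaves a monomial m of degree n - 1, and s is the only permutation whose
    monomial is divisible by m, so the coefficient of m is c l0 up to sign. *)
Lemma det_perp_linear_eq0 (c : 'I_(n * n) -> k) :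
  det_perp (\sum_l c l *: 'X_l : mat_poly k n) -> forall l, c l = 0.
Proof.
move=> /eqP h l0; pose i := prow l0; pose j := pcol l0.
have l0E : l0 = mv i j by rewrite mv_rowcol.
pose s := tperm i j; have si : s i = j by rewrite tpermL.
pose m := (perm_mnm s - U_(l0))%MM.
have e : perm_mnm s = (U_(l0) + m)%MM.
  by rewrite addmC submK // lep1mP l0E perm_mnmE si eqxx.
have := congr1 (mcoeff m) h.
rewrite contract_sum raddf_sum /= mcoeff0.
rewrite (bigD1 l0) //= [X in _ + X]big1 => [|l ne]; last first.
  rewrite contractZl mcoeffZ -[X in contract X _]mul1r mcoeff_contractMX contract1l.
  rewrite addmC det_coef big1 ?mulr0 // => t _; case: eqP => [e'|_]; last by rewrite mulr0.
  have ts : t = s.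
    apply: (@perm_agree1 _ _ i); apply: (perm_mnm_ge (B := pred1 i) e) => [r /= nr|].
      by rewrite mnm1E l0E mv_eq eq_sym (negbTE nr).
    by exists U_(l)%MM; rewrite e' addmC.
  have /eqP := e'; rewrite ts e addmC eqm_add2l => /eqP/mnmP/(_ l).
  by rewrite !mnm1E eqxx eq_sym (negbTE ne).
rewrite addr0 contractZl mcoeffZ -[X in contract X _]mul1r mcoeff_contractMX contract1l.
rewrite -e det_coef (bigD1 s) //= eqxx mulr1 big1 ?addr0 => [|t ne]; last first.
  by rewrite (inj_eq perm_mnm_inj) (negbTE ne) mulr0.
by move/eqP; rewrite mulf_eq0 signr_eq0 orbF => /eqP.
Qed.

Lemma mnm1D_eq (x y z w : 'I_(n * n)) :
  (U_(x) + U_(y) == U_(z) + U_(w))%MM = ((x == z) && (y == w)) || ((x == w) && (y == z)).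
Proof.
apply/eqP/orP => [/mnmP e|[/andP[/eqP -> /eqP ->]|/andP[/eqP -> /eqP ->]]] //; last first.
  by rewrite addmC.
have [zx|nzx] := eqVneq z x.
  left; subst z; rewrite ?eqxx /=; have := e y; rewrite !mnmDE !mnm1E eqxx.
  by rewrite (eq_sym y w); case: (w == y) => //; case: (x == y).
have [wx|nwx] := eqVneq w x.
  right; subst w; rewrite ?eqxx /=; have := e y; rewrite !mnmDE !mnm1E eqxx.
  by rewrite (eq_sym y z); case: (z == y) => //; case: (x == y).
by have := e x; rewrite !mnmDE !mnm1E eqxx (negbTE nzx) (negbTE nwx).
Qed.

(** In a monomial of a permutation s with s i = j and s i' = j', remove the two
    factors in rows i and i'. Only s and its product with (i i') have a
    monomial divisible by the rest, so the corresponding coefficient of the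
    contraction is the difference of the two values of S, up to sign and a
    factor 2. *)
Lemma det_perp_quad_nec (S : 'I_(n * n) -> 'I_(n * n) -> k) :
  (forall x y, S x y = S y x) -> det_perp (quad_poly S) ->
  forall i j i' j', S (mv i j) (mv i' j') = S (mv i j') (mv i' j).
Proof.
move=> symS /eqP h i j i' j'.
have [<-|ni] := eqVneq i i'; first by rewrite symS.
have [<-//|nj] := eqVneq j j'.
have [s [si si']] : exists s : 'S_n, s i = j /\ s i' = j'.
  exists (tperm i j * tperm (tperm i j i') j')%g; split; last by rewrite permM tpermL.
  have h1 : tperm i j i' != j.
    by apply/eqP => e; case/eqP: ni; apply: (@perm_inj _ (tperm i j)); rewrite tpermL.
  have h2 : j' != j by rewrite eq_sym.
  by rewrite permM tpermL (tpermD h1 h2).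
pose z0 := mv i j; pose w0 := mv i' j'; pose z1 := mv i j'; pose w1 := mv i' j.
pose m := (perm_mnm s - (U_(z0) + U_(w0)))%MM.
have e : perm_mnm s = (U_(z0) + U_(w0) + m)%MM.
  rewrite addmC submK //; apply/mnm_lepP => l; rewrite -(mv_rowcol l) mnmDE !mnm1E perm_mnmE.
  rewrite !mv_eq; have [<-|n1] := eqVneq i (prow l).
    by rewrite si /= (eq_sym i' i) (negbTE ni) addn0; case: (j == _).
  by have [<-|n2] := eqVneq i' (prow l); rewrite /= ?si' ?add0n //; case: (j' == _).
have e1 := perm_mnm_swap ni e.
have := congr1 (mcoeff m) h; rewrite mcoeff_contract_quad mcoeff0.
have coefE x y : (det_poly k n)@_(U_(x) + U_(y) + m) = (-1) ^+ s *
    (((x == z0) && (y == w0) || (x == w0) && (y == z0))%:R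
     - ((x == z1) && (y == w1) || (x == w1) && (y == z1))%:R).
  rewrite det_coef (bigD1 s) //= (bigD1 (tperm i i' * s)%g) /=; last first.
    rewrite -[X in _ != X]mul1g (inj_eq (mulIg s)); apply: contra_neq ni => ee.
    by have := congr1 (fun q : 'S_n => q i) ee; rewrite tpermL perm1.
  rewrite big1 ?addr0 => [|t /andP[nt1 nt2]]; last first.
    case: eqP => [et|_]; last by rewrite mulr0.
    have ag r : r != i -> r != i' -> t r = s r.
      move=> nr nr'; apply: (perm_mnm_ge (B := pred2 i i') e); last by rewrite /= negb_or nr.
        move=> q; rewrite /= negb_or => /andP[nq nq'].
        by rewrite mnmDE !mnm1E !mv_eq !(eq_sym _ q) (negbTE nq) (negbTE nq').
      by exists (U_(x) + U_(y))%MM.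
    by case: (perm_agree2 ag) => et'; rewrite et' eqxx in nt1 nt2.
rewrite e e1 odd_permM odd_tperm ni /= signrN !eqm_add2r mulrBr mulNr -/z1 -/w1.
  by rewrite (eq_sym (U_(z0) + _)%MM) (eq_sym (U_(z1) + _)%MM) !mnm1D_eq.
have pick z w : z != w -> \sum_x \sum_y S x y *
    ((x == z) && (y == w) || (x == w) && (y == z))%:R = S z w + S w z.
  move=> nzw; rewrite (bigD1 z) //= [X in _ + X](bigD1 w) /=; last by rewrite eq_sym.
  rewrite [X in _ + (_ + X)]big1 ?addr0; last first.
    move=> x /andP[/negbTE nz /negbTE nw]; apply: big1 => y _; rewrite nz nw /=.
    by rewrite mulr0.
  congr (_ + _).
    rewrite (bigD1 w) //= big1 => [|y /negbTE ny]; rewrite !eqxx /= ?mulr1 ?addr0 //.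
    by rewrite ny (negbTE nzw) mulr0.
  rewrite (bigD1 z) //= big1 => [|y /negbTE ny]; rewrite !eqxx /= ?andbT ?orbT ?mulr1 ?addr0 //.
  by rewrite ny (eq_sym w) (negbTE nzw) mulr0.
rewrite (eq_bigr (fun x => \sum_y (-1) ^+ s * (S x y *
    ((x == z0) && (y == w0) || (x == w0) && (y == z0))%:R - S x y *
    ((x == z1) && (y == w1) || (x == w1) && (y == z1))%:R))); last first.
  by move=> x _; apply: eq_bigr => y _; rewrite coefE mulrCA mulrBr.
under eq_bigr do rewrite -mulr_sumr sumrB.
rewrite -mulr_sumr sumrB !pick; last 2 first.
- by rewrite mv_eq (negbTE ni).
- by rewrite mv_eq (negbTE ni).
rewrite !(symS w0) !(symS w1) => /eqP; rewrite mulf_eq0 signr_eq0 /=.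
rewrite -mulr2n -mulr2n -mulrnBl -mulr_natr mulf_eq0 (negbTE (natS_neq0 char0 1)) orbF.
by rewrite subr_eq0 => /eqP.
Qed.

Lemma det_perp_const (c : k) : det_perp (c%:MP : mat_poly k n) -> c = 0.
Proof.
rewrite /det_perp -[c%:MP]mulr1 mul_mpolyC contractZl contract1l scaler_eq0.
by rewrite (negbTE (det_poly_neq0 k n)) orbF => /eqP.
Qed.
End Det.

(** * Minimal resolutions in low degrees *)

Local Open Scope quotient_scope.

Section Quotient.
Variables (k : fieldType) (n : nat).
Notation S := (mat_poly k n).
Notation proj := (@apolar_proj k n).

Lemma proj_eq (s t : S) : proj s = proj t <-> det_perp (s - t).
Proof.
have h : (s - t \in det_perp_ideal k n) = (proj s == proj t).
  by rewrite Quotient.idealrBE.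
by split=> [/eqP|p]; [rewrite -h | apply/eqP; rewrite -h].
Qed.

Lemma projM (s t : S) : proj (s * t) = proj s * proj t.
Proof. exact: (rmorphM (\pi_(apolar_alg k n))). Qed.
Lemma projD (s t : S) : proj (s + t) = proj s + proj t.
Proof. exact: (raddfD (\pi_(apolar_alg k n))). Qed.
Lemma proj0 : proj 0 = 0.
Proof. exact: (raddf0 (\pi_(apolar_alg k n))). Qed.

Lemma proj_eq0 (s : S) : proj s = 0 <-> det_perp s.
Proof. by rewrite -proj0 proj_eq subr0. Qed.

(** The degree n part of a contraction with the determinant is the constant term
    times the determinant. *)
Lemma det_perp_coef0 (s : S) : det_perp s -> s@_0%MM = 0.
Proof.
move=> /eqP h; have := congr1 (mcoeff (perm_mnm (1%g : 'S_n))) h.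
rewrite mcoeff_contract mcoeff0.
have deg_perm_mnm t : mdeg (perm_mnm (n := n) t) = n.
  by rewrite /perm_mnm mdeg_sum (eq_bigr (fun=> 1%N)) ?sum1_card ?card_ord // => i _; rewrite mdeg1.
rewrite (eq_bigr (fun a => s@_a * (if a == 0%MM then 1 else 0))); last first.
  move=> a _; case: eqVneq => [->|na].
    rewrite add0m det_coef (bigD1 1%g) //= eqxx odd_perm1 expr0 mul1r big1 ?addr0 // => t ne.
    by rewrite (inj_eq (@perm_mnm_inj n)) (negbTE ne) mulr0.
  rewrite det_coef big1 ?mulr0 // => t _; case: eqP => [e|_]; last by rewrite mulr0.
  have := congr1 mdeg e; rewrite mdegD !deg_perm_mnm => /eqP.
  by rewrite -[X in X == _]add0n eqn_add2r eq_sym mdeg_eq0 (negbTE na).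
have [z|z] := boolP (0%MM \in msupp s); last by rewrite (memN_msupp_eq0 z).
rewrite (bigD1_seq 0%MM) //= eqxx mulr1 big1 ?addr0 // => a /negbTE ->.
by rewrite mulr0.
Qed.
End Quotient.

Section Resolution.
Variables (k : fieldType) (n : nat).
Hypothesis char0 : [pchar k] =i pred0.
Variable F : graded_free_resolution k n.
Hypothesis minF : minimal F.
Notation S := (mat_poly k n).
Notation proj := (@apolar_proj k n).
Notation hom i d v := (homogeneous (deg F i) d v).

Definition coef0_zero r (v : 'rV[S]_r) := forall j, (v 0 j)@_0%MM = 0.
Definition const_vec r (v : 'rV[S]_r) := forall j, v 0 j = ((v 0 j)@_0%MM)%:MP.

Lemma diff_coef0 i (w : 'rV_(rank F i.+1)) : coef0_zero (w *m diff F i).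
Proof.
move=> j; rewrite mxE raddf_sum big1 // => a _ /=.
by rewrite rmorphM /= minF mulr0.
Qed.

Lemma delta_hom i j : hom i (deg F i j) (delta_mx 0 j : 'rV[S]_(rank F i)).
Proof.
move=> a m; rewrite mxE eqxx /=; case: eqVneq => [->|_] /=.
  by rewrite msupp1 inE => /eqP ->; rewrite mdeg0.
by rewrite msupp0.
Qed.

Lemma aug0 : aug F 0 = 0.
Proof.
have := aug_linear 1 0 (0 : 'rV_(rank F 0)); rewrite scaler0 addr0.
rewrite -[proj 1]/(\pi_(apolar_alg k n) 1) rmorph1 mul1r => h.
by apply: (addrI (aug F 0)); rewrite addr0 -h.
Qed.

Lemma augD x y : aug F (x + y) = aug F x + aug F y.
Proof.
have := aug_linear 1 x y; rewrite scale1r => ->.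
by rewrite -[proj 1]/(\pi_(apolar_alg k n) 1) rmorph1 mul1r.
Qed.

Lemma augZ s x : aug F (s *: x) = proj s * aug F x.
Proof. by have := aug_linear s x 0; rewrite aug0 !addr0. Qed.

Lemma aug_sum (c : 'I_(rank F 0) -> S) s : (forall j, aug F (delta_mx 0 j) = proj (s j)) ->
  aug F (\row_j c j) = proj (\sum_j c j * s j).
Proof.
move=> h; rewrite [\row_j _]row_sum_delta.
rewrite (big_morph _ augD aug0) (big_morph _ (@projD k n) (@proj0 k n)).
by apply: eq_bigr => j _; rewrite mxE augZ h projM.
Qed.

(** Surjectivity provides a generator whose image s j0 has nonzero constant
    term. For another generator j, the vector s_j e_j0 - s_j0 e_j is a relation,
    with a coefficient outside the maximal ideal, contrary to minimality. *)
Lemma rank0 : exists j0 : 'I_(rank F 0), [/\ forall j, j = j0, deg F 0 j0 = 0%N &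
  exists2 c : k, c != 0 & aug F (delta_mx 0 j0) = proj c%:MP].
Proof.
have /fin_all_exists2[s homs augs] : forall j, exists2 s : S, s \is (deg F 0 j).-homog &
    aug F (delta_mx 0 j) = proj s.
  by move=> j; apply: aug_graded; apply: delta_hom.
have [v augv] := aug_surj F (proj 1).
have [j0 sj0] : exists j0, (s j0)@_0%MM != 0.
  apply/existsP; apply/contraT; rewrite negb_exists => /forallP none.
  have : det_perp (\sum_j v 0 j * s j - 1).
    apply/proj_eq; rewrite -augv -(aug_sum _ augs); congr (aug F _).
    by apply/rowP => j; rewrite mxE.
  move/det_perp_coef0; rewrite mcoeffB mcoeff1 eqxx raddf_sum big1 ?sub0r => [/eqP|j _].
    by rewrite oppr_eq0 oner_eq0.
  by rewrite /= rmorphM /=; have := none j; rewrite negbK => /eqP ->; rewrite mulr0.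
have deg0 : deg F 0 j0 = 0%N.
  have : 0%MM \in msupp (s j0) by rewrite mcoeff_msupp.
  by move/(dhomog_mf (homs j0)) => <- /=; rewrite mdeg0.
exists j0; split=> //.
  move=> j; apply/eqP/contraT => ne.
  pose w : 'rV[S]_(rank F 0) := \row_a (if a == j0 then s j else if a == j then - s j0 else 0).
  have [w' ew] : exists w', w = w' *m diff F 0.
    apply/exact_aug; rewrite (aug_sum _ augs) -(proj0 k n); congr (proj _).
    rewrite (bigD1 j0) //= (bigD1 j) //= eqxx (negbTE ne) eqxx big1 => [|a /andP[/negbTE -> /negbTE ->]].
      by rewrite addr0 mulNr mulrC subrr.
    by rewrite mul0r.
  have := diff_coef0 w' j; rewrite -ew mxE (negbTE ne) eqxx mcoeffN => /eqP.
  by rewrite oppr_eq0 (negbTE sj0).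
exists (s j0)@_0%MM => //; rewrite augs; congr (proj _).
by apply: homog0_const; have := homs j0; rewrite deg0.
Qed.

Lemma basis_nz i j : (delta_mx 0 j : 'rV[S]_(rank F i.+1)) *m diff F i != 0.
Proof.
apply/eqP => /exact_diff[w e].
have := diff_coef0 w j; rewrite -e mxE !eqxx mcoeff1 eqxx => /eqP.
by rewrite oner_eq0.
Qed.

Lemma row_nz r (v : 'rV[S]_r) : v != 0 -> exists a, v 0 a != 0.
Proof.
move=> nz; apply/existsP/contraT; rewrite negb_exists => /forallP h.
by case/eqP: nz; apply/rowP => a; rewrite mxE; apply/eqP; rewrite -[_ == _]negbK h.
Qed.

Lemma homog_lt2_perp_eq0 d (s : S) : (d < 2)%N -> s \is d.-homog -> det_perp s -> s = 0.
Proof.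
case: d => [|[|//]] _ hs ps.
  by rewrite (homog0_const hs) (det_perp_coef0 ps) mpolyC0.
move: ps; rewrite (linear_expand hs) => /(det_perp_linear_eq0 (n := n)) h.
by apply: big1 => a _; rewrite h scale0r.
Qed.

(** By minimality and exactness the image of a generator of F_(i+1) is a nonzero
    vector without constant terms, so the degree exceeds that of some generator
    of F_i. In F_1 the generators are elements of det_n^perp, which has none
    below degree 2. *)
Lemma deg_ge i j : (i.+2 <= deg F i.+1 j)%N.
Proof.
elim: i j => [|i IH] j.
  have [j0 [uniq_j0 deg0 [c c0 augj0]]] := rank0.
  pose u : 'rV[S]_(rank F 0) := delta_mx 0 j *m diff F 0.
  have homu : hom 0 (deg F 1 j) u by apply/diff_graded/delta_hom.
  have [a ua] := row_nz (basis_nz j).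
  rewrite leqNgt; apply/negP => lt2; case/eqP: ua; rewrite -/u (uniq_j0 a).
  apply: (homog_lt2_perp_eq0 lt2).
    by apply/dhomogP => m /homu; rewrite deg0 addn0.
  have uE : u = u 0 j0 *: delta_mx 0 j0.
    by apply/rowP => b; rewrite [RHS]mxE [X in _ * X]mxE (uniq_j0 b) !eqxx mulr1.
  have : aug F (u 0 j0 *: delta_mx 0 j0) = 0.
    by rewrite -uE; apply/exact_aug; exists (delta_mx 0 j).
  rewrite augZ augj0 -projM => /proj_eq0; rewrite mulrC mul_mpolyC => /eqP.
  rewrite contractZl => /eqP; rewrite scaler_eq0 (negbTE c0) /= => /eqP h.
  by apply/eqP.
pose u : 'rV[S]_(rank F i.+1) := delta_mx 0 j *m diff F i.+1.
have homu : hom i.+1 (deg F i.+2 j) u by apply/diff_graded/delta_hom.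
have [a ua] := row_nz (basis_nz j); rewrite -/u in ua.
have [m mu] : exists m, m \in msupp (u 0 a).
  case E : (msupp (u 0 a)) => [|m s]; last by exists m; rewrite inE eqxx.
  by move/eqP: E; rewrite msupp_eq0 (negbTE ua).
have nm : m != 0%MM.
  by apply: contraTneq mu => ->; rewrite mcoeff_msupp negbK diff_coef0.
rewrite -(homu a m mu); move: (IH a); rewrite -mdeg_eq0 -lt0n in nm.
by move=> h; rewrite -add1n; apply: leq_add.
Qed.

Lemma const_vecP i v : hom i.+1 i.+2 v -> const_vec v.
Proof.
move=> hv j; apply/mpolyP => m; rewrite mcoeffC.
case: eqVneq => [->|nm]; first by rewrite mulr1.
rewrite mulr0; apply/eqP; rewrite mcoeff_eq0; apply/negP => /hv.
by have := deg_ge j; rewrite -mdeg_eq0 in nm; lia.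
Qed.

Lemma const_vec_eq0 r (v : 'rV[S]_r) : const_vec v -> coef0_zero v -> v = 0.
Proof. by move=> cv v0; apply/rowP => j; rewrite cv v0 mxE mpolyC0. Qed.

(** A vector of constants in the kernel lies in the image of the next
    differential, whose entries have no constant term. *)
Lemma const_diff_inj i v : const_vec v -> v *m diff F i = 0 -> v = 0.
Proof.
by move=> cv /exact_diff[w e]; apply: const_vec_eq0 => //; rewrite e; apply: diff_coef0.
Qed.

Definition lin_part r l (v : 'rV[S]_r) : 'rV[S]_r := map_mx (fun p : S => (p@_U_(l)%MM)%:MP) v.

Lemma lin_const r l (v : 'rV[S]_r) : const_vec (lin_part l v).
Proof. by move=> j; rewrite mxE mcoeffC eqxx mulr1. Qed.

Lemma lin_hom i l v : hom i.+1 i.+3 v -> hom i.+1 i.+2 (lin_part l v).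
Proof.
move=> hv j m; rewrite mxE msuppC; case: eqP => [//|/eqP nz]; rewrite inE => /eqP ->.
have /hv : U_(l)%MM \in msupp (v 0 j) by rewrite mcoeff_msupp.
by rewrite mdeg1 mdeg0 => -[].
Qed.

Lemma lin_expand i v : hom i.+1 i.+3 v -> coef0_zero v -> v = \sum_l 'X_l *: lin_part l v.
Proof.
move=> hv v0; apply/rowP => j; rewrite summxE.
have h1 : v 0 j \is 1.-homog.
  apply/dhomogP => m mv /=; have := hv j m mv; have := deg_ge j.
  have : m != 0%MM by apply: contraTneq mv => ->; rewrite mcoeff_msupp v0 eqxx.
  rewrite -mdeg_eq0; move=> h1 h2 h3; lia.
rewrite {1}(linear_expand h1); apply: eq_bigr => l _.
by rewrite !mxE mulrC mul_mpolyC.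
Qed.

Lemma lin_sum r l (c : 'I_(n * n) -> 'rV[S]_r) (G : 'I_(n * n) -> 'I_(n * n) -> k) :
  (forall x, const_vec (c x)) ->
  lin_part l (\sum_x (\sum_m G x m *: 'X_m) *: c x) = \sum_x (G x l)%:MP *: c x.
Proof.
move=> cc; apply/rowP => j; rewrite mxE !summxE raddf_sum raddf_sum /=.
apply: eq_bigr => x _; rewrite !mxE cc -mpolyCM; congr (_%:MP); rewrite [in LHS]mulrC mul_mpolyC mcoeffZ.
rewrite raddf_sum /= (bigD1 l) //= big1 => [|m ne]; rewrite mcoeffZ mcoeffXU.
  by rewrite eqxx mulr1 addr0 mulrC.
by rewrite (negbTE ne) mulr0.
Qed.

Lemma lin_sumX r l (c : 'I_(n * n) -> 'rV[S]_r) : (forall x, const_vec (c x)) ->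
  lin_part l (\sum_x 'X_x *: c x) = c l.
Proof.
move=> cc; have := lin_sum l (fun x m => (x == m)%:R) cc.
rewrite (eq_bigr (fun x => 'X_x *: c x)) => [->|x _]; last first.
  congr (_ *: _); rewrite (bigD1 x) //= eqxx scale1r big1 ?addr0 // => m ne.
  by rewrite eq_sym (negbTE ne) scale0r.
rewrite (bigD1 l) //= eqxx mpolyC1 scale1r big1 ?addr0 // => m ne.
by rewrite (negbTE ne) mpolyC0 scale0r.
Qed.

Lemma lin_linear r l (c : k) (v w : 'rV[S]_r) :
  lin_part l (c%:MP *: v + w) = c%:MP *: lin_part l v + lin_part l w.
Proof.
by apply/rowP => j; rewrite !mxE mcoeffD mul_mpolyC mcoeffZ mpolyCD mpolyCM.
Qed.

Definition order_ge i d (v : 'rV[S]_(rank F i)) :=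
  forall j m, m \in msupp (v 0 j) -> (d <= mdeg m + deg F i j)%N.

Lemma diff_order i d v : order_ge d v -> @order_ge i d (v *m diff F i).
Proof.
move=> hv a m; rewrite mxE => /msupp_sum_le /flattenP[s /mapP[j _ ->]].
move=> /msuppM_le /allpairsP[[m1 m2] [h1 h2 ->]] /=.
apply: leq_trans (hv j m1 h1) _; rewrite mdegD -addnA leq_add2l.
have /(_ a m2) : hom i (deg F i.+1 j) (delta_mx 0 j *m diff F i).
  by apply/diff_graded/delta_hom.
by rewrite -rowE mxE => /(_ h2) ->.
Qed.

Lemma hom_order_eq0 i d v : hom i d v -> order_ge d.+1 v -> v = 0.
Proof.
move=> hv ov; apply/rowP => j; rewrite mxE; apply/eqP; rewrite -msupp_eq0.
case E : (msupp _) => [//|m s]; have mv : m \in msupp (v 0 j) by rewrite E inE eqxx.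
by have := ov j m mv; rewrite (hv j m mv) ltnn.
Qed.

(** Keeping only the part of w of degree i + 2 changes w by terms of higher
    degree, whose image has no component in degree i + 2. *)
Lemma const_lift i (u : 'rV_(rank F i)) w : hom i i.+2 u -> u = w *m diff F i ->
  exists2 w', hom i.+1 i.+2 w' & u = w' *m diff F i.
Proof.
move=> hu e.
pose w' : 'rV[S]_(rank F i.+1) :=
  \row_j (if deg F i.+1 j == i.+2 then ((w 0 j)@_0%MM)%:MP else 0).
have hw' : hom i.+1 i.+2 w'.
  move=> j m; rewrite mxE; case: eqP => [dj|_]; last by rewrite msupp0.
  by rewrite msuppC; case: eqP => // _; rewrite inE => /eqP ->; rewrite mdeg0 add0n.
exists w' => //; apply: subr0_eq; apply: (@hom_order_eq0 i i.+2).
  move=> j m; have hd := diff_graded hw'.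
  rewrite !mxE => /msuppB_le; rewrite mem_cat => /orP[/hu//|h].
  by apply: hd; rewrite mxE.
rewrite e -mulmxBl; apply: diff_order => j m; rewrite !mxE.
case: eqP => [dj|/eqP dj].
  rewrite dj => mw; have : m != 0%MM.
    apply: contraTneq mw => ->; rewrite mcoeff_msupp mcoeffB mcoeffC eqxx mulr1 subrr.
    by rewrite eqxx.
  by rewrite -mdeg_eq0 -lt0n => h; rewrite -add1n leq_add2r.
move=> _; apply: leq_trans (leq_addl _ _); rewrite ltn_neqAle eq_sym dj.
exact: deg_ge.
Qed.

End Resolution.

(** * Linear second syzygies and quadrics *)

Section Syzygies.
Variables (k : fieldType) (n : nat).
Hypothesis char0 : [pchar k] =i pred0.
Variable F : graded_free_resolution k n.
Hypothesis minF : minimal F.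
Notation S := (mat_poly k n).
Notation mv := (@mxvec_index n n).
Notation hom i d v := (homogeneous (deg F i) d v).
Implicit Types (x y z w : 'I_(n * n)).

Definition step2 (v : 'rV[S]_(rank F 3)) x : 'rV[S]_(rank F 2) := lin_part x (v *m diff F 2).
Definition step1 v x y : 'rV[S]_(rank F 1) := lin_part y (step2 v x *m diff F 1).

(** The quadric q_xy attached to v; F_0 has rank one, so that the sum is its
    only coordinate. *)
Definition syz v x y : S := \sum_j (step1 v x y *m diff F 0) 0 j.

Lemma diff_diff i (v : 'rV[S]_(rank F i.+2)) : v *m diff F i.+1 *m diff F i = 0.
Proof. by apply/exact_diff; exists v. Qed.

Lemma sumX_mul r r' (c : 'I_(n * n) -> 'rV[S]_r) (A : 'M[S]_(r, r')) :
  (\sum_x 'X_x *: c x) *m A = \sum_x 'X_x *: (c x *m A).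
Proof. by rewrite mulmx_suml; apply: eq_bigr => x _; rewrite scalemxAl. Qed.

Lemma sum_rank0 j0 (u : 'rV[S]_(rank F 0)) :
  (forall j : 'I_(rank F 0), j = j0) -> \sum_j u 0 j = u 0 j0.
Proof. by move=> uj; rewrite (bigD1 j0) //= big1 ?addr0 // => j; rewrite (uj j) eqxx. Qed.

Lemma hom0P d (u : 'rV[S]_(rank F 0)) : hom 0 d u <-> \sum_j u 0 j \is d.-homog.
Proof.
have [j0 [uj d0 _]] := rank0 minF.
rewrite (sum_rank0 _ uj); split=> [h|/dhomogP h j m].
  by apply/dhomogP => m /h; rewrite d0 addn0.
by rewrite (uj j) => /h; rewrite d0 addn0.
Qed.

Lemma sum0_eq0 (u : 'rV[S]_(rank F 0)) : \sum_j u 0 j = 0 -> u = 0.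
Proof.
have [j0 [uj d0 _]] := rank0 minF.
by rewrite (sum_rank0 _ uj) => h; apply/rowP => j; rewrite mxE (uj j).
Qed.

Lemma perp_sum0 (u : 'rV[S]_(rank F 0)) : aug F u = 0 <-> det_perp (\sum_j u 0 j).
Proof.
have [j0 [uj d0 [c c0 augj]]] := rank0 minF.
rewrite (sum_rank0 _ uj); have {1}-> : u = u 0 j0 *: delta_mx 0 j0.
  by apply/rowP => b; rewrite !mxE (uj b) !eqxx mulr1.
rewrite augZ augj -projM mulrC mul_mpolyC proj_eq0 /det_perp contractZl.
by rewrite scaler_eq0 (negbTE c0).
Qed.

Section Degree4.
Variable v : 'rV[S]_(rank F 3).
Hypothesis hv : hom 3 4 v.

Lemma step2_hom x : hom 2 3 (step2 v x).
Proof. by apply: lin_hom; apply: diff_graded. Qed.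

Lemma step2_expand : v *m diff F 2 = \sum_x 'X_x *: step2 v x.
Proof. by apply: lin_expand => //; [apply: diff_graded | apply: diff_coef0]. Qed.

Lemma step1_hom x y : hom 1 2 (step1 v x y).
Proof. by apply: lin_hom; apply: diff_graded; apply: step2_hom. Qed.

Lemma step1_expand x : step2 v x *m diff F 1 = \sum_y 'X_y *: step1 v x y.
Proof.
apply: lin_expand => //; last exact: diff_coef0.
by apply: diff_graded; apply: step2_hom.
Qed.

Lemma syz_homog x y : syz v x y \is 2.-homog.
Proof. by apply/hom0P; apply: diff_graded; apply: step1_hom. Qed.

Lemma syz_perp x y : det_perp (syz v x y).
Proof. by apply/perp_sum0/exact_aug; exists (step1 v x y). Qed.

Lemma syz_linear_rel x : \sum_y 'X_y * syz v x y = 0.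
Proof.
have : (\sum_y 'X_y *: step1 v x y) *m diff F 0 = 0.
  by rewrite -step1_expand diff_diff.
rewrite sumX_mul => e; transitivity (\sum_j (0 : 'rV[S]_(rank F 0)) 0 j); last first.
  by apply: big1 => j _; rewrite mxE.
rewrite -e; under [RHS]eq_bigr do rewrite summxE.
rewrite exchange_big; apply: eq_bigr => y _ /=.
by rewrite /syz mulr_sumr; apply: eq_bigr => j _; rewrite [RHS]mxE.
Qed.

(** Compare the coefficients of X_x X_y. *)
Lemma const_antisym r (c : 'I_(n * n) -> 'I_(n * n) -> 'rV[S]_r) :
  (forall x y, const_vec (c x y)) ->
  \sum_x 'X_x *: (\sum_y 'X_y *: c x y) = 0 -> forall x y, c x y + c y x = 0.
Proof.
move=> cc e x y; apply/rowP => j; rewrite !mxE (cc x y) (cc y x) -mpolyCD.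
have := congr1 (fun u : 'rV[S]_r => coef2 x y (u 0 j)) e.
rewrite summxE (eq_bigr (fun a => 'X_a * \sum_b 'X_b * c a b 0 j)); last first.
  by move=> a _; rewrite mxE summxE; congr (_ * _); apply: eq_bigr => b _; rewrite mxE.
rewrite coef2_sumX !mderiv_sumX !mcoeffD !mcoeff0_sumX !addr0 => ->.
by rewrite mxE /coef2 !mderiv0 mcoeff0 mpolyC0.
Qed.

Lemma step1_antisym x y : step1 v x y + step1 v y x = 0.
Proof.
apply: (@const_antisym _ (step1 v)) => [a b|]; first exact: lin_const.
have := diff_diff v; rewrite step2_expand sumX_mul => e.
by rewrite -[RHS]e; apply: eq_bigr => a _; rewrite step1_expand.
Qed.

Lemma syz_antisym x y : syz v y x = - syz v x y.
Proof.
rewrite /syz -sumrN; apply: eq_bigr => j _.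
have /eqP := step1_antisym x y; rewrite addrC addr_eq0 => /eqP ->.
by rewrite mulNmx mxE.
Qed.

(** The quadric is apolar to the determinant. *)
Lemma syz_exchange x y i j i' j' : coef2 (mv i j) (mv i' j') (syz v x y) =
  coef2 (mv i j') (mv i' j) (syz v x y).
Proof.
have := syz_perp x y; rewrite {1}(quad_expand char0 (syz_homog x y)).
move=> /(det_perp_quad_nec char0) h.
have two : (2%:R : k)^-1 != 0 by rewrite invr_eq0 (natS_neq0 char0).
by apply: (mulfI two); apply: h => a b; rewrite coef2C.
Qed.

Lemma syz_cycle x y z w : coef2 z w (syz v x y) + coef2 y w (syz v x z)
  + coef2 y z (syz v x w) = 0.
Proof.
rewrite -(coef3_sumX y z w (syz v x)) syz_linear_rel.
by rewrite /coef2 !mderiv0 mcoeff0.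
Qed.

(** The quadrics determine the constant vectors at each stage, since the
    differentials are injective on constants. *)
Lemma syz_inj : (forall x y z w, coef2 z w (syz v x y) = 0) -> v = 0.
Proof.
move=> h.
have s1 x y : step1 v x y = 0.
  apply: (const_diff_inj minF); first exact: lin_const.
  apply: sum0_eq0; rewrite -/(syz v x y).
  by apply: (quadratic_eq0 char0 (syz_homog x y)) => z w; apply: h.
have s2 x : step2 v x = 0.
  apply: (const_diff_inj minF); first exact: lin_const.
  by rewrite step1_expand big1 // => y _; rewrite s1 scaler0.
apply: (const_diff_inj minF); first exact: (const_vecP minF hv).
by rewrite step2_expand big1 // => x _; rewrite s2 scaler0.
Qed.
End Degree4.

(** The quadrics with the prescribed coefficients are apolar, so they lift to
    constant vectors of F_1; their linear relations lift these to F_2, and the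
    alternation gives the lift to F_3. *)
Lemma syz_surj (T : 'I_(n * n) -> 'I_(n * n) -> 'I_(n * n) -> 'I_(n * n) -> k) :
  (forall x y z w, T y x z w = - T x y z w) ->
  (forall x y z w, T x y w z = T x y z w) ->
  (forall x y i j i' j', T x y (mv i j) (mv i' j') = T x y (mv i j') (mv i' j)) ->
  (forall x y z w, T x y z w + T x z y w + T x w y z = 0) ->
  exists2 v, hom 3 4 v & forall x y z w, coef2 z w (syz v x y) = T x y z w.
Proof.
move=> Tanti Tsym Texch Tcyc.
have two := natS_neq0 char0 1.
(* Halved because the Hessian of a quadratic form doubles its coefficients. *)
pose q x y : S := quad_poly (fun z w => 2%:R^-1 * T x y z w).
have qE x y z w : coef2 z w (q x y) = T x y z w.
  by rewrite coef2_quad (Tsym x y z w); field.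
have qhom x y : q x y \is 2.-homog by apply: quad_homog.
have qperp x y : det_perp (q x y).
  by apply: (det_perp_quad_suff char0) => i j i' j'; rewrite Texch.
have qanti x y : q x y + q y x = 0.
  apply: (quadratic_eq0 char0); first by apply: rpredD; apply: qhom.
  by move=> a b; rewrite coef2D !qE Tanti addNr.
have qrel x : \sum_y 'X_y * q x y = 0.
  apply: (cubic_eq0 char0) => [|a b c].
    by apply: rpred_sum => y _; apply: (dhomogM (X_homog _ y) (qhom x y)).
  by rewrite coef3_sumX !qE; apply: Tcyc.
have [j0 [uj d0 _]] := rank0 minF.
have sum_j0 u := @sum_rank0 j0 u uj.
pose Q x y : 'rV[S]_(rank F 0) := const_mx (q x y).
have QE x y : \sum_j Q x y 0 j = q x y by rewrite sum_j0 mxE.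
have /fin_all_exists2[W Whom WE] : forall p : 'I_(n * n) * 'I_(n * n),
    exists2 w : 'rV[S]_(rank F 1), hom 1 2 w & Q p.1 p.2 = w *m diff F 0.
  move=> [x y] /=.
  have [w0 e0] : exists u, Q x y = u *m diff F 0.
    by apply/exact_aug/perp_sum0; rewrite QE.
  have hQ : hom 0 2 (Q x y) by apply/hom0P; rewrite QE.
  exact: (const_lift minF hQ e0).
have Wconst p : const_vec (W p) by apply: (const_vecP minF).
have Wanti x y : W (x, y) + W (y, x) = 0.
  apply: (const_diff_inj minF).
    by move=> j; rewrite mxE (Wconst (x, y)) (Wconst (y, x)) -mpolyCD mcoeffC eqxx mulr1.
  rewrite mulmxDl -!WE; apply: sum0_eq0; rewrite -[RHS](qanti x y) -!QE -big_split /=.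
  by apply: eq_bigr => j _; rewrite mxE.
have Whom3 x : hom 1 3 (\sum_y 'X_y *: W (x, y)).
  move=> j m; rewrite summxE => /msupp_sum_le/flattenP[s /mapP[y _ ->]].
  rewrite mxE mulrC (perm_mem (msuppMX _ _)) => /mapP[m' hm' ->].
  by rewrite mdegD mdeg1 -addnA (Whom _ _ _ hm').
have /fin_all_exists2[U Uhom UE] : forall x, exists2 w : 'rV[S]_(rank F 2),
    hom 2 3 w & \sum_y 'X_y *: W (x, y) = w *m diff F 1.
  move=> x.
  have [w0 e0] : exists u, \sum_y 'X_y *: W (x, y) = u *m diff F 1.
    apply/exact_diff; rewrite sumX_mul; apply: sum0_eq0.
    rewrite sum_j0 summxE -[RHS](qrel x); apply: eq_bigr => y _.
    by rewrite mxE -WE mxE.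
  exact: (const_lift minF _ e0).
have Uconst x : const_vec (U x) by apply: (const_vecP minF).
have Uhom4 : hom 2 4 (\sum_x 'X_x *: U x).
  move=> j m; rewrite summxE => /msupp_sum_le/flattenP[s /mapP[y _ ->]].
  rewrite mxE mulrC (perm_mem (msuppMX _ _)) => /mapP[m' hm' ->].
  by rewrite mdegD mdeg1 -addnA (Uhom _ _ _ hm').
have [v0 e0] : exists u, \sum_x 'X_x *: U x = u *m diff F 2.
  apply/exact_diff; rewrite sumX_mul.
  rewrite (eq_bigr (fun x => \sum_y ('X_x * 'X_y) *: W (x, y))); last first.
    by move=> x _; rewrite -UE scaler_sumr; apply: eq_bigr => y _; rewrite scalerA.
  (* W is alternating and X_x X_y symmetric. *)
  set Z := \sum_x _; have ZN : Z = - Z.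
    rewrite {1}/Z exchange_big /= -sumrN; apply: eq_bigr => x _.
    rewrite -sumrN; apply: eq_bigr => y _.
    have /eqP := Wanti y x; rewrite addr_eq0 => /eqP ->.
    by rewrite scalerN mulrC.
  have : (2%:R%:MP : S) *: Z = 0.
    by rewrite rmorph_nat scaler_nat mulr2n {2}ZN subrr.
  move=> Z0; apply/rowP => j; have /rowP/(_ j) := Z0; rewrite !mxE => /eqP.
  by rewrite mulf_eq0 mpolyC_eq0 (negbTE two) => /eqP.
have [v vhom vE] := const_lift minF Uhom4 e0.
exists v => // x y z w; rewrite -qE; congr coef2.
have s2 a : step2 v a = U a by rewrite /step2 -vE lin_sumX.
have s1 a b : step1 v a b = W (a, b).
  rewrite /step1 s2 -UE lin_sumX // => c; exact: Wconst.
by rewrite /syz s1 -WE QE.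
Qed.

(** An automorphism of the resolution that is semilinear over a linear
    substitution. *)
Section Semilinear.
Variable G : 'I_(n * n) -> 'I_(n * n) -> k.
Variable f : forall i, 'rV[S]_(rank F i) -> 'rV[S]_(rank F i).
Hypothesis f_lin : forall i (s : S) (u v : 'rV[S]_(rank F i)),
  f (s *: u + v) = subst_lin G s *: f u + f v.
Hypothesis f_hom : forall i d (v : 'rV[S]_(rank F i)), hom i d v -> hom i d (f v).
Hypothesis f_diff : forall i (v : 'rV[S]_(rank F i.+1)),
  f (v *m diff F i) = f v *m diff F i.
Hypothesis f_aug : forall (v : 'rV[S]_(rank F 0)) s, aug F v = apolar_proj s ->
  aug F (f v) = apolar_proj (subst_lin G s).

Lemma subst_lin1 : subst_lin G 1 = 1.
Proof. exact: comp_mpoly1. Qed.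

Lemma semilinear0 i : f (0 : 'rV_(rank F i)) = 0.
Proof.
have := f_lin 1 (0 : 'rV[S]_(rank F i)) 0; rewrite scaler0 addr0 subst_lin1 scale1r.
by move=> /eqP; rewrite -[X in X == _]addr0 (inj_eq (addrI _)) eq_sym => /eqP.
Qed.

Lemma semilinearD i (u v : 'rV[S]_(rank F i)) : f (u + v) = f u + f v.
Proof. by have := f_lin 1 u v; rewrite scale1r subst_lin1 scale1r. Qed.

Lemma semilinearZ i s (u : 'rV[S]_(rank F i)) : f (s *: u) = subst_lin G s *: f u.
Proof. by have := f_lin s u 0; rewrite semilinear0 !addr0. Qed.

Lemma semilinear_sum i (u : 'I_(n * n) -> 'rV[S]_(rank F i)) :
  f (\sum_x u x) = \sum_x f (u x).
Proof. exact: (big_morph _ (@semilinearD i) (semilinear0 i)). Qed.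

Lemma semilinear_sumX i (u : 'I_(n * n) -> 'rV[S]_(rank F i)) :
  f (\sum_x 'X_x *: u x) = \sum_x (\sum_m G x m *: 'X_m) *: f (u x).
Proof.
by rewrite semilinear_sum; apply: eq_bigr => x _; rewrite semilinearZ subst_linX.
Qed.

(** The generator of F_0 can only be multiplied by a constant a; both its image
    in the quotient and the image of that under the substitution are the same
    nonzero constant, so a = 1. *)
Lemma semilinear_fix0 (u : 'rV[S]_(rank F 0)) :
  \sum_j f u 0 j = subst_lin G (\sum_j u 0 j).
Proof.
have [j0 [uj d0 [c c0 augj]]] := rank0 minF.
have sum_j0 u := @sum_rank0 j0 u uj.
pose e : 'rV[S]_(rank F 0) := delta_mx 0 j0.
have uE (w : 'rV[S]_(rank F 0)) : w = w 0 j0 *: e.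
  by apply/rowP => b; rewrite [RHS]mxE [X in _ * X]mxE (uj b) !eqxx mulr1.
have fe : f e = e.
  have he : hom 0 0 (f e) by apply: f_hom; rewrite -[X in homogeneous _ X _]d0; apply: delta_hom.
  have he' : f e 0 j0 \is 0.-homog.
    by apply/dhomogP => m /he; rewrite d0 addn0.
  set a := (f e 0 j0)@_0%MM.
  have feE : f e = a%:MP *: e by rewrite [LHS]uE (homog0_const he').
  have := f_aug augj; rewrite -/e feE augZ augj subst_linC -projM.
  move=> /proj_eq; rewrite -mpolyCM -mpolyCB => /det_perp_const.
  move/eqP; rewrite subr_eq0 -[X in _ == X]mul1r (inj_eq (mulIf c0)) => /eqP a1.
  by rewrite a1 mpolyC1 scale1r.
by rewrite !sum_j0 [X in f X]uE semilinearZ fe !mxE !eqxx mulr1.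
Qed.

Section Transform.
Variable v : 'rV[S]_(rank F 3).
Hypothesis hv : hom 3 4 v.

Lemma const_f i (u : 'rV[S]_(rank F i.+1)) : hom i.+1 i.+2 u -> const_vec (f u).
Proof. by move=> hu; apply: (const_vecP minF); apply: f_hom. Qed.

Lemma step2_f x : step2 (f v) x = \sum_a (G a x)%:MP *: f (step2 v a).
Proof.
rewrite [LHS]/step2 -f_diff (step2_expand hv) semilinear_sumX lin_sum // => a.
by apply: const_f; apply: step2_hom.
Qed.

Lemma step1_f x y : step1 (f v) x y =
  \sum_a \sum_b (G a x * G b y)%:MP *: f (step1 v a b).
Proof.
rewrite [LHS]/step1 step2_f mulmx_suml.
have lin_sumC (c : 'I_(n * n) -> k) (u : 'I_(n * n) -> 'rV[S]_(rank F 1)) :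
    lin_part y (\sum_a (c a)%:MP *: u a) = \sum_a (c a)%:MP *: lin_part y (u a).
  have linD (u1 u2 : 'rV[S]_(rank F 1)) : lin_part y (u1 + u2) = lin_part y u1 + lin_part y u2.
    by have := lin_linear y 1 u1 u2; rewrite mpolyC1 !scale1r.
  have lin0 : lin_part y (0 : 'rV[S]_(rank F 1)) = 0.
    by apply/rowP => j; rewrite !mxE mcoeff0 mpolyC0.
  rewrite (big_morph _ linD lin0); apply: eq_bigr => a _.
  by have := lin_linear y (c a) (u a) 0; rewrite lin0 !addr0.
rewrite (eq_bigr (fun a => (G a x)%:MP *: f (step2 v a *m diff F 1))); last first.
  by move=> a _; rewrite -scalemxAl f_diff.
rewrite lin_sumC; apply: eq_bigr => a _.
rewrite (step1_expand hv) semilinear_sumX lin_sum => [|b]; last first.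
  by apply: const_f; apply: step1_hom.
by rewrite scaler_sumr; apply: eq_bigr => b _; rewrite scalerA mpolyCM.
Qed.

Lemma syz_f x y : syz (f v) x y =
  \sum_a \sum_b (G a x * G b y)%:MP * subst_lin G (syz v a b).
Proof.
rewrite [LHS]/syz step1_f mulmx_suml; under eq_bigr do rewrite summxE.
rewrite exchange_big; apply: eq_bigr => a _ /=.
under eq_bigr do rewrite mulmx_suml summxE.
rewrite exchange_big; apply: eq_bigr => b _ /=.
rewrite -semilinear_fix0 f_diff mulr_sumr; apply: eq_bigr => j _.
by rewrite -scalemxAl mxE.
Qed.

Lemma coef2_syz_f x y z w : coef2 z w (syz (f v) x y) =
  \sum_a \sum_b \sum_c \sum_d
    (G a x * G b y * G c z * G d w) * coef2 c d (syz v a b).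
Proof.
rewrite syz_f coef2_sum; apply: eq_bigr => a _.
rewrite coef2_sum; apply: eq_bigr => b _.
rewrite mul_mpolyC coef2Z (coef2_subst char0) ?syz_homog // mulr_sumr.
apply: eq_bigr => c _; rewrite mulr_sumr; apply: eq_bigr => d _.
by rewrite !mulrA.
Qed.
End Transform.
End Semilinear.
End Syzygies.

(** * The degree 4 component of F_3 *)

Section SyzygyTensor.
Variables (k : fieldType) (n : nat).
Hypothesis char0 : [pchar k] =i pred0.
Variable F : graded_free_resolution k n.
Hypothesis minF : minimal F.
Notation S := (mat_poly k n).
Notation mv := (@mxvec_index n n).
Notation hom i d v := (homogeneous (deg F i) d v).
Notation idx := {ffun 'I_4 -> 'I_n}.
Notation N := #|{ffun 'I_4 -> 'I_n}|.
Notation ent M a b c d e f g h := (M (enum_rank (quad a b c d)) (enum_rank (quad e f g h))).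

(** The letters of the four positions are regrouped: row letters index the rows
    of the tensor, column letters its columns. *)
Fact syz_tensor_spec : {f : 'rV[S]_(rank F 3) -> 'M[k]_N |
  forall v a b c d e f' g h, ent (f v) a b c d e f' g h =
    coef2 (mv c g) (mv d h) (syz v (mv a e) (mv b f'))}.
Proof.
exists (fun v => mx8 (fun a b c d e f g h =>
  coef2 (mv c g) (mv d h) (syz v (mv a e) (mv b f)))) => *.
exact: mx8E.
Qed.

Definition syz_tensor : 'rV[S]_(rank F 3) -> 'M[k]_N := sval syz_tensor_spec.

Lemma syz_tensorE v a b c d e f g h :
  ent (syz_tensor v) a b c d e f g h = coef2 (mv c g) (mv d h) (syz v (mv a e) (mv b f)).
Proof. exact: (svalP syz_tensor_spec). Qed.

Lemma linear_entry (c : k) (M M' : 'M[k]_N) x y : (c *: M + M') x y = c * M x y + M' x y.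
Proof. by rewrite !mxE. Qed.

Lemma syz_tensor_kernel v : hom 3 4 v -> in_kernel (syz_tensor v).
Proof.
move=> hv; split=> a b c d e f g h; rewrite !syz_tensorE.
- rewrite (syz_antisym minF hv) -scaleN1r coef2Z mulN1r; congr (- _).
- by rewrite (syz_exchange char0 minF hv) coef2C.
- by rewrite (syz_exchange char0 minF hv).
have := syz_cycle minF hv (mv a e) (mv b f) (mv c g) (mv d h).
by rewrite (coef2C (mv c g) (mv b f)).
Qed.

Lemma syz_tensor_linear c v w : syz_tensor (c%:MP *: v + w) = c *: syz_tensor v + syz_tensor w.
Proof.
have s2 x : step2 (c%:MP *: v + w) x = c%:MP *: step2 v x + step2 w x.
  by rewrite /step2 mulmxDl -scalemxAl lin_linear.
have s1 x y : step1 (c%:MP *: v + w) x y = c%:MP *: step1 v x y + step1 w x y.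
  by rewrite [LHS]/step1 s2 mulmxDl -scalemxAl lin_linear.
have s0 x y : syz (c%:MP *: v + w) x y = c *: syz v x y + syz w x y.
  rewrite [LHS]/syz s1 mulmxDl -scalemxAl /syz scaler_sumr -big_split.
  by apply: eq_bigr => j _; rewrite [LHS]mxE [X in X + _]mxE mul_mpolyC.
apply: ent_eqP => a b c' d e f g h.
rewrite linear_entry.
by rewrite !syz_tensorE s0 coef2D coef2Z.
Qed.

Lemma syz_tensor_inj v w : hom 3 4 v -> hom 3 4 w -> syz_tensor v = syz_tensor w -> v = w.
Proof.
move=> hv hw e; apply: subr0_eq.
have hvw : hom 3 4 (v - w).
  by move=> j m; rewrite !mxE => /msuppB_le; rewrite mem_cat => /orP[/hv|/hw].
apply: (syz_inj char0 minF hvw) => x y z t.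
have <- : syz_tensor (v - w) (enum_rank (quad (prow x) (prow y) (prow z) (prow t)))
    (enum_rank (quad (pcol x) (pcol y) (pcol z) (pcol t))) =
  coef2 z t (syz (v - w) x y) by rewrite syz_tensorE !mv_rowcol.
rewrite addrC -scaleN1r -mpolyC1 -mpolyCN syz_tensor_linear e.
by rewrite scaleN1r addNr mxE.
Qed.

Lemma syz_tensor_surj M : in_kernel M -> exists2 v, hom 3 4 v & syz_tensor v = M.
Proof.
move=> KM; pose T x y z w := ent M (prow x) (prow y) (prow z) (prow w)
  (pcol x) (pcol y) (pcol z) (pcol w).
have symLR a b c d e f g h : ent M a b d c e f h g = ent M a b c d e f g h.
  by rewrite (ker_syml KM) (ker_symr KM).
have [x y z w|x y z w|x y i j i' j'|x y z w|v hv vE] := @syz_surj k n char0 F minF T.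
- exact: (ker_anti KM).
- exact: symLR.
- by rewrite /T !prow_mv !pcol_mv (ker_symr KM).
- by rewrite /T (symLR (prow x) (prow w)); apply: (ker_cycle KM).
exists v => //; apply: ent_eqP => a b c d e f g h.
by rewrite syz_tensorE vE /T !prow_mv !pcol_mv.
Qed.

(** The coefficients of the substitution of A^T X B for the matrix X of variables. *)
Definition kron_coef (A B : 'M[k]_n) l m : k := A (prow m) (prow l) * B (pcol m) (pcol l).

Lemma act_S_subst A B s : act_S A B s = subst_lin (kron_coef A B) s.
Proof.
rewrite /act_S /subst_mx /subst_lin; congr (_ \mPo _).
apply: eq_from_tnth => l; rewrite !tnth_mktuple -{1}(mv_rowcol l) mxvecE mxE.
rewrite [RHS]sum_mv exchange_big; apply: eq_bigr => j _ /=.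
rewrite mxE mulr_suml; apply: eq_bigr => i _.
rewrite /kron_coef prow_mv pcol_mv !mxE -mul_mpolyC mpolyCM.
by rewrite -!mulrA; congr (_ * _); rewrite mulrC.
Qed.

Definition swap_coef (l m : 'I_(n * n)) : k := (l == mv (pcol m) (prow m))%:R.

Lemma swap_S_subst s : swap_S s = subst_lin swap_coef s.
Proof.
rewrite /swap_S /subst_mx /subst_lin; congr (_ \mPo _).
apply: eq_from_tnth => l; rewrite !tnth_mktuple -{1}(mv_rowcol l) mxvecE !mxE.
rewrite (bigD1 (mv (pcol l) (prow l))) //= big1 => [|m ne]; rewrite /swap_coef.
  by rewrite prow_mv pcol_mv mv_rowcol eqxx scale1r addr0.
case: eqP => [e|_]; last by rewrite scale0r.
by case/eqP: ne; rewrite e prow_mv pcol_mv mv_rowcol.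
Qed.

Lemma sum_ent (H : idx -> idx -> k) :
  \sum_i \sum_j H i j = \sum_x \sum_y \sum_z \sum_w
    H (quad (prow x) (prow y) (prow z) (prow w)) (quad (pcol x) (pcol y) (pcol z) (pcol w)).
Proof.
rewrite pair_bigA /= [RHS]pair_bigA [RHS]pair_bigA [RHS]pair_bigA /=.
pose I4 := ('I_(n * n) * 'I_(n * n) * 'I_(n * n) * 'I_(n * n))%type.
pose h (p : I4) : idx * idx := let: (x, y, z, w) := p in
  (quad (prow x) (prow y) (prow z) (prow w), quad (pcol x) (pcol y) (pcol z) (pcol w)).
pose h' (q : idx * idx) : I4 :=
  (mv (q.1 (inord 0)) (q.2 (inord 0)), mv (q.1 (inord 1)) (q.2 (inord 1)),
   mv (q.1 (inord 2)) (q.2 (inord 2)), mv (q.1 (inord 3)) (q.2 (inord 3))).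
rewrite (reindex h) /=; last first.
  exists h' => [[[[x y] z] w] _|[i j] _]; rewrite /h /h' /=.
    by rewrite !quadE !mv_rowcol.
  by rewrite !prow_mv !pcol_mv -!quadP.
by apply: eq_bigr => -[[[x y] z] w] _.
Qed.

Variable E : equivariant_structure F.

Lemma syz_tensor_act A B v : A \in unitmx -> B \in unitmx -> hom 3 4 v ->
  syz_tensor (res_act E 3 A B v) = tens A *m syz_tensor v *m (tens B)^T.
Proof.
move=> Au Bu hv; apply: ent_eqP => a b c d e f g h; rewrite syz_tensorE.
rewrite (@coef2_syz_f k n char0 F minF (kron_coef A B) (fun i => res_act E i A B)) //; last first.
- by move=> u s; rewrite -act_S_subst; apply: aug_act.
- by move=> i u; apply: diff_act.
- by move=> i r u; apply: res_act_graded.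
- by move=> i s u w; rewrite -act_S_subst; apply: res_act_semilinear.
rewrite [RHS]mxE big_rank.
under [RHS]eq_bigr do rewrite mxE big_rank mulr_suml.
rewrite [RHS]exchange_big /= (sum_ent (fun i j => tens A (enum_rank (quad a b c d)) (enum_rank i) *
  syz_tensor v (enum_rank i) (enum_rank j) * (tens B)^T (enum_rank j) (enum_rank (quad e f g h)))).
apply: eq_bigr => x _; apply: eq_bigr => y _; apply: eq_bigr => z _; apply: eq_bigr => w _.
rewrite syz_tensorE !mv_rowcol [(tens B)^T _ _]mxE !tensE !prod4 !quadE /kron_coef !prow_mv !pcol_mv.
ring.
Qed.

Lemma sum_swap (H : 'I_(n * n) -> k) m :
  \sum_l swap_coef l m * H l = H (mv (pcol m) (prow m)).
Proof.
rewrite (bigD1 (mv (pcol m) (prow m))) //= /swap_coef eqxx mul1r big1 ?addr0 // => l ne.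
by rewrite (negbTE ne) mul0r.
Qed.

Lemma syz_tensor_swap v : hom 3 4 v -> syz_tensor (res_swap E 3 v) = (syz_tensor v)^T.
Proof.
move=> hv; apply: ent_eqP => a b c d e f g h; rewrite syz_tensorE [RHS]mxE syz_tensorE.
rewrite (@coef2_syz_f k n char0 F minF swap_coef (fun i => res_swap E i)) //; last first.
- by move=> u s; rewrite -swap_S_subst; apply: aug_swap.
- by move=> i u; apply: diff_swap.
- by move=> i r u; apply: res_swap_graded.
- by move=> i s u w; rewrite -swap_S_subst; apply: res_swap_semilinear.
transitivity (\sum_x swap_coef x (mv a e) * \sum_y swap_coef y (mv b f) *
   \sum_z swap_coef z (mv c g) * \sum_w swap_coef w (mv d h) * coef2 z w (syz v x y)).
  apply: eq_bigr => x _; rewrite mulr_sumr; apply: eq_bigr => y _.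
  rewrite !mulr_sumr; apply: eq_bigr => z _; rewrite !mulr_sumr.
  by apply: eq_bigr => w _; rewrite !mulrA.
by rewrite !sum_swap !prow_mv !pcol_mv.
Qed.

(** Both sides are identified equivariantly with the same space of tensors. *)
Lemma degree4_iso : degree_component_iso E 3 4 (model n char0).
Proof.
(* The isomorphism sends x to the syzygy whose tensor is that of x. *)
have ex (x : swap_space (model n char0)) : exists v, hom 3 4 v /\ syz_tensor v = model_tensor x.
  have [v hv e] := syz_tensor_surj (@model_tensor_kernel k n char0 x).
  exists v; split; [exact: hv|exact: e].
pose phi x := proj1_sig (constructive_indefinite_description _ (ex x)).
have phiP x : hom 3 4 (phi x) /\ syz_tensor (phi x) = model_tensor x.
  exact: (proj2_sig (constructive_indefinite_description _ (ex x))).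
have phih x := (phiP x).1; have phiE x := (phiP x).2.
exists phi; split.
- move=> c x y; apply: syz_tensor_inj => //.
    move=> j m; rewrite !mxE mul_mpolyC => /msuppD_le; rewrite mem_cat.
    by case/orP => [/msuppZ_le|]; apply: phih.
  by rewrite syz_tensor_linear !phiE model_tensor_linear.
- by move=> x y e; apply: model_tensor_inj; rewrite -!phiE e.
- move=> v; split=> [hv|[x <-]//].
  have [x e] := model_tensor_surj char0 (syz_tensor_kernel hv); exists x.
  by apply: syz_tensor_inj => //; rewrite phiE.
- move=> A B x Au Bu; apply: syz_tensor_inj => //; first exact: res_act_graded.
  by rewrite syz_tensor_act // !phiE model_tensor_act.
move=> x; apply: syz_tensor_inj => //; first exact: res_swap_graded.
by rewrite syz_tensor_swap // !phiE model_tensor_iota.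
Qed.
End SyzygyTensor.

Lemma highest_weight_dim (k : fieldType) n lam (V : gl_rep k n) :
  has_highest_weight lam V -> (0 < gl_dim V)%N.
Proof.
move=> [v [nz _ _]]; rewrite lt0n; apply: contraNneq nz => d0; apply/eqP/matrixP => a b.
by have : (a < 0)%N by rewrite -d0.
Qed.

Theorem proposition7p3 (k : fieldType) (n : nat)
    (char0 : [pchar k] =i pred0) (n_gt0 : (0 < n)%N) :
  exists V4 V31 V211 : gl_rep k n,
    [/\ is_V [:: 4%N] V4, is_V [:: 3%N; 1%N] V31 & is_V [:: 2%N; 1%N; 1%N] V211] /\
    [/\ (3 <= n)%N -> gdet_irreducible (pair_rep V211 V4),
        (2 <= n)%N -> gdet_irreducible (square_rep true V31)
      & forall (F : graded_free_resolution k n) (E : equivariant_structure F),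
          minimal F ->
          degree_component_iso E 3 4
            (sum_rep (pair_rep V211 V4) (square_rep true V31))].
Proof.
have is4 := is_V4 char0 n_gt0; have is31 := is_V31 n char0; have is211 := is_V211 n char0.
have dim (lam : seq nat) (V : gl_rep k n) : is_V lam V -> (size lam <= n)%N -> (0 < gl_dim V)%N.
  by move=> irr le; move: irr; rewrite /is_V le => -[_ /highest_weight_dim].
exists (sm_rep (summand4 n char0)), (sm_rep (summand31 n char0)), (sm_rep (summand211 n char0)).
split=> //; split=> [n3|n2|F E minF].
- apply: pair_irreducible => //; [exact: primitive211|exact: primitive4| | | |].
  + exact: disjoint_211_4.
  + exact: disjoint_4_211.
  + exact: (dim _ _ is211).
  exact: (dim _ _ is4).
- by apply: square_irreducible => //; [exact: primitive31|exact: (dim _ _ is31)].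
exact: degree4_iso.
Qed.
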